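(* Let $m\in\mathbb N$. For each $n$ let $\mu^{(n)}$ be a Borel measure on $\mathbb R$ and $w_1^{(n)},\dots,w_m^{(n)}$ non-negative weight functions such that the system $d\mu^{(n)}_j=w^{(n)}_j\,d\mu^{(n)}$, $j=1,\dots,m$, is perfect, with nearest neighbor recurrence coefficients $a^{(n)}_{\vec k,j}$, $b^{(n)}_{\vec k,j}$. Let $\{\vec k_n\}_{n=0}^\infty\subset\mathbb Z_{\ge 0}^m$ be a path such that $|\vec k_n|=n$, $\vec k_{n+1}=\vec k_n+\vec e_{j_n}$ for some $j_n\in\{1,\dots,m\}$, and $\vec k_n/n\to\vec\nu$ as $n\to\infty$ for some $\vec\nu\in[0,1]^m$ with $|\vec \nu|=1$. Assume that there are numbers $a_j=a_j(\vec\nu)$ and $b_j=b_j(\vec\nu)$ such that for every $j\in\{1,\dots,m\}$ and every $s\in\mathbb Z$, $$a^{(n)}_{\vec k_{n+s},j}\to a_j,\qquad b^{(n)}_{\vec k_{n+s},j}\to b_j,\qquad n\to\infty.$$ For each $n$ let $x_1,\dots,x_n$ be random points distributed according to the Multiple Orthogonal Polynomial Ensemble with weights $w^{(n)}_1,\dots,w^{(n)}_m$, measure $\mu^{(n)}$ and multiplicities $\vec k_n$. Then for any polynomial $f$ with real coefficients, $$\sum_{j=1}^n f(x_j)-\mathbb E\Big[\sum_{j=1}^n f(x_j)\Big]\longrightarrow N\Big(0,\sum_{\ell=1}^\infty \ell f_\ell f_{-\ell}\Big)$$ in distribution as $n\to\infty$, where for $\ell\in\mathbb Z$ $$f_\ell=\frac1{2\pi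 i}\oint_\gamma f\Big(z+\sum_{j=1}^m\frac{a_j}{z-b_j}\Big)\frac{dz}{z^{\ell+1}}$$ and $\gamma$ is a simple closed contour with counter-clockwise orientation going around all the points $b_1,\dots,b_m$ and around the origin.
   Context: Notation: $|\vec k|=k_1+\dots+k_m$ for a vector $\vec k=(k_1,\dots,k_m)$; $\vec e_1,\dots,\vec e_m$ is the standard basis of $\mathbb R^m$. $N(0,\sigma^2)$ is the normal law with mean $0$ and variance $\sigma^2$. Multiple orthogonal polynomials: given Borel measures $\mu_1,\dots,\mu_m$ on $\mathbb R$ (for which the integrals below exist) and $\vec k\in\mathbb Z_{\ge0}^m$, $p_{\vec k}$ denotes the monic polynomial of smallest possible degree such that $\int p_{\vec k}(x)x^l\,d\mu_j(x)=0$ for $l=0,\dots,k_j-1$ and $j=1,\dots,m$. The system is perfect if $\deg p_{\vec k}=|\vec k|$ for every $\vec k\in\mathbb Z_{\ge0}^m$. For a perfect system there are nearest neighbor recurrence coefficients $a_{\vec k,j}$, $b_{\vec k,j}$ such that $$xp_{\vec k}(x)=p_{\vec k+\vec e_\ell}(x)+b_{\vec k,\ell}\,p_{\vec k}(x)+\sum_{j=1}^m a_{\vec k,j}\,p_{\vec k-\vec e_j}(x)$$ for every $\vec k\in\mathbb Z_{\ge0}^m$ and every $1\le\ell\le m$ (with $a_{\vec k,j}=0$, and the corresponding term absent, when $k_j=0$). For the $n$-th system all objects carry a superscript $(n)$. Multiple Orthogonal Polynomial Ensemble (MOPE) with weights $w_1,\dots,w_m$, measure $\mu$ and multiplicities $\vec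 k$, $|\vec k|=n$: the probability measure on $\mathbb R^n$ $$\frac1{Z_{\vec k}}\det\big(x_i^{j-1}\big)_{i,j=1}^n\det\big(g_j(x_i)\big)_{i,j=1}^n\prod_{j=1}^n d\mu(x_j),$$ where $g_1,\dots,g_n$ are the functions $w_1(x),xw_1(x),\dots,x^{k_1-1}w_1(x),\dots,w_m(x),xw_m(x),\dots,x^{k_m-1}w_m(x)$ and $Z_{\vec k}$ is the normalizing constant. It is a standing assumption that this expression is non-negative, i.e. defines a probability measure. *)

(* Defs.v *)
From HB Require Import structures.
From mathcomp Require Import all_boot all_order all_algebra.
From mathcomp Require Import complex.
From mathcomp Require Import all_classical all_reals all_analysis.

Set Implicit Arguments.
Unset Strict Implicit.
Unset Printing Implicit Defensive.

Import Order.TTheory GRing.Theory Num.Theory.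
Import numFieldNormedType.Exports.

Local Open Scope classical_set_scope.
Local Open Scope complex_scope.
Local Open Scope ring_scope.

(** * Multi-indices *)

Notation multi_index m := {ffun 'I_m -> nat}.

Section MultiIndex.
Variable m : nat.
Implicit Types (k : multi_index m) (j : 'I_m).

Definition mi_size k : nat := (\sum_(j < m) k j)%N.

Definition mi_succ k j : multi_index m := [ffun i => (k i + (i == j))%N].

(* Meaningful as [k - e_j] only when [0 < k j]. *)
Definition mi_pred k j : multi_index m := [ffun i => (k i - (i == j))%N].

End MultiIndex.

(** * Multiple orthogonal polynomials *)

Section MultipleOrthogonalPolynomials.
Variables (R : realType) (m : nat).
Variable mus : 'I_m -> {measure set (measurableTypeR R) -> \bar R}.
Implicit Types (k : multi_index m) (p : {poly R}).

Definition finite_moments : Prop := forall (j : 'I_m) (l : nat),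
  (mus j).-integrable setT (fun x : measurableTypeR R => (x ^+ l)%:E).

Definition mop_orthogonal k p : Prop := forall (j : 'I_m) (l : nat),
  (l < k j)%N -> (\int[mus j]_x (p.[x] * x ^+ l)%:E = 0)%E.

Definition is_mop k p : Prop :=
  [/\ p \is monic, mop_orthogonal k p &
      forall q : {poly R}, q \is monic -> mop_orthogonal k q ->
        (size p <= size q)%N].

(* When all the moments are finite exactly one polynomial satisfies
   [is_mop k]; the default value [0] is then never used. *)
Definition mop k : {poly R} := xget 0 [set p | is_mop k p].

Definition perfect : Prop := forall k, size (mop k) = (mi_size k).+1.

Definition nearest_neighbor_recurrence
    (a b : multi_index m -> 'I_m -> R) : Prop :=
  (forall k (l : 'I_m),
     'X * mop k = mop (mi_succ k l) + b k l *: mop k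
                  + \sum_(j < m | (0 < k j)%N) a k j *: mop (mi_pred k j))
  /\ (forall k (j : 'I_m), k j = 0%N -> a k j = 0).

End MultipleOrthogonalPolynomials.

(** * Multiple orthogonal polynomial ensembles *)

Section MOPE.
Variables (R : realType) (m : nat).
Variable mu : {measure set (measurableTypeR R) -> \bar R}.
Variable w : 'I_m -> measurableTypeR R -> R.

(* Integration against the [n]-fold product of [mu], as an iterated integral:
   this is the product measure when [mu] is sigma-finite.  For arbitrary [mu]
   and integrable weights, the ensemble below only involves [mu] on the set
   where some weight is positive, on which it is sigma-finite. *)
Fixpoint iterated_integral (n : nat) :
    (n.-tuple (measurableTypeR R) -> \bar R) -> \bar R :=
  match n with
  | 0%N => fun F => F [tuple]
  | n'.+1 => fun F =>
      (\int[mu]_x iterated_integral (fun t => F (cons_tuple x t)))%E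
  end.

Definition mope_functions (k : multi_index m) : seq (R -> R) :=
  flatten [seq [seq (fun x : R => x ^+ l * w j x) | l <- iota 0 (k j)]
          | j <- enum 'I_m].

Definition mope_weight (k : multi_index m) (n : nat)
    (x : n.-tuple (measurableTypeR R)) : R :=
  \det (\matrix_(i < n, j < n) ((tnth x i : R) ^+ j))
  * \det (\matrix_(i < n, j < n)
            (nth (fun=> 0) (mope_functions k) j (tnth x i))).

Definition mope_Z (k : multi_index m) (n : nat) : R :=
  fine (iterated_integral (fun x : n.-tuple _ => (mope_weight k x)%:E)).

(* Intended for [n = mi_size k].  No sign condition on [mope_weight] appears:
   when [Q] is a probability measure, the identity itself forces the density to
   be nonnegative almost everywhere. *)
Definition is_mope (k : multi_index m) (n : nat)
    (Q : set (n.-tuple (measurableTypeR R)) -> \bar R) : Prop :=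
  forall A : set (n.-tuple (measurableTypeR R)), measurable A ->
    Q A = iterated_integral
            (fun x => (\1_A x * ((mope_Z k n)^-1 * mope_weight k x))%:E).

End MOPE.

(** * Contour integrals *)

Section Contour.
Variable R : realType.
Implicit Types (g : R -> R[i]) (F : R[i] -> R[i]).

Definition C1_on (s t : R) (u : R -> R) : Prop :=
  {within `[s, t], continuous u} /\
  exists2 du : R -> R, {within `[s, t], continuous du} &
    forall x : R, x \in `]s, t[ -> is_derive x (1 : R) u (du x).

Definition piecewise_C1 g : Prop := exists s : seq R,
  [/\ s`_0 = 0, last 0 s = 1, sorted <%R s &
      forall i, (i.+1 < size s)%N ->
        C1_on s`_i s`_i.+1 (fun t => complex.Re (g t)) /\
        C1_on s`_i s`_i.+1 (fun t => complex.Im (g t))].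

(* A contour is parametrized by [0, 1]; the values of [g] elsewhere are
   irrelevant. *)
Definition simple_closed_contour g : Prop :=
  [/\ piecewise_C1 g, g 0 = g 1 & {in `[0, 1[ &, injective g}].

Definition velocity g (t : R) : R[i] :=
  derive1 (fun s => complex.Re (g s)) t
  +i* derive1 (fun s => complex.Im (g s)) t.

Definition contour_integral g F : R[i] :=
  let h t := F (g t) * velocity g t in
  Rintegral (@lebesgue_measure R) `[0, 1] (fun t => complex.Re (h t))
  +i* Rintegral (@lebesgue_measure R) `[0, 1] (fun t => complex.Im (h t)).

Definition two_pi_i : R[i] := 0 +i* (2 * pi).

Definition winding_number g (c : R[i]) : R[i] :=
  two_pi_i^-1 * contour_integral g (fun z => (z - c)^-1).

(* For a simple closed contour, winding number [1] means that [c] is in the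
   interior and that the orientation is counter-clockwise. *)
Definition goes_around_ccw g (c : R[i]) : Prop :=
  {in `[0, 1], forall t, g t != c} /\ winding_number g c = 1.

(* [z ^ (l + 1)] is an integer power. *)
Definition symbol_coef (m : nat) (a b : 'I_m -> R) g (f : {poly R})
    (l : int) : R[i] :=
  two_pi_i^-1 * contour_integral g (fun z =>
    (map_poly (real_complex R) f).[z + \sum_(j < m) (a j)%:C / (z - (b j)%:C)]
    / z ^ (l + 1)).

Definition complex_series_cvg (u : nat -> R[i]) (s : R[i]) : Prop :=
  (fun N => complex.Re (\sum_(1 <= l < N) u l)) @ \oo --> complex.Re s /\
  (fun N => complex.Im (\sum_(1 <= l < N) u l)) @ \oo --> complex.Im s.

End Contour.

(** * Convergence in distribution *)

Section Distribution.
Variable R : realType.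

(* [normal_prob] is parametrized by the standard deviation and is not the
   Dirac mass when it vanishes. *)
Definition gaussian (mean var : R) : set (measurableTypeR R) -> \bar R :=
  if var == 0 then \d_(mean : measurableTypeR R)
  else normal_prob mean (Num.sqrt var).

Definition cvg_in_distribution (d : nat -> measure_display)
    (T : forall n, measurableType (d n)) (P : forall n, probability (T n) R)
    (S : forall n, T n -> R) (Q : set (measurableTypeR R) -> \bar R) : Prop :=
  forall h : R -> R, continuous h -> (exists M : R, forall x, `|h x| <= M) ->
    (fun n => 'E_(P n)[fun o => h (S n o)]%E) @ \oo
      --> (\int[Q]_x (h x)%:E)%E.

End Distribution.

(* Main.v *)
Require Import Defs.
From HB Require Import structures.
From mathcomp Require Import all_boot all_order all_algebra.
From mathcomp Require Import fingroup perm finmap.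
From mathcomp Require Import complex.
From mathcomp Require Import all_classical all_reals all_analysis.
From mathcomp Require Import measurable_realfun.
From mathcomp Require Import ring lra zify.

Set Implicit Arguments.
Unset Strict Implicit.
Unset Printing Implicit Defensive.

Import Order.TTheory GRing.Theory Num.Theory.
Import numFieldNormedType.Exports.

Local Open Scope ring_scope.

(** Write S for the sum of the f(x_i), p_0, p_1, ... for the multiple orthogonal
    polynomials along the path, and H for the infinite matrix of multiplication
    by f in the basis of the p_r.

    Expanding both determinants of the ensemble and using that p_r, r >= n, is
    orthogonal to all the functions g_j, the generating function E[exp (t S)] is
    the determinant of the n x n corner of exp (t H), as a formal power series
    in t ([moment_corner_det]).  In block form, the upper right block of
    exp (t H) is its corner times the solution D of a Riccati equation
    D' = H12 + D H22 - H11 D - D H21 D, D(0) = 0, so that Jacobi's formula gives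
    the cumulant generating function: its derivative is tr H11 + tr (D H21)
    ([det_corner_log_deriv]).  All cumulants but the first are thus coefficients
    of tr (D H21).

    Multiplication by f raises the degree by at most d, hence H has at most d
    nonzero diagonals above the main one, and each coefficient of tr (D H21) is
    a fixed polynomial in entries of H at bounded distance from (n, n)
    ([block_riccati_trace]).  The lower part of H is full, but the nearest
    neighbor recurrence coefficients of a perfect system satisfy compatibility
    relations which let its entries be computed step by step along the path
    ([path_vS]).  Hence they become close to those of a limit operator: f applied
    to the operator q |-> X q + sum_j a_j (q %/ (X - b_j)), written in the Newton
    basis with nodes b_(j_0), b_(j_1), ... ([masym_f]).  No limit of the entries
    themselves is needed, only that the two matrices become close.

    Away from the first rows the limit operator is q |-> (N q) %/ M, where N / M
    is the rational function f (z + sum_j a_j / (z - b_j)).  Dividing N by M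
    splits it into the multiplication A by a polynomial and a strictly lowering
    Toeplitz operator B.  A and B commute far from the constants, and this solves
    the Riccati equation explicitly: D = exp (- t A11) (exp (t A))_12, with
    tr (D B21) = t tr (A12 B21) ([riccati_conj_corner], [trace_conj_corner]).
    So the second cumulant tends to tr (A12 B21), the higher ones tend to 0, and
    the centered moments of S tend to those of a Gaussian law
    ([moments_Y_limit]).

    This trace is the sum over l > 0 of l h_l h_(-l), where the h_l are the
    Laurent coefficients of N / M at infinity ([model_variance]).  By partial
    fractions along the contour these are the Fourier coefficients of the
    statement ([contour_residue], [variance_series]).  Finally Gaussian laws are determined
    by their moments: convergence of moments gives convergence of the
    expectation of cosines, hence of polynomials in sin (t x), hence of all
    bounded continuous functions ([tested_bounded_continuous]). *)

(** * Formal matrix series and the Riccati equation of a corner *)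

Section MatrixSeries.
Variable R : numFieldType.

Definition fmul (m n p : nat) (A : nat -> 'M[R]_(m, n))
    (B : nat -> 'M[R]_(n, p)) : nat -> 'M[R]_(m, p) :=
  fun k => \sum_(i < k.+1) A i *m B (k - i)%N.

Definition fcst (m n : nat) (M : 'M[R]_(m, n)) : nat -> 'M[R]_(m, n) :=
  fun k => if k == 0%N then M else 0.

Definition fder (m n : nat) (A : nat -> 'M[R]_(m, n)) : nat -> 'M[R]_(m, n) :=
  fun k => k.+1%:R *: A k.+1.

Definition fpoly (K m n : nat) (A : nat -> 'M[R]_(m, n)) : 'M[{poly R}]_(m, n) :=
  \matrix_(i, j) \poly_(k < K) A k i j.

Lemma coef_fpoly K m n (A : nat -> 'M[R]_(m, n)) i j k : (k < K)%N ->
  (fpoly K A i j)`_k = A k i j.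
Proof. by move=> kK; rewrite mxE coef_poly kK. Qed.

Lemma coef_fmul K m n p (A : nat -> 'M[R]_(m, n)) (B : nat -> 'M[R]_(n, p))
    i j k : (k < K)%N ->
  ((fpoly K A *m fpoly K B) i j)`_k = fmul A B k i j.
Proof.
move=> kK; rewrite mxE coef_sum summxE.
under eq_bigr => u _.
  rewrite coefM.
  under eq_bigr => l _.
    rewrite !coef_fpoly//; last 2 first.
    - by rewrite (leq_ltn_trans (leq_subr _ _)).
    - by rewrite (leq_ltn_trans _ kK)// -ltnS.
    over.
  over.
rewrite exchange_big/=; apply: eq_bigr => l _.
by rewrite mxE.
Qed.

Lemma coefM_eq K (p p' q q' : {poly R}) :
  (forall k, (k < K)%N -> p`_k = p'`_k) ->
  (forall k, (k < K)%N -> q`_k = q'`_k) ->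
  forall k, (k < K)%N -> (p * q)`_k = (p' * q')`_k.
Proof.
move=> pp qq k kK; rewrite !coefM; apply: eq_bigr => i _.
rewrite pp ?qq//.
- by rewrite (leq_ltn_trans (leq_subr _ _)).
- by rewrite (leq_ltn_trans _ kK)// -ltnS.
Qed.

Lemma coef_mulmx_eq K m n p (A A' : 'M[{poly R}]_(m, n))
    (B B' : 'M[{poly R}]_(n, p)) :
  (forall i j k, (k < K)%N -> (A i j)`_k = (A' i j)`_k) ->
  (forall i j k, (k < K)%N -> (B i j)`_k = (B' i j)`_k) ->
  forall i j k, (k < K)%N -> ((A *m B) i j)`_k = ((A' *m B') i j)`_k.
Proof.
move=> AA BB i j k kK; rewrite !mxE !coef_sum; apply: eq_bigr => u _.
by apply: (@coefM_eq K) => // l lK; [exact: AA|exact: BB].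
Qed.

Lemma fmulA m n p q (A : nat -> 'M[R]_(m, n)) (B : nat -> 'M[R]_(n, p))
    (C : nat -> 'M[R]_(p, q)) k : fmul (fmul A B) C k = fmul A (fmul B C) k.
Proof.
apply/matrixP => i j; rewrite -!(@coef_fmul k.+1)//.
transitivity ((fpoly k.+1 A *m fpoly k.+1 B *m fpoly k.+1 C) i j)`_k.
  apply: (@coef_mulmx_eq k.+1) => // a b l lk.
  by rewrite coef_fpoly// coef_fmul.
rewrite -mulmxA; apply: (@coef_mulmx_eq k.+1) => // a b l lk.
by rewrite coef_fpoly// coef_fmul.
Qed.

Lemma fmulDl m n p (A A' : nat -> 'M[R]_(m, n)) (B : nat -> 'M[R]_(n, p)) k :
  fmul (fun k => A k + A' k) B k = fmul A B k + fmul A' B k.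
Proof. by rewrite /fmul -big_split; apply: eq_bigr => i _; rewrite mulmxDl. Qed.

Lemma fmulDr m n p (A : nat -> 'M[R]_(m, n)) (B B' : nat -> 'M[R]_(n, p)) k :
  fmul A (fun k => B k + B' k) k = fmul A B k + fmul A B' k.
Proof. by rewrite /fmul -big_split; apply: eq_bigr => i _; rewrite mulmxDr. Qed.

Lemma fmulNl m n p (A : nat -> 'M[R]_(m, n)) (B : nat -> 'M[R]_(n, p)) k :
  fmul (fun k => - A k) B k = - fmul A B k.
Proof. by rewrite /fmul -sumrN; apply: eq_bigr => i _; rewrite mulNmx. Qed.

Lemma fmulNr m n p (A : nat -> 'M[R]_(m, n)) (B : nat -> 'M[R]_(n, p)) k :
  fmul A (fun k => - B k) k = - fmul A B k.
Proof. by rewrite /fmul -sumrN; apply: eq_bigr => i _; rewrite mulmxN. Qed.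

Lemma fmul_cstl m n p (M : 'M[R]_(m, n)) (B : nat -> 'M[R]_(n, p)) k :
  fmul (fcst M) B k = M *m B k.
Proof.
rewrite /fmul big_ord_recl/= subn0 big1 ?addr0// => i _.
by rewrite /fcst/= mul0mx.
Qed.

Lemma fmul_cstr m n p (A : nat -> 'M[R]_(m, n)) (M : 'M[R]_(n, p)) k :
  fmul A (fcst M) k = A k *m M.
Proof.
rewrite /fmul big_ord_recr/= subnn big1 ?add0r// => i _.
by rewrite /fcst subn_eq0 leqNgt ltn_ord mulmx0.
Qed.

Lemma fder_fmul m n p (A : nat -> 'M[R]_(m, n)) (B : nat -> 'M[R]_(n, p)) k :
  fder (fmul A B) k = fmul (fder A) B k + fmul A (fder B) k.
Proof.
rewrite /fder /fmul scaler_sumr.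
transitivity (\sum_(i < k.+2) (i%:R *: (A i *m B (k.+1 - i)%N)
    + (k.+1 - i)%:R *: (A i *m B (k.+1 - i)%N))).
  apply: eq_bigr => i _; rewrite -scalerDl -natrD subnKC//.
  by rewrite -ltnS.
rewrite big_split/=; congr (_ + _).
  rewrite big_ord_recl/= scale0r add0r; apply: eq_bigr => i _.
  by rewrite /bump/= add1n subSS scalemxAl.
rewrite big_ord_recr/= subnn scale0r addr0; apply: eq_bigr => i _.
by rewrite -scalemxAr subSn// -ltnS.
Qed.

Lemma fmul_eq m n p (A A' : nat -> 'M[R]_(m, n)) (B B' : nat -> 'M[R]_(n, p)) k :
  (forall i, (i <= k)%N -> A i = A' i) -> (forall i, (i <= k)%N -> B i = B' i) ->
  fmul A B k = fmul A' B' k.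
Proof.
move=> AA BB; apply: eq_bigr => i _; rewrite AA ?BB ?leq_subr//.
by rewrite -ltnS.
Qed.

(** Uniqueness for linear systems: each coefficient of A' = A C determines the
    next coefficient of A. *)
Lemma fder_eq0 m n (A : nat -> 'M[R]_(m, n)) (C : nat -> 'M[R]_n) :
  A 0%N = 0 -> (forall k, fder A k = fmul A C k) -> forall k, A k = 0.
Proof.
move=> A0 dA k; elim/ltn_ind: k => -[|k] IH //.
have := dA k; rewrite /fder /fmul big1; last first.
  by move=> i _; rewrite IH ?mul0mx.
by move/eqP; rewrite scaler_eq0 pnatr_eq0/= => /eqP.
Qed.

Definition fexp n (A : 'M[R]_n) : nat -> 'M[R]_n := fun k => (k`!%:R)^-1 *: A ^+ k.

Lemma fder_exp n (A : 'M[R]_n) k : fder (fexp A) k = A *m fexp A k.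
Proof.
rewrite /fder /fexp scalerA factS natrM invfM mulrA divff ?pnatr_eq0// mul1r.
by rewrite -scalemxAr exprS.
Qed.

Lemma fexpC n (A : 'M[R]_n) k : A *m fexp A k = fexp A k *m A.
Proof. by rewrite /fexp -scalemxAr -scalemxAl -[A *m _]exprS exprSr. Qed.


(** Jacobi's formula, obtained by differentiating the Leibniz expansion one
    row at a time and recognizing Laplace expansions. *)
Lemma deriv_det n (M : 'M[{poly R}]_n) :
  (\det M)^`() = \tr (\adj M *m map_mx (@deriv R) M).
Proof.
have deriv_prod (I : finType) (F : I -> {poly R}) (s : seq I) : uniq s ->
    (\prod_(i <- s) F i)^`() =
      \sum_(i <- s) (F i)^`() * \prod_(j <- s | j != i) F j.
  elim: s => [_|x s IH /= /andP[xs us]]; first by rewrite !big_nil derivC.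
  rewrite !big_cons eqxx/= derivM IH//; congr (_ * _ + _).
    rewrite big_seq_cond [RHS]big_seq_cond; apply: eq_bigl => i.
    by rewrite andbT; case: eqP => [->|]; rewrite ?(negPf xs) ?andbT.
  rewrite big_distrr/=; apply: eq_big_seq => j js.
  rewrite big_cons; case: eqP => [xj|_]; first by rewrite xj js in xs.
  by rewrite mulrCA.
have -> : \tr (\adj M *m map_mx (@deriv R) M) =
    \sum_i \sum_j (M i j)^`() * cofactor M i j.
  rewrite /mxtrace exchange_big/=; apply: eq_bigr => j _.
  by rewrite mxE; apply: eq_bigr => i _; rewrite !mxE mulrC.
rewrite /determinant raddf_sum/=.
transitivity (\sum_i \sum_(s : 'S_n) (-1) ^+ s * ((M i (s i))^`() *
     \prod_(j | j != i) M j (s j))).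
  rewrite exchange_big/=; apply: eq_bigr => s _.
  rewrite -big_distrr/= -signr_odd; case: odd; rewrite ?expr1 ?expr0 ?mulN1r ?mul1r ?derivN;
    by rewrite (deriv_prod _ _ _ (index_enum_uniq _)).
apply: eq_bigr => i _.
pose M' := \matrix_(a, b) if a == i then (M a b)^`() else M a b.
transitivity (\det M').
  apply: eq_bigr => s _; congr (_ * _).
  rewrite [RHS](bigD1 i)//= mxE eqxx; congr (_ * _).
  by apply: eq_bigr => j /negPf ji; rewrite mxE ji.
rewrite (expand_det_row M' i); apply: eq_bigr => j _.
rewrite mxE eqxx; congr (_ * _); rewrite /cofactor; congr (_ * \det _).
by apply/matrixP => a b; rewrite !mxE eq_sym (negPf (neq_lift _ _)).
Qed.

Section Riccati.
Variables n K : nat.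
Variables (H11 : 'M[R]_n) (H12 : 'M[R]_(n, K)) (H21 : 'M[R]_(K, n)) (H22 : 'M[R]_K).

Definition riccati_rhs (D : nat -> 'M[R]_(n, K)) k : 'M[R]_(n, K) :=
  fcst H12 k + D k *m H22 - H11 *m D k - fmul (fun k => D k *m H21) D k.

(** Truncated at order T, since estimates are only available for finitely many
    coefficients at a time. *)
Definition riccati T (D : nat -> 'M[R]_(n, K)) : Prop :=
  D 0%N = 0 /\ forall k, (k < T)%N -> fder D k = riccati_rhs D k.

Lemma riccati_rhs_eq D D' k : (forall i, (i <= k)%N -> D i = D' i) ->
  riccati_rhs D k = riccati_rhs D' k.
Proof.
move=> DD; rewrite /riccati_rhs DD//; congr (_ - _).
by apply: fmul_eq => i ik; rewrite ?DD.
Qed.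

(** The right-hand side at order k only involves D 0, ..., D k, so the
    coefficients can be computed one after the other. *)
Lemma riccati_exists : exists D, forall T, riccati T D.
Proof.
pose st (D : nat -> 'M[R]_(n, K)) k : 'M[R]_(n, K) :=
  (k.+1%:R)^-1 *: riccati_rhs D k.
(* L k is correct up to the index k only; the solution is its diagonal *)
pose fix L k : nat -> 'M[R]_(n, K) :=
  if k is k'.+1 then fun i => if (i <= k')%N then L k' i else st (L k') k'
  else fun=> 0.
have LE k i : (i <= k)%N -> L k i = L i i.
  elim: k i => [|k IH] i; first by rewrite leqn0 => /eqP ->.
  rewrite leq_eqVlt => /orP[/eqP ->//|]; rewrite ltnS => ik /=.
  by rewrite ik IH.
exists (fun i => L i i) => T; split=> // k _.
rewrite /fder /= ltnn /st scalerA divff ?pnatr_eq0// scale1r.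
by apply: riccati_rhs_eq => i ik; rewrite LE.
Qed.

Lemma riccati_unique T D D' : riccati T D -> riccati T D' ->
  forall k, (k <= T)%N -> D k = D' k.
Proof.
move=> [D0 dD] [D'0 dD']; elim/ltn_ind => -[|k] IH kT; first by rewrite D0.
have : fder D k = fder D' k.
  rewrite dD// dD'//; apply: riccati_rhs_eq => i ik.
  by apply: IH => //; rewrite ?ltnS// (leq_trans ik)// ltnW.
by move/(scalerI _); apply; rewrite pnatr_eq0.
Qed.

Let H := block_mx H11 H12 H21 H22.
Definition corner k : 'M[R]_n := ulsubmx (fexp H k).
Let V k : 'M[R]_(n, K) := ursubmx (fexp H k).

Lemma fder_cornerE k : fder corner k = corner k *m H11 + V k *m H21.
Proof.
have -> : fder corner k = ulsubmx (fder (fexp H) k).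
  by apply/matrixP => i j; rewrite /fder /corner !mxE.
rewrite fder_exp fexpC /corner.
rewrite -{1}(submxK (fexp H k)) mulmx_block block_mxKul.
by [].
Qed.

Lemma fder_VE k : fder V k = corner k *m H12 + V k *m H22.
Proof.
have -> : fder V k = ursubmx (fder (fexp H) k).
  by apply/matrixP => i j; rewrite /fder /V !mxE.
rewrite fder_exp fexpC /corner /V.
rewrite -{1}(submxK (fexp H k)) mulmx_block block_mxKur.
by [].
Qed.

Variable D : nat -> 'M[R]_(n, K).
Hypothesis Dric : forall T, riccati T D.

(** Both sides solve the same linear differential equation: the difference
    X = V - corner D satisfies X' = X (H22 - H21 D) and X(0) = 0. *)
Lemma V_factor k : V k = fmul corner D k.
Proof.
have [D0 _] := Dric 0; have dD k' : fder D k' = riccati_rhs D k'.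
  by have [_] := Dric k'.+1; apply.
pose X k := V k - fmul corner D k.
suff : forall k, X k = 0 by move/(_ k)/eqP; rewrite subr_eq0 => /eqP.
apply: (@fder_eq0 _ _ _ (fun k => fcst H22 k - H21 *m D k)).
  rewrite /X /V /fexp fact0 invr1 scale1r -[H ^+ 0]/(1%:M) /fmul big_ord1 subn0 D0 mulmx0 subr0.
  by rewrite scalar_mx_block block_mxKur.
move=> l.
have -> : fder X l = fder V l - fder (fmul corner D) l.
  by rewrite /fder /X scalerBr.
rewrite fder_VE fder_fmul.
have -> : fmul (fder corner) D l =
    fmul corner (fun k => H11 *m D k) l + fmul V (fun k => H21 *m D k) l.
  have -> : fmul (fder corner) D l = fmul (fun k => corner k *m H11 + V k *m H21) D l.
    by apply: fmul_eq => // i _; exact: fder_cornerE.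
  by rewrite fmulDl; congr (_ + _); apply: eq_bigr => i _; rewrite mulmxA.
have -> : fmul corner (fder D) l = corner l *m H12 +
     fmul corner D l *m H22 - fmul corner (fun k => H11 *m D k) l
     - fmul (fmul corner D) (fun k => H21 *m D k) l.
  have -> : fmul corner (fder D) l = fmul corner (fun k => fcst H12 k +
      D k *m H22 - H11 *m D k - fmul (fun k => D k *m H21) D k) l.
    by apply: fmul_eq => // i _; exact: dD.
  rewrite (fmulDr corner (fun k => _ + _ - _) (fun k => - _)) fmulNr.
  rewrite (fmulDr corner (fun k => _ + _) (fun k => - _)) fmulNr.
  rewrite fmulDr fmul_cstr; congr (_ + _ - _ - _).
    rewrite /fmul mulmx_suml; apply: eq_bigr => i _; exact: mulmxA.
  rewrite fmulA; apply: fmul_eq => // i _; apply: eq_bigr => j _.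
  by rewrite mulmxA.
have -> : fmul X (fun k => fcst H22 k - H21 *m D k) l =
   V l *m H22 - fmul V (fun k => H21 *m D k) l -
   (fmul corner D l *m H22 - fmul (fmul corner D) (fun k => H21 *m D k) l).
  rewrite /X fmulDl fmulNl !fmulDr !fmul_cstr.
  by rewrite !(fmulNr _ (fun k => H21 *m D k)).
rewrite !opprD !opprK !addrA.
set a := corner l *m H12; set b := V l *m H22; set c := fmul corner _ l.
set e := fmul V _ l; set f := (fmul corner D l *m _); set g := fmul (fmul _ _) _ l.
apply/matrixP => i j; rewrite !mxE.
ring.
Qed.

Definition trace_coef k : R := (if k == 0%N then \tr H11 else 0) + \tr (D k *m H21).

(** With U the corner, U' = U H11 + V H21 = U (H11 + D H21) by [V_factor], and
    Jacobi's formula gives (det U)' = det U tr (H11 + D H21). *)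
Lemma det_corner_log_deriv T k : (k < T)%N ->
  (\det (fpoly T.+1 corner))`_k.+1 *+ k.+1 =
  \sum_(i < k.+1) (\det (fpoly T.+1 corner))`_i * trace_coef (k - i)%N.
Proof.
move=> kT; set M := fpoly T.+1 corner.
pose G k := fcst H11 k + D k *m H21.
have dU l : fder corner l = fmul corner G l.
  rewrite fder_cornerE fmulDr fmul_cstr; congr (_ + _).
  rewrite V_factor /fmul mulmx_suml; apply: eq_bigr => i _.
  by rewrite mulmxA.
rewrite -coef_deriv deriv_det.
have -> : (\tr (\adj M *m map_mx (@deriv R) M))`_k =
    (\tr (\adj M *m (M *m fpoly T.+1 G)))`_k.
  rewrite /mxtrace !coef_sum; apply: eq_bigr => i _.
  apply: (@coef_mulmx_eq T) => // a b l lT.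
  rewrite mxE coef_deriv /M coef_fpoly// coef_fmul ?ltnS 1?ltnW// -dU.
  by rewrite /fder [RHS]mxE mulr_natl.
rewrite mulmxA mul_adj_mx mul_scalar_mx mxtraceZ coefM.
apply: eq_bigr => i _; congr (_ * _).
rewrite /mxtrace coef_sum /trace_coef.
have ki : (k - i < T.+1)%N by rewrite ltnS (leq_trans (leq_subr _ _))// ltnW.
transitivity (\tr (G (k - i)%N)).
  by apply: eq_bigr => j _; rewrite coef_fpoly.
by rewrite /G mxtraceD /fcst; case: eqP => // _; rewrite mxtrace0.
Qed.

End Riccati.

Lemma fexpN_exp n (A : 'M[R]_n) k : fmul (fexp (- A)) (fexp A) k = fcst 1%:M k.
Proof.
case: k => [|k].
  by rewrite /fmul big_ord1 /fexp fact0 invr1 !scale1r -[_ ^+ _]/(1%:M) mul1mx.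
have : fder (fmul (fexp (- A)) (fexp A)) k = 0.
  rewrite fder_fmul.
  rewrite (@fmul_eq _ _ _ _ (fun k => - (fexp (- A) k *m A)) _ (fexp A)) //; last first.
    by move=> i _; rewrite fder_exp fexpC mulmxN.
  rewrite [X in _ + X](@fmul_eq _ _ _ _ (fexp (- A)) _ (fun k => A *m fexp A k)) //; last first.
    by move=> i _; rewrite fder_exp.
  rewrite fmulNl addrC; apply/eqP; rewrite subr_eq0; apply/eqP.
  by apply: eq_bigr => i _; rewrite mulmxA.
by rewrite /fder => /eqP; rewrite scaler_eq0 pnatr_eq0/= => /eqP ->.
Qed.

Lemma fexp_expN n (A : 'M[R]_n) k : fmul (fexp A) (fexp (- A)) k = fcst 1%:M k.
Proof. by rewrite -{1}(opprK A) fexpN_exp. Qed.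

Section TriangularModel.
Variables n K T : nat.
Variables (A11 : 'M[R]_n) (A12 : 'M[R]_(n, K)) (A22 : 'M[R]_K).
Variables (B11 : 'M[R]_n) (B21 : 'M[R]_(K, n)) (B22 : 'M[R]_K).

Let A := block_mx A11 A12 0 A22.
Definition upper_exp k : 'M[R]_(n, K) := ursubmx (fexp A k).
Definition conj_corner := fmul (fexp (- A11)) upper_exp.

Lemma fexp_triangular k :
  ulsubmx (fexp A k) = fexp A11 k /\ dlsubmx (fexp A k) = 0.
Proof.
suff [ul dl] : ulsubmx (A ^+ k) = A11 ^+ k /\ dlsubmx (A ^+ k) = 0.
  split; apply/matrixP => i j.
    by rewrite !mxE -ul !mxE.
  by have /matrixP/(_ i j) := dl; rewrite !mxE => ->; rewrite mulr0.
elim: k => [|k [ul dl]].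
  by rewrite -![_ ^+ 0]/(1%:M) scalar_mx_block block_mxKul block_mxKdl.
rewrite !exprSr -[A ^+ k * A]/(A ^+ k *m A) -(submxK (A ^+ k)) mulmx_block.
by rewrite block_mxKul block_mxKdl ul dl !mul0mx !mulmx0 !addr0.
Qed.

Lemma fder_upper_exp k :
  fder upper_exp k = fexp A11 k *m A12 + upper_exp k *m A22.
Proof.
have -> : fder upper_exp k = ursubmx (fder (fexp A) k).
  by apply/matrixP => i j; rewrite /fder /upper_exp !mxE.
rewrite fder_exp fexpC /upper_exp.
rewrite -{1}(submxK (fexp A k)) mulmx_block block_mxKur.
by have [-> _] := fexp_triangular k.
Qed.

Lemma conj_corner0 : conj_corner 0%N = 0.
Proof.
rewrite /conj_corner /fmul big_ord1 /upper_exp /fexp -[A ^+ 0]/(1%:M).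
by rewrite fact0 invr1 !scale1r scalar_mx_block block_mxKur mulmx0.
Qed.

Lemma fder_conj_corner k : fder conj_corner k =
  fcst A12 k + conj_corner k *m A22 - A11 *m conj_corner k.
Proof.
rewrite fder_fmul addrC -addrA.
rewrite [X in X + _](@fmul_eq _ _ _ _ (fexp (- A11)) _
   (fun k => fexp A11 k *m A12 + upper_exp k *m A22)) //; last first.
  by move=> i _; rewrite fder_upper_exp.
rewrite fmulDr -addrA; congr (_ + _).
  transitivity (fmul (fmul (fexp (- A11)) (fexp A11)) (fcst A12) k).
    by rewrite fmulA; apply: fmul_eq => // i _; rewrite fmul_cstr.
  rewrite fmul_cstr fexpN_exp /fcst; case: eqP => _; last by rewrite mul0mx.
  by rewrite mul1mx.
congr (_ + _).
  by rewrite /conj_corner /fmul mulmx_suml; apply: eq_bigr => i _; rewrite mulmxA.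
rewrite /conj_corner /fmul mulmx_sumr -sumrN; apply: eq_bigr => i _.
by rewrite fder_exp !mulNmx mulmxA.
Qed.

Hypothesis comm22 : forall k, (k <= T)%N ->
  upper_exp k *m B22 = B11 *m upper_exp k.
Hypothesis comm21 : forall i j, (i <= T)%N -> (j <= T)%N ->
  (fexp A11 i *m B11 + upper_exp i *m B21 - B11 *m fexp A11 i) *m conj_corner j = 0.
Hypothesis comm_trace : forall k, (k <= T)%N ->
  \tr (conj_corner k *m (A22 *m B21 - B21 *m A11)) = 0.

Lemma upper_exp_factor k : upper_exp k = fmul (fexp A11) conj_corner k.
Proof.
rewrite -fmulA (@fmul_eq _ _ _ _ (fcst 1%:M) _ upper_exp) //.
  by rewrite fmul_cstl mul1mx.
by move=> i _; rewrite fexp_expN.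
Qed.

Lemma conj_corner_mulB22 k : (k <= T)%N -> conj_corner k *m B22 =
  B11 *m conj_corner k + fmul (fun k => conj_corner k *m B21) conj_corner k.
Proof.
move=> kT.
have -> : conj_corner k *m B22 =
    fmul (fexp (- A11)) (fmul (fun i => B11 *m fexp A11 i) conj_corner) k.
  rewrite {1}/conj_corner {1}/fmul mulmx_suml; apply: eq_bigr => i _.
  rewrite -mulmxA comm22 ?(leq_trans (leq_subr _ _))// upper_exp_factor.
  by rewrite /fmul mulmx_sumr; congr (_ *m _); apply: eq_bigr => j _; rewrite mulmxA.
have -> : fmul (fexp (- A11)) (fmul (fun i => B11 *m fexp A11 i) conj_corner) k =
   fmul (fexp (- A11)) (fmul (fun i => fexp A11 i *m B11 + upper_exp i *m B21)
        conj_corner) k.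
  apply: fmul_eq => // i iT; apply: eq_bigr => j _; apply/eqP.
  rewrite -subr_eq0 -mulmxBl -opprB mulNmx comm21 ?oppr0//.
    by rewrite (leq_trans _ kT)// (leq_trans _ iT)// -ltnS.
  by rewrite (leq_trans _ kT)// (leq_trans (leq_subr _ _)).
rewrite -fmulA (@fmul_eq _ _ _ _ (fun i => fcst B11 i + conj_corner i *m B21) _
   conj_corner) //.
  by rewrite fmulDl fmul_cstl.
move=> i _; rewrite fmulDr; congr (_ + _).
  transitivity (fmul (fmul (fexp (- A11)) (fexp A11)) (fcst B11) i).
    by rewrite fmulA; apply: fmul_eq => // j _; rewrite fmul_cstr.
  rewrite fmul_cstr fexpN_exp /fcst; case: eqP => _; last by rewrite mul0mx.
  by rewrite mul1mx.
by rewrite /conj_corner /fmul mulmx_suml; apply: eq_bigr => j _; rewrite mulmxA.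
Qed.

(** If A and B commuted, conjugating by exp (t A) would fix B; on the blocks this
    amounts to comm22 and comm21, the latter being needed only against the
    conjugated corner.  The quadratic term of the equation then comes from
    [conj_corner_mulB22]. *)
Lemma riccati_conj_corner :
  riccati (A11 + B11) A12 B21 (A22 + B22) T conj_corner.
Proof.
split=> [|k /ltnW kT]; first exact: conj_corner0.
rewrite fder_conj_corner /riccati_rhs mulmxDr mulmxDl conj_corner_mulB22//.
rewrite !opprD !addrA.
set a := fcst _ _; set b := conj_corner k *m A22; set c := B11 *m _.
set e := fmul _ _ _; set f := A11 *m _.
by apply/matrixP => i j; rewrite !mxE; ring.
Qed.

(** The derivative of tr (D B21) equals tr (A12 B21) at order 0; the remaining
    terms form the trace of D against a commutator, which vanishes. *)
Lemma trace_conj_corner k : (0 < k <= T.+1)%N ->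
  \tr (conj_corner k *m B21) = if k == 1%N then \tr (A12 *m B21) else 0.
Proof.
case: k => // k /=; rewrite ltnS => kT.
have : k.+1%:R * \tr (conj_corner k.+1 *m B21) =
    if k == 0%N then \tr (A12 *m B21) else 0.
  rewrite -mxtraceZ scalemxAl -[_ *: _]/(fder conj_corner k) fder_conj_corner.
  rewrite mulmxBl mulmxDl -addrA mxtraceD -[RHS]addr0; congr (_ + _).
    by rewrite /fcst; case: eqP => // _; rewrite mul0mx mxtrace0.
  rewrite mxtraceD -mulmxA -(mulmxA A11) raddfN/= (mxtrace_mulC A11) -mulmxA.
  by rewrite -raddfN -raddfD/= -mulmxBr comm_trace.
case: k kT => [|k] kT /=; first by rewrite mul1r.
by move/eqP; rewrite mulf_eq0 pnatr_eq0/= => /eqP.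
Qed.

End TriangularModel.
End MatrixSeries.

(** * Coordinates in a graded basis of polynomials *)

Section Coordinates.
Variable R : fieldType.
Variable e : nat -> {poly R}.
Hypothesis size_e : forall r, size (e r) = r.+1.
Hypothesis monic_e : forall r, e r \is monic.

Implicit Types (p q : {poly R}) (O : {poly R} -> {poly R}).

(** Greedy elimination of leading terms, which makes the coordinates total
    functions without inverting a change of basis. *)
Fixpoint crdN (N : nat) (q : {poly R}) : nat -> R :=
  if N is N'.+1 then
    fun s => if s == N' then q`_N' else crdN N' (q - q`_N' *: e N') s
  else fun=> 0.

Definition crd (q : {poly R}) (s : nat) : R := crdN (size q) q s.

Lemma crdN_linear N a p q s :
  crdN N (a *: p + q) s = a * crdN N p s + crdN N q s.
Proof.
elim: N p q => [|N IH] p q /=; first by rewrite mulr0 addr0.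
case: eqP => _; first by rewrite coefD coefZ.
rewrite -IH; congr (crdN N _ s); rewrite coefD coefZ scalerDl scalerBr scalerA.
by rewrite opprD addrACA.
Qed.

Lemma crdN_ge N q s : (N <= s)%N -> crdN N q s = 0.
Proof.
elim: N q => [//|N IH] q /= Ns; rewrite gtn_eqF//; apply: IH; exact: ltnW.
Qed.

Lemma size_sub_top N (q : {poly R}) : (size q <= N.+1)%N ->
  (size (q - q`_N *: e N)%R <= N)%N.
Proof.
move=> qN; apply/leq_sizeP => j; rewrite leq_eqVlt => /orP[/eqP <-|Nj].
  have := monic_e N; rewrite monicE lead_coefE size_e/= => /eqP eN.
  by rewrite coefB coefZ eN mulr1 subrr.
rewrite coefB coefZ [q`_j]nth_default ?(leq_trans qN)//.
by rewrite [(e N)`_j]nth_default ?size_e// mulr0 subr0.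
Qed.

Lemma crdN_expand N q : (size q <= N)%N -> q = \sum_(s < N) crdN N q s *: e s.
Proof.
elim: N q => [|N IH] q qN.
  by rewrite big_ord0; apply/eqP; rewrite -size_poly_leq0.
rewrite big_ord_recr/= eqxx -[LHS](subrK (q`_N *: e N)); congr (_ + _).
rewrite {1}(IH _ (size_sub_top qN)); apply: eq_bigr => i _.
by rewrite ltn_eqF.
Qed.

Lemma crdN_stable N q s : (size q <= N)%N -> crdN N.+1 q s = crdN N q s.
Proof.
move=> qN /=; rewrite (nth_default 0 qN) scale0r subr0.
by case: eqP => // ->; rewrite crdN_ge.
Qed.

Lemma crdE N q s : (size q <= N)%N -> crd q s = crdN N q s.
Proof.
move/subnK => <-; elim: (N - size q)%N => [//|k IH].
by rewrite addSn crdN_stable ?leq_addl.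
Qed.

Lemma crd_linear a p q s : crd (a *: p + q) s = a * crd p s + crd q s.
Proof.
pose N := maxn (size (a *: p + q)) (maxn (size p) (size q)).
rewrite !(@crdE N) ?crdN_linear// /N.
- by rewrite !leq_max leqnn !orbT.
- by rewrite !leq_max leqnn !orbT.
- by rewrite leq_maxl.
Qed.

Lemma crd0 s : crd 0 s = 0.
Proof. by rewrite /crd size_poly0. Qed.

Lemma crdD p q s : crd (p + q) s = crd p s + crd q s.
Proof. by have := crd_linear 1 p q s; rewrite scale1r mul1r. Qed.

Lemma crdZ a p s : crd (a *: p) s = a * crd p s.
Proof. by rewrite -[a *: p]addr0 crd_linear crd0 addr0. Qed.

Lemma crdN_opp p s : crd (- p) s = - crd p s.
Proof. by rewrite -scaleN1r crdZ mulN1r. Qed.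

Lemma crdB p q s : crd (p - q) s = crd p s - crd q s.
Proof. by rewrite crdD crdN_opp. Qed.

Lemma crd_sum (I : Type) (r : seq I) (P : pred I) (F : I -> {poly R}) s :
  crd (\sum_(i <- r | P i) F i) s = \sum_(i <- r | P i) crd (F i) s.
Proof.
elim: r => [|x r IH]; first by rewrite !big_nil crd0.
by rewrite !big_cons; case: (P x) => //; rewrite crdD IH.
Qed.

Lemma crd_ge q s : (size q <= s)%N -> crd q s = 0.
Proof. exact: crdN_ge. Qed.

Lemma crd_expand N q : (size q <= N)%N -> q = \sum_(s < N) crd q s *: e s.
Proof.
by move=> qN; rewrite {1}(crdN_expand qN); apply: eq_bigr => s _; rewrite -crdE.
Qed.

Lemma crd_e r s : crd (e r) s = (s == r)%:R.
Proof.
rewrite /crd size_e /=; have := monic_e r.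
rewrite monicE lead_coefE size_e/= => /eqP ->.
case: eqP => // _; rewrite scale1r subrr.
suff -> : forall N, crdN N 0 s = 0 by [].
by elim=> [//|N IH] /=; rewrite coef0 scale0r subr0 IH if_same.
Qed.

Section Operators.


Lemma linear_sum_crd O N q : linear O -> (size q <= N)%N ->
  O q = \sum_(s < N) crd q s *: O (e s).
Proof.
move=> lO qN; pose L : {linear {poly R} -> {poly R}} :=
  HB.pack O (GRing.isLinear.Build _ _ _ _ O lO).
have LE p : O p = L p by [].
rewrite LE {1}(crd_expand qN) raddf_sum; apply: eq_bigr => i _.
exact: (linearZZ L).
Qed.

Lemma crd_op O N q s : linear O -> (size q <= N)%N ->
  crd (O q) s = \sum_(u < N) crd q u * crd (O (e u)) s.
Proof.
move=> lO qN; rewrite (linear_sum_crd lO qN) crd_sum.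
by apply: eq_bigr => u _; rewrite crdZ.
Qed.

(** Row i holds the coordinates of O (e i): matrices act on row vectors, so that
    an operator raising degrees by d has d diagonals above the main one. *)
Definition opmx N O : 'M[R]_N := \matrix_(i, j) crd (O (e i)) j.
Definition crdv N q : 'rV[R]_N := \row_j crd q j.

Lemma crdv_opmx N O q : linear O -> (size q <= N)%N ->
  crdv N q *m opmx N O = crdv N (O q).
Proof.
move=> lO qN; apply/rowP => j; rewrite !mxE (crd_op j lO qN).
by apply: eq_bigr => u _; rewrite !mxE.
Qed.

Lemma row_opmx N O i : row i (opmx N O) = crdv N (O (e i)).
Proof. by apply/rowP => j; rewrite !mxE. Qed.

Lemma row_crdv N (i : 'I_N) : row i 1%:M = crdv N (e i).
Proof. by apply/rowP => j; rewrite !mxE crd_e val_eqE eq_sym. Qed.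

Lemma row_opmxX N O k (i : 'I_N) : linear O ->
  (forall l, (l < k)%N -> (size (iter l O (e i)) <= N)%N) ->
  row i (opmx N O ^+ k) = crdv N (iter k O (e i)).
Proof.
move=> lO; elim: k => [|k IH] sz; first by rewrite -[_ ^+ 0]/(1%:M) row_crdv.
rewrite exprSr row_mul IH; last by move=> l lk; apply: sz; rewrite ltnS ltnW.
by rewrite crdv_opmx// sz.
Qed.

Lemma opmxX N O k (i j : 'I_N) : linear O ->
  (forall l, (l < k)%N -> (size (iter l O (e i)) <= N)%N) ->
  (opmx N O ^+ k) i j = crd (iter k O (e i)) j.
Proof.
move=> lO sz; have := row_opmxX lO sz => /rowP/(_ j).
by rewrite !mxE.
Qed.

Lemma opmxX_mul N O O' k (i j : 'I_N) : linear O -> linear O' ->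
  (forall l, (l <= k)%N -> (size (iter l O (e i)) <= N)%N) ->
  (opmx N O ^+ k *m opmx N O') i j = crd (O' (iter k O (e i))) j.
Proof.
move=> lO lO' sz; have : row i (opmx N O ^+ k *m opmx N O') =
    crdv N (O' (iter k O (e i))).
  rewrite row_mul row_opmxX// ?crdv_opmx//; first exact: sz.
  by move=> l lk; apply: sz; exact: ltnW.
by move/rowP/(_ j); rewrite !mxE.
Qed.

Lemma mul_opmxX N O O' k (i j : 'I_N) : linear O -> linear O' ->
  (forall l, (l < k)%N -> (size (iter l O (O' (e i))) <= N)%N) ->
  (opmx N O' *m opmx N O ^+ k) i j = crd (iter k O (O' (e i))) j.
Proof.
move=> lO lO' sz; have : row i (opmx N O' *m opmx N O ^+ k) =
    crdv N (iter k O (O' (e i))).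
  rewrite row_mul row_opmx; elim: k sz => [|k IH] sz; first by rewrite mulmx1.
  rewrite exprSr -[_ * _]/(_ *m _) mulmxA IH; last by move=> l lk; apply: sz; rewrite ltnS ltnW.
  by rewrite crdv_opmx// sz.
by move/rowP/(_ j); rewrite !mxE.
Qed.

End Operators.

End Coordinates.

(** * Multiplication plus a Toeplitz operator: an exactly solvable model *)

(** By induction on k: H12 only couples indices within distance d of the cut n, and
    each further order of the recursion widens this by at most d.  The block H21
    below the diagonal may be full. *)
Lemma riccati_local (R : numFieldType) n K (H11 : 'M[R]_n) (H12 : 'M[R]_(n, K))
    (H21 : 'M[R]_(K, n)) (H22 : 'M[R]_K) d T D :
  (forall (i : 'I_n) (j : 'I_K), (i + d < n + j)%N -> H12 i j = 0) ->
  (forall i j : 'I_n, (i + d < j)%N -> H11 i j = 0) ->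
  (forall i j : 'I_K, (i + d < j)%N -> H22 i j = 0) ->
  riccati H11 H12 H21 H22 T D ->
  forall k, (k <= T)%N -> forall (i : 'I_n) (j : 'I_K),
    (i + k * d < n)%N || (k * d <= j)%N -> D k i j = 0.
Proof.
move=> h12 h11 h22 [D0 dD]; elim/ltn_ind => -[|k] IH kT i j ij.
  by rewrite D0 mxE.
have IHk l : (l <= k)%N -> forall (i : 'I_n) (j : 'I_K),
    (i + l * d < n)%N || (l * d <= j)%N -> D l i j = 0.
  by move=> lk; apply: IH => //; rewrite (leq_trans lk)// ltnW.
suff : fder D k i j = 0.
  by rewrite mxE => /eqP; rewrite mulf_eq0 pnatr_eq0/= => /eqP.
have ile l : (l <= k)%N -> (l * d <= k * d)%N by move=> lk; rewrite leq_mul2r lk orbT.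
have jn := ltn_ord j; have in_ := ltn_ord i.
move: ij; rewrite mulSn => ij.
rewrite dD// /riccati_rhs !mxE.
have -> : fcst H12 k i j = 0.
  rewrite /fcst; case: eqP => _; last by rewrite mxE.
  apply: h12; case/orP: ij; lia.
rewrite big1; last first.
  move=> u _; have [ku|uk] := leqP (k * d) u; first by rewrite IHk ?mul0r// ku orbT.
  case/orP: ij => ij; first by rewrite IHk ?mul0r//; apply/orP; left; lia.
  by rewrite h22 ?mulr0//; lia.
rewrite big1; last first.
  move=> v _; have [vi|iv] := leqP v (i + d); last by rewrite h11 ?mul0r.
  rewrite IHk ?mulr0//; case/orP: ij => ij; apply/orP; [left|right]; lia.
rewrite /fmul summxE big1 ?(add0r, oppr0, subr0)// => l _.
have lk : (l <= k)%N by rewrite -ltnS.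
case/orP: ij => ij.
  rewrite !mxE big1// => v _; rewrite mxE big1 ?mul0r// => u _.
  by rewrite IHk ?mul0r//; apply/orP; left; have := ile _ lk; lia.
rewrite !mxE big1// => v _; rewrite IHk ?mulr0 ?leq_subr//; apply/orP; right.
by have := ile _ (leq_subr l k); lia.
Qed.

Section LimitModel.
Variable R : numFieldType.
Variable beta : nat -> R.
Implicit Types p q u v : {poly R}.

(** The basis in which dividing by 'X - b_j has coordinates depending only on the
    nodes met along the path; it is the limit of the orthogonal basis. *)
Definition newton r : {poly R} := \prod_(i < r) ('X - (beta i)%:P).

Lemma newtonS r : newton r.+1 = newton r * ('X - (beta r)%:P).
Proof. by rewrite /newton big_ord_recr. Qed.

Lemma monic_newton r : newton r \is monic.
Proof. by rewrite /newton monic_prod// => i _; exact: monicXsubC. Qed.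

Lemma size_newton r : size (newton r) = r.+1.
Proof.
elim: r => [|r IH]; first by rewrite /newton big_ord0 size_poly1.
by rewrite newtonS size_Mmonic ?monicXsubC ?monic_neq0 ?monic_newton// IH size_XsubC addn2.
Qed.

Local Notation crd := (crd newton).

Lemma newton_addn n j :
  newton (n + j) = newton n * \prod_(i < j) ('X - (beta (n + i))%:P).
Proof. by rewrite /newton big_split_ord. Qed.

(** The projection onto the span of the newton j with n <= j. *)
Definition tailN n q := newton n * (q %/ newton n).

Lemma tail_newton n j : tailN n (newton j) = if (j < n)%N then 0 else newton j.
Proof.
rewrite /tailN; case: ltnP => [jn|nj].
  by rewrite divp_small ?mulr0// !size_newton.
by rewrite -{1}(subnKC nj) newton_addn mulKp ?monic_neq0 ?monic_newton//
  -newton_addn subnKC.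
Qed.

Lemma tailN_linear n : linear (tailN n).
Proof.
by move=> a p q; rewrite /tailN divpD divpZl mulrDr scalerAr.
Qed.

Lemma crd_tailN n q s : crd (tailN n q) s = if (s < n)%N then 0 else crd q s.
Proof.
rewrite (crd_op size_newton monic_newton s (@tailN_linear n) (leqnn (size q))).
transitivity (\sum_(u < size q)
    crd q u * ((s == u)%:R * (if (s < n)%N then 0 else 1))).
  apply: eq_bigr => u _; rewrite tail_newton; case: ltnP => un.
    rewrite crd0; case: eqP => [->|]; last by rewrite mul0r !mulr0.
    by rewrite un !mulr0.
  rewrite (crd_e size_newton monic_newton).
  case: eqP => [->|_]; last by rewrite mul0r.
  by rewrite ltnNge un !mulr1.
case: ltnP => sn; first by rewrite big1// => u _; rewrite !mulr0.
under eq_bigr do rewrite mulr1.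
rewrite [in RHS](crd_expand size_newton monic_newton (leqnn (size q))).
rewrite crd_sum; apply: eq_bigr => u _.
by rewrite crdZ (crd_e size_newton monic_newton).
Qed.

Lemma crd_mul_newton p r s : (s < r)%N -> crd (p * newton r) s = 0.
Proof.
move=> sr; have -> : p * newton r = tailN r (p * newton r).
  by rewrite /tailN mulpK ?monic_neq0 ?monic_newton// mulrC.
by rewrite crd_tailN sr.
Qed.

(** In the basis of powers and for v = 'X^k this shifts coordinates: truncated
    division is a Toeplitz operator with symbol u / v. *)
Definition toeplitz u v q := (u * q) %/ v.

Lemma toeplitz_linear u v : linear (toeplitz u v).
Proof.
by move=> a p q; rewrite /toeplitz mulrDr divpD -scalerAr divpZl.
Qed.

Lemma size_toeplitz_small u v q : v \is monic -> (size u < size v)%N ->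
  (size (toeplitz u v q) <= (size q).-1)%N.
Proof.
move=> mv uv; rewrite /toeplitz size_divp ?monic_neq0//.
suff aux a b c w : (a <= (b + c).-1 -> b < w -> a - w.-1 <= c.-1)%N.
  exact: (aux _ _ _ _ (size_polyMleq u q) uv).
by lia.
Qed.

(** Symbols multiply under composition, up to a correction supported near the
    constants, as for Toeplitz operators on the half line. *)
Lemma toeplitz_comp u v v' q : v \is monic -> v' \is monic ->
  (size (toeplitz u v' (q %/ v) - toeplitz u (v * v') q)%R <= size u)%N.
Proof.
move=> mv mv'; have -> : toeplitz u v' (q %/ v) - toeplitz u (v * v') q =
    - (toeplitz u (v * v') (q %% v)).
  have uq : u * q = v * (u * (q %/ v)) + u * (q %% v).
    by rewrite {1}(divp_eq q v) mulrDr [v * _]mulrC mulrA.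
  rewrite /toeplitz uq divpD opprD addrA divp_pmul2l ?monic_neq0//.
  by rewrite subrr sub0r.
rewrite size_polyN /toeplitz size_divp ?mulf_neq0 ?monic_neq0//.
rewrite (size_Mmonic (monic_neq0 mv) mv').
suff aux a b c w w' : (a <= (b + c).-1 -> c < w -> 0 < w' ->
    a - (w + w').-1.-1 <= b)%N.
  apply: (aux _ _ _ _ _ (size_polyMleq u (q %% v)) (ltn_modpN0 q (monic_neq0 mv))).
  by rewrite size_poly_gt0 monic_neq0.
by lia.
Qed.

Lemma mul_toeplitz p u v q : v \is monic ->
  (size (p * toeplitz u v q - toeplitz (p * u) v q)%R <= size p)%N.
Proof.
move=> mv; rewrite /toeplitz -mulrA.
have := toeplitz_comp p (u * q) mv (monic1 R).
by rewrite /toeplitz divp1 mulr1.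
Qed.

Section Model.
Variables (hp hr W : {poly R}) (d : nat).
Hypothesis monW : W \is monic.
Hypothesis size_hr : (size hr < size W)%N.
Hypothesis size_hp : (size hp <= d.+1)%N.

Let opA q := hp * q.
Let opB q := toeplitz hr W q.
Definition opH q := hp * q + toeplitz hr W q.

Lemma opA_linear : linear opA.
Proof. by move=> a p q; rewrite /opA mulrDr scalerAr. Qed.

Lemma opB_linear : linear opB. Proof. exact: toeplitz_linear. Qed.

Lemma iter_opA k q : iter k opA q = hp ^+ k * q.
Proof. by elim: k => [|k IH]; rewrite ?mul1r//= IH /opA exprS mulrA. Qed.

Lemma size_hpX k : (size (hp ^+ k) <= (k * d).+1)%N.
Proof.
apply: (leq_trans (size_poly_exp_leq _ _)); rewrite ltnS mulnC leq_mul2l.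
by rewrite -subn1 leq_subLR add1n size_hp orbT.
Qed.

Lemma size_iter_opA k q : (size (iter k opA q) <= size q + k * d)%N.
Proof.
rewrite iter_opA; have [->|q0] := eqVneq q 0; first by rewrite mulr0 size_poly0.
suff aux a b c w : (a <= (b + c).-1 -> b <= w.+1 -> 0 < c -> a <= c + w)%N.
  by apply: (aux _ _ _ _ (size_polyMleq _ q) (size_hpX k)); rewrite size_poly_gt0.
by lia.
Qed.

Lemma size_opB q : (size (opB q) <= (size q).-1)%N.
Proof. exact: size_toeplitz_small. Qed.

Lemma size_commutator k q :
  (size (opB (iter k opA q) - iter k opA (opB q))%R <= (k * d).+1)%N.
Proof.
rewrite -opprB size_polyN !iter_opA; apply: leq_trans (size_hpX k).
have := mul_toeplitz (hp ^+ k) hr q monW; rewrite /opB.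
by rewrite /toeplitz -[_ * hr * q]mulrA [hp ^+ k * (hr * q)]mulrCA.
Qed.

Section Blocks.
Variables n K T : nat.

Local Notation opmx := (opmx newton).
Let A : 'M[R]_(n + K) := opmx (n + K) opA.
Let B : 'M[R]_(n + K) := opmx (n + K) opB.
Let A11 := ulsubmx A. Let A12 := ursubmx A. Let A22 := drsubmx A.
Let B11 := ulsubmx B. Let B21 := dlsubmx B. Let B22 := drsubmx B.

Lemma dlsubmx_opA : dlsubmx A = 0.
Proof. 
apply/matrixP => i j; rewrite !mxE /= crd_mul_newton//.
by rewrite (leq_trans (ltn_ord j))// leq_addr. Qed.

Lemma ursubmx_opB : ursubmx B = 0.
Proof.
apply/matrixP => i j; rewrite !mxE /= crd_ge//.
apply: (leq_trans (size_opB _)); rewrite size_newton/=.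
by have := ltn_ord i; lia.
Qed.

Lemma opA_block : A = block_mx A11 A12 0 A22.
Proof. by rewrite -dlsubmx_opA submxK. Qed.

Lemma commutator_small k (i c : 'I_(n + K)) :
  (i + (k * d).+1 <= n + K)%N -> (k * d < c)%N ->
  (A ^+ k *m B) i c = (B *m A ^+ k) i c.
Proof.
move=> ik kc; apply/eqP; rewrite -subr_eq0.
rewrite (opmxX_mul size_newton monic_newton) //; last 3 first.
- exact: opA_linear.
- exact: opB_linear.
- move=> l lk; apply: leq_trans (size_iter_opA _ _) _; rewrite size_newton.
  have : (l * d <= k * d)%N by rewrite leq_mul2r lk orbT.
  by lia.
rewrite (mul_opmxX size_newton monic_newton) //; last 3 first.
- exact: opA_linear.
- exact: opB_linear.
- move=> l lk; apply: leq_trans (size_iter_opA _ _) _.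
  have lkd : (l * d <= k * d)%N by rewrite leq_mul2r ltnW// orbT.
  apply: leq_trans (leq_add (size_opB _) lkd) _; rewrite size_newton.
  by lia.
by rewrite -crdB crd_ge ?(leq_trans (size_commutator _ _)).
Qed.

(** q |-> hp^k toeplitz q and q |-> toeplitz (hp^k q) differ by a polynomial of
    degree less than the size of hp^k ([mul_toeplitz]): the commutator vanishes
    away from the first columns, and truncation only affects the last rows. *)
Lemma fexp_commutator_small k (i c : 'I_(n + K)) :
  (i + (k * d).+1 <= n + K)%N -> (k * d < c)%N ->
  (fexp A k *m B - B *m fexp A k) i c = 0.
Proof.
move=> ik kc; rewrite /fexp -scalemxAl -scalemxAr -scalerBr mxE [X in _ * X]mxE.
by rewrite [X in _ + X]mxE commutator_small// subrr mulr0.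
Qed.

Lemma opA_band (i c : 'I_(n + K)) : (i + d < c)%N -> A i c = 0.
Proof.
move=> ic; rewrite mxE crd_ge//.
apply: leq_trans (size_iter_opA 1 (newton i)) _.
by rewrite size_newton mul1n.
Qed.

Local Notation conj := (conj_corner A11 A12 A22).

Lemma conj_corner_local k (i : 'I_n) (j : 'I_K) :
  (i + k * d < n)%N || (k * d <= j)%N -> conj k i j = 0.
Proof.
apply: (@riccati_local _ _ _ A11 A12 0 A22 d k) => //.
- by move=> a b ab; rewrite mxE [LHS]mxE opA_band.
- by move=> a b ab; rewrite mxE [LHS]mxE opA_band.
- by move=> a b ab; rewrite mxE [LHS]mxE opA_band//= -addnA ltn_add2l.
split; first exact: conj_corner0.
move=> l _; rewrite fder_conj_corner /riccati_rhs [X in _ - _ - X](_ : _ = 0) ?subr0//.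
by rewrite /fmul big1// => u _; rewrite mulmx0 mul0mx.
Qed.

Lemma fexp_blocks k : fexp A k = block_mx (fexp A11 k) (upper_exp A11 A12 A22 k)
   0 (drsubmx (fexp A k)).
Proof.
rewrite /upper_exp -opA_block -[LHS]submxK.
have [ul dl] := fexp_triangular A11 A12 A22 k.
by rewrite -opA_block in ul dl; rewrite ul dl.
Qed.

Lemma opB_block : B = block_mx B11 0 B21 B22.
Proof. by rewrite -ursubmx_opB submxK. Qed.

Lemma fexp_commutator k : fexp A k *m B - B *m fexp A k =
  block_mx
   (fexp A11 k *m B11 + upper_exp A11 A12 A22 k *m B21 - B11 *m fexp A11 k)
   (upper_exp A11 A12 A22 k *m B22 - B11 *m upper_exp A11 A12 A22 k)
   (drsubmx (fexp A k) *m B21 - B21 *m fexp A11 k)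
   (drsubmx (fexp A k) *m B22 - (B21 *m upper_exp A11 A12 A22 k +
        B22 *m drsubmx (fexp A k))).
Proof.
rewrite {1 2}fexp_blocks {1 2}opB_block !mulmx_block opp_block_mx add_block_mx.
by rewrite !mul0mx !mulmx0 !addr0 !add0r.
Qed.

Hypothesis n_large : (2 * (T * d) + d < n)%N.
Hypothesis K_large : (T.+1 * d < K)%N.

(** The commutator of A and B is supported near the constants and, because of
    the truncation, near the end of the matrix, both far from the cut at n where
    conj lives: these are the hypotheses of [riccati_conj_corner]. *)
Lemma model_riccati : riccati (A11 + B11) A12 B21 (A22 + B22) T conj /\
  forall k, (0 < k <= T.+1)%N ->
  \tr (conj k *m B21) = if k == 1%N then \tr (A12 *m B21) else 0.
Proof.
have leT k : (k <= T)%N -> (k * d <= T * d)%N by move=> kT; rewrite leq_mul2r kT orbT.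
have comm22 k : (k <= T)%N -> upper_exp A11 A12 A22 k *m B22 =
    B11 *m upper_exp A11 A12 A22 k.
  move=> kT; apply/eqP; rewrite -subr_eq0; apply/eqP/matrixP => i j; rewrite [RHS]mxE.
  have := @fexp_commutator_small k (lshift K i) (rshift n j).
  rewrite fexp_commutator block_mxEur; apply => /=;
    have := leT _ kT; have := ltn_ord i; lia.
have comm21 i j : (i <= T)%N -> (j <= T)%N ->
  (fexp A11 i *m B11 + upper_exp A11 A12 A22 i *m B21 - B11 *m fexp A11 i)
   *m conj j = 0.
  move=> iT jT; apply/matrixP => r s; rewrite [LHS]mxE [RHS]mxE big1// => v _.
  have [vT|Tv] := leqP v (T * d).
    rewrite (conj_corner_local (k := j)) ?mulr0//; apply/orP; left.
    by have := leT _ jT; lia.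
  have := @fexp_commutator_small i (lshift K r) (lshift K v).
  rewrite fexp_commutator block_mxEul => -> /=; first by rewrite mul0r.
    by have := leT _ iT; have := ltn_ord r; lia.
  by have := leT _ iT; lia.
have comm_trace k : (k <= T)%N -> \tr (conj k *m (A22 *m B21 - B21 *m A11)) = 0.
  move=> kT; rewrite /mxtrace big1// => i _; rewrite mxE big1// => j _.
  have [kj|jk] := leqP (k * d) j.
    by rewrite conj_corner_local ?mul0r// kj orbT.
  have [ik|ki] := ltnP (i + k * d) n.
    by rewrite conj_corner_local ?mul0r// ik.
  have f1 m (M : 'M[R]_m) : fexp M 1 = M.
    by rewrite /fexp factS fact0 muln1 invr1 scale1r expr1.
  have := @fexp_commutator_small 1 (rshift n j) (lshift K i).
  rewrite fexp_commutator block_mxEdl !f1 => -> /=; first by rewrite mulr0.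
    by rewrite mul1n; have := leT _ kT; lia.
  by rewrite mul1n; have := leT _ kT; lia.
split; first exact: riccati_conj_corner.
by move=> k kT; apply: (@trace_conj_corner _ _ _ T).
Qed.

End Blocks.

Lemma coefM_top p q a b : (size p <= a.+1)%N -> (size q <= b.+1)%N ->
  (p * q)`_(a + b) = p`_a * q`_b.
Proof.
move=> pa qb; have ab : (a < (a + b).+1)%N by rewrite ltnS leq_addr.
rewrite coefM (bigD1 (Ordinal ab))//= addKn big1 ?addr0// => i.
rewrite -val_eqE/= neq_ltn => /orP[ia|ai].
  by rewrite [q`__]nth_default ?mulr0// (leq_trans qb)//; lia.
by rewrite [p`__]nth_default ?mul0r// (leq_trans pa).
Qed.

(** For monic v this is minus the residue at infinity of u / v, i.e. the sum of
    its residues at the roots of v. *)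
Definition residue u v := (u %% v)`_(size v).-2.

Lemma crd_top n q : (size q <= n.+1)%N -> crd q n = q`_n.
Proof. by move=> qn; rewrite (crdE newton n qn) /= eqxx. Qed.

Lemma crd_toeplitz_residue u n : crd (toeplitz u W (newton n.+1)) n = residue u W.
Proof.
have W0 := monic_neq0 monW.
have -> : toeplitz u W (newton n.+1) =
    (u %/ W) * newton n.+1 + toeplitz (u %% W) W (newton n.+1).
  rewrite /toeplitz {1}(divp_eq u W) mulrDl divpD -mulrA [W * _]mulrC mulrA.
  by rewrite mulpK.
rewrite crdD crd_mul_newton// add0r.
have rW : (size (u %% W)%R < size W)%N := ltn_modpN0 u W0.
rewrite /residue; set r := u %% W in rW *.
have [w|w] := leqP (size W) 1.
  have -> : r = 0 by apply/eqP; rewrite -size_poly_leq0 -ltnS (leq_trans rW).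
  by rewrite /toeplitz mul0r div0p crd0 coef0.
set Q := toeplitz r W (newton n.+1).
have sQ : (size Q <= n.+1)%N.
  by apply: leq_trans (size_toeplitz_small _ monW rW) _; rewrite size_newton.
rewrite crd_top//.
have [w' wE] : exists w', size W = w'.+2 by exists (size W).-2; move: w; case: (size W) => [|[]].
have top : (r * newton n.+1)`_(w'.+1 + n) = Q`_n.
  rewrite (divp_eq (r * newton n.+1) W) coefD mulrC coefM_top ?wE//.
  rewrite [(_ %% _)`__]nth_default ?addr0.
    have := monW; rewrite monicE lead_coefE wE/= => /eqP ->.
    by rewrite mul1r.
  have := ltn_modpN0 (r * newton n.+1) W0; rewrite wE ltnS => h.
  by apply: leq_trans h _; rewrite leq_addr.
rewrite -top addSnnS coefM_top ?size_newton//; last by rewrite -ltnS -wE.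
have := monic_newton n.+1; rewrite monicE lead_coefE size_newton/= => /eqP ->.
by rewrite mulr1 wE.
Qed.

Lemma tailN_mulX n q :
  tailN n.+1 ('X * q) = crd q n *: newton n.+1 + 'X * tailN n.+1 q.
Proof.
pose O1 p := tailN n.+1 ('X * p).
pose O2 p := crd p n *: newton n.+1 + 'X * tailN n.+1 p.
have l1 : linear O1.
  by move=> a p p'; rewrite /O1 mulrDr -scalerAr tailN_linear.
have l2 : linear O2.
  move=> a p p'; rewrite /O2 crd_linear tailN_linear scalerDl mulrDr -scalerAr.
  by rewrite -scalerA scalerDr addrACA.
rewrite -[LHS]/(O1 q) -[RHS]/(O2 q).
rewrite (linear_sum_crd size_newton monic_newton l1 (leqnn (size q))).
rewrite (linear_sum_crd size_newton monic_newton l2 (leqnn (size q))).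
apply: eq_bigr => j _; congr (_ *: _); rewrite /O1 /O2.
have XE : 'X * newton j = newton j.+1 + beta j *: newton j.
  by rewrite newtonS mulrBr -mul_polyC -addrA [_%:P * _]mulrC addNr addr0 mulrC.
rewrite XE addrC tailN_linear !tail_newton (crd_e size_newton monic_newton).
rewrite ltnS; case: (ltngtP j n) => [jn|nj|->].
- by rewrite ltnS jn scaler0 add0r scale0r mulr0 addr0.
- by rewrite ltnS ltnNge (ltnW nj)/= scale0r add0r XE addrC.
- by rewrite ltnS ltnn !scaler0 mulr0 scale1r addr0 add0r.
Qed.

(** tr (A12 B21) when A multiplies by p and B is the Toeplitz operator of u / W:
    the part of p newton_i beyond the cut n is brought back below it. *)
Definition tau n p u := \sum_(i < n.+1) crd (toeplitz u W (tailN n.+1 (p * newton i))) i.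

(** Multiplying by 'X moves exactly one basis vector across the cut; its
    contribution is the coefficient of toeplitz (newton n.+1) along a diagonal,
    which is a residue. *)
Lemma tau_mulX n l u : (l < n)%N ->
  tau n 'X^(l.+1) u = residue ('X^l * u) W + tau n 'X^l (u * 'X).
Proof.
move=> ln; rewrite /tau.
transitivity (\sum_(i < n.+1) (crd ('X^l * newton i) n * crd (toeplitz u W (newton n.+1)) i
   + crd (toeplitz (u * 'X) W (tailN n.+1 ('X^l * newton i))) i)).
  apply: eq_bigr => i _; rewrite exprS -mulrA tailN_mulX toeplitz_linear crd_linear.
  by congr (_ + crd _ _); rewrite /toeplitz mulrA.
rewrite big_split/=; congr (_ + _).
set q := toeplitz u W (newton n.+1).
transitivity (crd ('X^l * q) n).
  have lX : linear (fun p => 'X^l * p : {poly R}).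
    by move=> a p p'; rewrite mulrDr scalerAr.
  have qN : (size q <= n.+1 + size q)%N by rewrite leq_addl.
  rewrite (crd_op size_newton monic_newton n lX qN) big_split_ord/=.
  rewrite [X in _ + X]big1 ?addr0; last first.
    by move=> i _; rewrite crd_mul_newton ?mulr0// leq_addr.
  by apply: eq_bigr => i _; rewrite mulrC.
rewrite -(crd_toeplitz_residue _ n); apply/eqP; rewrite -subr_eq0 -crdB crd_ge//.
by apply: leq_trans (mul_toeplitz _ _ _ monW) _; rewrite size_polyXn.
Qed.

Lemma tau_Xn n l u : (l <= n)%N -> tau n 'X^l u = l%:R * residue ('X^(l.-1) * u) W.
Proof.
elim: l u => [|l IH] u ln.
  rewrite mul0r /tau big1// => i _.
  by rewrite expr0 mul1r tail_newton ltn_ord /toeplitz mulr0 div0p crd0.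
rewrite tau_mulX// IH 1?ltnW//=; case: l {IH} ln => [|l] ln.
  by rewrite /= mul0r addr0 [RHS]mul1r.
by rewrite /= [u * 'X]mulrC mulrA -exprSr -[in RHS]natr1 mulrDl mul1r addrC.
Qed.

Lemma tau_linear n a p p' u : tau n (a *: p + p') u = a * tau n p u + tau n p' u.
Proof.
rewrite /tau big_distrr -big_split/=; apply: eq_bigr => i _.
by rewrite mulrDl -scalerAl tailN_linear toeplitz_linear crd_linear.
Qed.

(** The sum over l of l h_l h_(-l) for the Laurent coefficients h at infinity of
    hp + hr / W. *)
Definition model_variance : R :=
  \sum_(l < d.+1) l%:R * hp`_l * residue ('X^(l.-1) * hr) W.

Lemma tau_variance n : (d <= n)%N -> tau n hp hr = model_variance.
Proof.
move=> dn; have tau0 : tau n 0 hr = 0.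
  by rewrite /tau big1// => i _; rewrite mul0r /tailN div0p mulr0 /toeplitz mulr0 div0p crd0.
have hpE : hp = \sum_(l < d.+1) hp`_l *: 'X^l.
  rewrite -poly_def; apply/polyP => i; rewrite coef_poly; case: ltnP => // di.
  by rewrite nth_default// (leq_trans size_hp).
rewrite {1}hpE /model_variance.
elim/big_ind2 : _ => //; last first.
  move=> l _; rewrite -[_ *: _]addr0 tau_linear tau0 addr0 tau_Xn; last first.
    by rewrite (leq_trans _ dn)// -ltnS.
  by rewrite mulrCA mulrA.
by move=> x p y p' <- <-; have := tau_linear n 1 p p' hr; rewrite mul1r scale1r.
Qed.

(** An index crosses the cut upwards through A and comes back through B, so the
    trace is [tau] with p = hp and u = hr. *)
Lemma trace_model n K : (d <= n)%N -> (d < K)%N ->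
  \tr (ursubmx (opmx newton (n.+1 + K) opA) *m dlsubmx (opmx newton (n.+1 + K) opB)) =
  model_variance.
Proof.
move=> dn dK; rewrite -(tau_variance dn) /tau /mxtrace; apply: eq_bigr => i _.
rewrite mxE; set q := hp * newton i.
have sq : (size (tailN n.+1 q) <= n.+1 + K)%N.
  have : (size q <= n.+1 + K)%N.
    apply: leq_trans (size_iter_opA 1 (newton i)) _; rewrite size_newton mul1n.
    by have := ltn_ord i; lia.
  rewrite /tailN => sqN; have [qn|qn] := ltnP (size q) (size (newton n.+1)).
    by rewrite divp_small// mulr0 size_poly0.
  rewrite mulrC; have -> : q %/ newton n.+1 * newton n.+1 = q - q %% newton n.+1.
    by rewrite {2}(divp_eq q (newton n.+1)) addrK.
  apply: leq_trans (size_polyD _ _) _; rewrite geq_max sqN size_polyN/=.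
  by apply: leq_trans (ltnW (ltn_modpN0 _ (monic_neq0 (monic_newton _)))) _;
     rewrite size_newton; lia.
rewrite (crd_op size_newton monic_newton i (toeplitz_linear hr W) sq).
rewrite big_split_ord/= [X in X + _]big1 ?add0r; last first.
  by move=> j _; rewrite crd_tailN ltn_ord mul0r.
by apply: eq_bigr => j _; rewrite !mxE/= crd_tailN ltnNge leq_addr.
Qed.

Lemma opmx_opH N :
  opmx newton N opH = opmx newton N opA + opmx newton N opB.
Proof. by apply/matrixP => i j; rewrite !mxE crdD. Qed.

(** Uniqueness identifies D with the explicit solution of [model_riccati]. *)
Lemma trace_coef_model n K T D :
  (2 * (T * d) + d <= n)%N -> (T.+1 * d < K)%N ->
  let H := opmx newton (n.+1 + K) opH in
  riccati (ulsubmx H) (ursubmx H) (dlsubmx H) (drsubmx H) T D ->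
  forall k, (0 < k <= T)%N ->
  \tr (D k *m dlsubmx H) = if k == 1%N then model_variance else 0.
Proof.
move=> nl Kl H ric k /andP[k0 kT].
have [ric' tr] := @model_riccati n.+1 K T nl Kl.
have eH : H = opmx newton (n.+1 + K) opA + opmx newton (n.+1 + K) opB := opmx_opH _.
have add_ul (M N : 'M[R]_(n.+1 + K)) : ulsubmx (M + N) = ulsubmx M + ulsubmx N.
  by apply/matrixP => i j; rewrite !mxE.
have add_ur (M N : 'M[R]_(n.+1 + K)) : ursubmx (M + N) = ursubmx M + ursubmx N.
  by apply/matrixP => i j; rewrite !mxE.
have add_dl (M N : 'M[R]_(n.+1 + K)) : dlsubmx (M + N) = dlsubmx M + dlsubmx N.
  by apply/matrixP => i j; rewrite !mxE.
have add_dr (M N : 'M[R]_(n.+1 + K)) : drsubmx (M + N) = drsubmx M + drsubmx N.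
  by apply/matrixP => i j; rewrite !mxE.
move: ric; rewrite eH add_ul add_ur add_dl add_dr ursubmx_opB addr0 dlsubmx_opA add0r.
move=> ric; have -> := riccati_unique ric ric' kT.
have kT' : (0 < k <= T.+1)%N by rewrite k0 (leq_trans kT).
have dn : (d <= n)%N by rewrite (leq_trans _ nl)// leq_addl.
have dK : (d < K)%N by apply: leq_ltn_trans Kl; rewrite mulSn leq_addr.
by rewrite (tr k kT') (trace_model dn dK).
Qed.

End Model.

Section LimitOperator.
Variables (m : nat) (alim blim : 'I_m -> R).

(** The limit of multiplication by 'X: the term a_j p_(k - e_j) of the recurrence
    becomes a quotient by 'X - b_j. *)
Definition limop q := 'X * q + \sum_(j < m) alim j *: (q %/ ('X - (blim j)%:P)).

Definition gden : {poly R} := \prod_(j < m) ('X - (blim j)%:P).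
Definition gnum : {poly R} :=
  'X * gden + \sum_(j < m) alim j *: \prod_(i < m | i != j) ('X - (blim i)%:P).

Lemma monic_gden : gden \is monic.
Proof. by rewrite /gden monic_prod// => i _; exact: monicXsubC. Qed.

Lemma size_gden : size gden = m.+1.
Proof. by rewrite /gden size_prod_XsubC /index_enum -enumT size_enum_ord. Qed.

Lemma limopE q : limop q = toeplitz gnum gden q.
Proof.
rewrite /limop /toeplitz /gnum mulrDl divpD; congr (_ + _).
  by rewrite mulrAC mulpK// monic_neq0// monic_gden.
rewrite mulr_suml; elim/big_ind2 : _ => [|x1 x2 y1 y2 -> ->|j _].
- by rewrite div0p.
- by rewrite divpD.
rewrite -scalerAl divpZl; congr (_ *: _).
rewrite /gden [X in _ = _ %/ X](bigD1 j)//=.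
rewrite [X in _ = _ %/ X]mulrC divp_pmul2l ?polyXsubC_eq0//.
by rewrite monic_neq0// monic_prod// => i _; exact: monicXsubC.
Qed.

Lemma limop_linear : linear limop.
Proof. by move=> a p q; rewrite !limopE toeplitz_linear. Qed.

Lemma size_gnum : (size gnum <= m.+2)%N.
Proof.
rewrite /gnum; apply: leq_trans (size_polyD _ _) _; rewrite geq_max.
rewrite mulrC size_mulX ?monic_neq0 ?monic_gden// size_gden leqnn/=.
elim/big_ind : _ => [|p q hp hq|j _]; first by rewrite size_poly0.
  by apply: leq_trans (size_polyD _ _) _; rewrite geq_max hp.
apply: leq_trans (size_scale_leq _ _) _.
rewrite -big_filter size_prod_XsubC size_filter ltnS.
by apply: leq_trans (count_size _ _) _; rewrite /index_enum -enumT size_enum_ord.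
Qed.

Lemma size_limop q : (size (limop q) <= (size q).+1)%N.
Proof.
rewrite limopE /toeplitz size_divp ?monic_neq0 ?monic_gden// size_gden/=.
have [->|q0] := eqVneq q 0; first by rewrite mulr0 size_poly0.
suff aux a b c : (a <= (b + c).-1 -> b <= m.+2 -> a - m <= c.+1)%N.
  exact: (aux _ _ _ (size_polyMleq gnum q) size_gnum).
by lia.
Qed.

(** Each composition loses a bounded number of coordinates by [toeplitz_comp]. *)
Lemma iter_limop i : exists c, forall q,
  (size (iter i limop q - toeplitz (gnum ^+ i) (gden ^+ i) q)%R <= c)%N.
Proof.
elim: i => [|i [c IH]].
  by exists 0%N => q; rewrite /toeplitz !expr0 mul1r divp1 subrr size_poly0.
exists (maxn c.+1 m.+2) => q; rewrite iterS.
set Tq := toeplitz (gnum ^+ i) (gden ^+ i) q; set Iq := iter i limop q.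
have -> : limop Iq - toeplitz (gnum ^+ i.+1) (gden ^+ i.+1) q =
    limop (Iq - Tq) + (limop Tq - toeplitz (gnum ^+ i.+1) (gden ^+ i.+1) q).
  rewrite addrA; congr (_ - _).
  by have := limop_linear (-1) Tq Iq; rewrite !scaleN1r [- Tq + Iq]addrC => ->;
    rewrite [RHS]addrC addrA subrr add0r.
apply: leq_trans (size_polyD _ _) _; rewrite geq_max; apply/andP; split.
  by apply: leq_trans (size_limop _) _; rewrite leq_max ltnS IH.
rewrite leq_max; apply/orP; right; apply: leq_trans size_gnum.
rewrite limopE /Tq exprS exprSr [toeplitz (gnum ^+ i) _ _]/toeplitz.
rewrite [toeplitz (_ * _) _ _]/toeplitz -mulrA.
by apply: toeplitz_comp; rewrite ?monic_gden// monic_exp// monic_gden.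
Qed.

Variables (f : {poly R}) (d : nat).
Hypothesis size_f : (size f <= d.+1)%N.

(** Numerator of f (z + sum_j a_j / (z - b_j)) over the common denominator
    gden^d. *)
Definition hnum : {poly R} := \sum_(i < d.+1) f`_i *: (gnum ^+ i * gden ^+ (d - i)).
Definition hden : {poly R} := gden ^+ d.
Definition flimop q := \sum_(i < d.+1) f`_i *: iter i limop q.

Lemma monic_hden : hden \is monic.
Proof. by rewrite /hden monic_exp// monic_gden. Qed.

Lemma size_hden : size hden = (d * m).+1.
Proof.
rewrite /hden; elim: d => [|l IH]; first by rewrite expr0 size_poly1.
rewrite exprSr size_Mmonic ?monic_gden// ?IH ?size_gden; first by lia.
by rewrite monic_neq0// monic_exp// monic_gden.
Qed.

Lemma size_hpol : (size (hnum %/ hden)%R <= d.+1)%N.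
Proof.
rewrite size_divp ?monic_neq0 ?monic_hden// size_hden/=.
have : (size hnum <= (d * m + d).+1)%N.
  rewrite /hnum; elim/big_ind : _ => [|p q hp hq|i _]; first by rewrite size_poly0.
    by apply: leq_trans (size_polyD _ _) _; rewrite geq_max hp.
  apply: leq_trans (size_scale_leq _ _) _.
  apply: leq_trans (size_polyMleq _ _) _.
  have s1 : (size (gnum ^+ i) <= (i * m.+1).+1)%N.
    apply: leq_trans (size_poly_exp_leq _ _) _; rewrite ltnS mulnC leq_mul2l.
    by rewrite -subn1 leq_subLR add1n size_gnum orbT.
  have s2 : (size (gden ^+ (d - i)) <= ((d - i) * m).+1)%N.
    apply: leq_trans (size_poly_exp_leq _ _) _; rewrite ltnS mulnC leq_mul2l.
    by rewrite size_gden leqnn orbT.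
  have := leq_add s1 s2; have : (i <= d)%N by rewrite -ltnS.
  set x := size _; set y := size _.
  move=> id; have -> : ((i * m.+1).+1 + ((d - i) * m).+1 = (d * m + i).+2)%N by nia.
  by lia.
suff aux a b : (a <= (b + d).+1 -> a - b <= d.+1)%N by exact: aux.
by lia.
Qed.

Lemma toeplitz_hnum q : toeplitz hnum hden q =
  \sum_(i < d.+1) f`_i *: toeplitz (gnum ^+ i) (gden ^+ i) q.
Proof.
rewrite /toeplitz /hnum mulr_suml; elim/big_ind2 : _ => [|x1 x2 y1 y2 <- <-|i _].
- by rewrite div0p.
- by rewrite divpD.
rewrite -scalerAl divpZl; congr (_ *: _).
have id : (i <= d)%N by rewrite -ltnS.
rewrite /hden -[in gden ^+ d](subnK id) exprD mulrAC [_ * gden ^+ (d - i)]mulrC.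
by rewrite divp_pmul2l// monic_neq0// monic_exp// monic_gden.
Qed.

Lemma opH_toeplitz q : opH (hnum %/ hden) (hnum %% hden) hden q = toeplitz hnum hden q.
Proof.
rewrite /opH /toeplitz [in RHS](divp_eq hnum hden) mulrDl divpD; congr (_ + _).
by rewrite mulrAC mulpK// monic_neq0// monic_hden.
Qed.

Lemma flimop_opH : exists c, forall q s, (c <= s)%N ->
  crd (flimop q) s = crd (opH (hnum %/ hden) (hnum %% hden) hden q) s.
Proof.
suff [c h] : exists c, forall (i : 'I_d.+1) q,
  (size (iter i limop q - toeplitz (gnum ^+ i) (gden ^+ i) q)%R <= c)%N.
  exists c => q s cs; rewrite opH_toeplitz toeplitz_hnum /flimop !crd_sum.
  apply: eq_bigr => i _; rewrite !crdZ; congr (_ * _).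
  by apply/eqP; rewrite -subr_eq0 -crdB crd_ge// (leq_trans (h _ _)).
elim: d.+1 => [|l [c IH]]; first by exists 0%N => -[].
have [c' hc'] := iter_limop l.
exists (maxn c c') => i q; rewrite leq_max.
have [il|] := ltnP i l; first by rewrite (IH (Ordinal il)).
move=> li; have -> : (i : nat) = l by apply/eqP; rewrite eqn_leq li -ltnS ltn_ord.
by rewrite hc' orbT.
Qed.

End LimitOperator.
End LimitModel.

(** * Stability of the Riccati recursion under perturbation of the entries *)

Section Asymptotics.
Variable R : realFieldType.

(** Elementary convergence to 0, over any ordered field: only rational operations
    on the entries of matrices are needed in this part. *)
Definition vanishes (u : nat -> R) := forall eps : R, 0 < eps ->
  exists n0, forall n, (n0 <= n)%N -> `|u n| <= eps.
Definition ev_bounded (u : nat -> R) := exists (C : R) n0, forall n, (n0 <= n)%N -> `|u n| <= C.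
(** The second sequence need not converge, but is bounded so that products can be
    compared. *)
Definition asym (u v : nat -> R) := vanishes (fun n => u n - v n) /\ ev_bounded v.

Lemma vanishes_ext u v : (exists n0, forall n, (n0 <= n)%N -> u n = v n) ->
  vanishes u -> vanishes v.
Proof.
move=> [n0 uv] hu e e0; have [n1 h] := hu e e0; exists (maxn n0 n1) => n.
by rewrite geq_max => /andP[/uv <- /h].
Qed.

Lemma asym_ext u v u' v' : asym u v ->
  (exists n0, forall n, (n0 <= n)%N -> u n = u' n /\ v n = v' n) -> asym u' v'.
Proof.
move=> [uv [C [n1 vC]]] [n0 h]; split.
  by apply: vanishes_ext uv; exists n0 => n /h[-> ->].
exists C, (maxn n0 n1) => n; rewrite geq_max => /andP[/h[_ <-]]; exact: vC.
Qed.

Lemma vanishesD u v : vanishes u -> vanishes v -> vanishes (fun n => u n + v n).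
Proof.
move=> hu hv e e0; have e2 : 0 < e / 2 by rewrite divr_gt0.
have [n0 h0] := hu _ e2; have [n1 h1] := hv _ e2; exists (maxn n0 n1) => n.
rewrite geq_max => /andP[/h0 hun /h1 hvn].
by rewrite (le_trans (ler_normD _ _))// [e]splitr lerD.
Qed.

Lemma vanishes_bounded u : vanishes u -> ev_bounded u.
Proof. by move=> /(_ 1 ltr01)[n0 h]; exists 1, n0. Qed.

Lemma ev_boundedD u v : ev_bounded u -> ev_bounded v -> ev_bounded (fun n => u n + v n).
Proof.
move=> [C [n0 h0]] [D [n1 h1]]; exists (C + D), (maxn n0 n1) => n.
rewrite geq_max => /andP[/h0 hun /h1 hvn].
by rewrite (le_trans (ler_normD _ _))// lerD.
Qed.

Lemma ev_boundedM u v : ev_bounded u -> ev_bounded v -> ev_bounded (fun n => u n * v n).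
Proof.
move=> [C [n0 h0]] [D [n1 h1]]; exists (C * D), (maxn n0 n1) => n.
rewrite geq_max => /andP[/h0 hun /h1 hvn].
by rewrite normrM ler_pM.
Qed.

Lemma vanishesM u v : vanishes u -> ev_bounded v -> vanishes (fun n => u n * v n).
Proof.
move=> hu [C [n1 h1]] e e0.
have C0 : 0 < `|C| + 1 by rewrite ltr_wpDl.
have [n0 h0] := hu (e / (`|C| + 1)) (divr_gt0 e0 C0); exists (maxn n0 n1) => n.
rewrite geq_max => /andP[/h0 hun /h1 hvn]; rewrite normrM.
rewrite -[e](divfK (lt0r_neq0 C0)) ler_pM// (le_trans hvn)//.
by rewrite (le_trans (ler_norm C))// lerDl.
Qed.

Lemma asym_bounded u v : asym u v -> ev_bounded u.
Proof.
move=> [uv bv]; have := ev_boundedD (vanishes_bounded uv) bv.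
by move=> [C [n0 h]]; exists C, n0 => n /h; rewrite subrK.
Qed.

Lemma asymD u v u' v' : asym u v -> asym u' v' ->
  asym (fun n => u n + u' n) (fun n => v n + v' n).
Proof.
move=> [uv bv] [uv' bv']; split; last exact: ev_boundedD.
by apply: vanishes_ext (vanishesD uv uv'); exists 0%N => n _; rewrite opprD addrACA.
Qed.

Lemma asymM u v u' v' : asym u v -> asym u' v' ->
  asym (fun n => u n * u' n) (fun n => v n * v' n).
Proof.
move=> uv uv'; have bu' := asym_bounded uv'.
case: uv uv' => [uv bv] [uv' bv']; split; last exact: ev_boundedM.
apply: vanishes_ext (vanishesD (vanishesM uv bu') (vanishesM uv' bv)).
by exists 0%N => n _; ring.
Qed.

Lemma asym_cst (c : R) : asym (fun=> c) (fun=> c).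
Proof.
split; last by exists `|c|, 0%N.
by move=> e e0; exists 0%N => n _; rewrite subrr normr0 ltW.
Qed.

Lemma asymN u v : asym u v -> asym (fun n => - u n) (fun n => - v n).
Proof.
move=> /(asymM (asym_cst (-1))) h; apply: (asym_ext h).
by exists 0%N => n _; rewrite !mulN1r.
Qed.

Lemma asymB u v u' v' : asym u v -> asym u' v' ->
  asym (fun n => u n - u' n) (fun n => v n - v' n).
Proof. by move=> uv /asymN; exact: asymD. Qed.

Lemma asymZ c u v : asym u v -> asym (fun n => c * u n) (fun n => c * v n).
Proof. exact: asymM (asym_cst c). Qed.

Lemma asym_sum L (u v : 'I_L -> nat -> R) : (forall i, asym (u i) (v i)) ->
  asym (fun n => \sum_(i < L) u i n) (fun n => \sum_(i < L) v i n).
Proof.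
elim: L u v => [|L IH] u v uv.
  by apply: (asym_ext (asym_cst 0)); exists 0%N => n _; rewrite !big_ord0.
have := asymD (uv ord0) (IH _ _ (fun i => uv (lift ord0 i))).
by move=> h; apply: (asym_ext h); exists 0%N => n _; rewrite !big_ord_recl.
Qed.

(** The entries at bounded distance from the cut n are indexed by such sequences. *)
Definition near_diag (r : nat -> nat) := exists L n0, forall n, (n0 <= n)%N ->
  (n <= r n + L)%N && (r n <= n + L)%N.

Definition masym (H G : nat -> nat -> nat -> R) := forall r s,
  near_diag r -> near_diag s -> asym (fun n => H n (r n) (s n)) (fun n => G n (r n) (s n)).

Lemma near_diagD c : near_diag (fun n => (n + c)%N).
Proof. by exists c, 0%N => n _; rewrite leqnn andbT; lia. Qed.

Lemma near_diagB c : near_diag (fun n => (n - c)%N).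
Proof. by exists c, 0%N => n _; apply/andP; split; lia. Qed.

(** Entries indexed by natural numbers, with value 0 outside of the matrix, so
    that the indices n - b make sense for all n. *)
Definition mxe p q (M : 'M[R]_(p, q)) (i j : nat) : R :=
  match insub i, insub j with Some i', Some j' => M i' j' | _, _ => 0 end.

Lemma mxeE p q (M : 'M[R]_(p, q)) (i : 'I_p) (j : 'I_q) : mxe M i j = M i j.
Proof. by rewrite /mxe !valK. Qed.

Lemma sum_top n L (F : nat -> R) : (L <= n)%N ->
  (forall v, (v + L <= n)%N -> F v = 0) ->
  \sum_(v < n.+1) F v = \sum_(b < L) F (n - b)%N.
Proof.
move=> Ln F0; rewrite -(big_mkord xpredT F) -(big_mkord xpredT (fun b => F (n - b)%N)).
rewrite (@big_cat_nat _ _ _ (n.+1 - L)%N) ?leq_subr//= big_nat_cond big1 ?add0r; last first.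
  by move=> v; rewrite andbT => /andP[_ vn]; apply: F0; lia.
rewrite big_nat_rev/= -{1}[(n.+1 - L)%N]add0n big_addn.
have -> : (n.+1 - (n.+1 - L) = L)%N by lia.
rewrite big_nat_cond [RHS]big_nat_cond; apply: eq_bigr => b.
by rewrite andbT => /andP[_ bL]; congr F; lia.
Qed.

Definition bmx N (h : nat -> nat -> R) : 'M[R]_N := \matrix_(i, j) h i j.

Definition block_riccati n K T (h : nat -> nat -> R) (D : nat -> 'M[R]_(n, K)) :=
  riccati (ulsubmx (bmx (n + K) h)) (ursubmx (bmx (n + K) h))
    (dlsubmx (bmx (n + K) h)) (drsubmx (bmx (n + K) h)) T D.

Section Compare.
Variables (K d T : nat).

Section OneSystem.
Variables (h : nat -> nat -> R) (n : nat) (D : nat -> 'M[R]_(n.+1, K)).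
Hypothesis band : forall r s, (r + d < s)%N -> h r s = 0.
Hypothesis ric : block_riccati T h D.

Lemma block_riccati_local k : (k <= T)%N -> forall i j,
  (i + k * d <= n)%N || (k * d <= j)%N -> mxe (D k) i j = 0.
Proof.
move=> kT i j ij; rewrite /mxe; case: insubP => // i' _ ii; case: insubP => // j' _ jj.
apply: (@riccati_local _ _ _ _ _ _ _ d T D _ _ _ ric k kT).
- by move=> a b ab; rewrite !mxE /=; apply: band.
- by move=> a b ab; rewrite !mxE /=; apply: band.
- by move=> a b ab; rewrite !mxE /=; apply: band; rewrite -addnA ltn_add2l.
by rewrite ltnS ii jj.
Qed.

(** The sums over the n rows of H11 and H21 reduce to windows of fixed length
    next to the cut by [block_riccati_local]: the recursion involves a number of
    entries independent of n. *)
Lemma block_riccatiS k i j : (k < T)%N -> (i <= n)%N -> (j < K)%N -> (T * d <= n)%N ->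
  mxe (D k.+1) i j = k.+1%:R^-1 *
  ((if k == 0%N then h i (n.+1 + j)%N else 0) +
   \sum_(u < K) mxe (D k) i u * h (n.+1 + u)%N (n.+1 + j)%N -
   \sum_(b < T * d) h i (n - b)%N * mxe (D k) (n - b)%N j -
   \sum_(l < k.+1) \sum_(b < T * d)
      (\sum_(u < K) mxe (D l) i u * h (n.+1 + u)%N (n - b)%N) *
      mxe (D (k - l)%N) (n - b)%N j).
Proof.
move=> kT; rewrite -ltnS => iN jK Tn; have [_ /(_ k kT)] := ric.
move/matrixP/(_ (Ordinal iN) (Ordinal jK)); rewrite mxE.
rewrite -[D _ _ _]/(D k.+1 (Ordinal iN) (Ordinal jK)) -mxeE /= => E.
apply: (@mulfI _ k.+1%:R); first by rewrite pnatr_eq0.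
rewrite mulrA divff ?pnatr_eq0// mul1r E /riccati_rhs !mxE.
have leT l : (l <= T)%N -> (l * d <= T * d)%N by move=> lT; rewrite leq_mul2r lT orbT.
have kT' := ltnW kT.
congr (_ + _ - _ - _).
- by rewrite /fcst; case: eqP => _; rewrite !mxE.
- by apply: eq_bigr => u _; rewrite !mxE -mxeE.
- rewrite -(@sum_top n (T * d) (fun v => h i v * mxe (D k) v j))//.
    by apply: eq_bigr => v _; rewrite !mxE -mxeE.
  move=> v vn; rewrite block_riccati_local ?mulr0//; apply/orP; left.
  by have := leT _ kT'; lia.
rewrite /fmul summxE; apply: eq_bigr => l _.
rewrite -(@sum_top n (T * d) (fun v => (\sum_(u < K) mxe (D l) i u * h (n.+1 + u)%N v)
     * mxe (D (k - l)%N) v j))//.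
  rewrite mxE; apply: eq_bigr => v _; congr (_ * _); last by rewrite -mxeE.
  by rewrite mxE; apply: eq_bigr => u _; rewrite !mxE -mxeE.
move=> v vn; rewrite [X in _ * X]block_riccati_local ?mulr0//.
  by rewrite (leq_trans (leq_subr _ _)).
by apply/orP; left; have := leT _ (leq_trans (leq_subr l k) kT'); lia.
Qed.

Lemma block_riccati_trace k : (k <= T)%N -> (T * d <= n)%N ->
  \tr (D k *m dlsubmx (bmx (n.+1 + K) h)) =
  \sum_(b < T * d) \sum_(u < K) mxe (D k) (n - b)%N u * h (n.+1 + u)%N (n - b)%N.
Proof.
move=> kT Tn; have leT l : (l <= T)%N -> (l * d <= T * d)%N.
  by move=> lT; rewrite leq_mul2r lT orbT.
rewrite -(@sum_top n (T * d) (fun v => \sum_(u < K) mxe (D k) v u * h (n.+1 + u)%N v))//.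
  apply: eq_bigr => i _; rewrite mxE; apply: eq_bigr => u _.
  by rewrite !mxE -mxeE.
move=> v vn; rewrite big1// => u _; rewrite block_riccati_local ?mul0r//.
by apply/orP; left; have := leT _ kT; lia.
Qed.

End OneSystem.

Variables (H G : nat -> nat -> nat -> R).
Variables (D E : forall n, nat -> 'M[R]_(n.+1, K)).
Hypothesis HG : masym H G.
Hypothesis bandH : forall n r s, (r + d < s)%N -> H n r s = 0.
Hypothesis bandG : forall n r s, (r + d < s)%N -> G n r s = 0.
Hypothesis ricH : forall n, block_riccati T (H n) (@D n).
Hypothesis ricG : forall n, block_riccati T (G n) (@E n).

(** By [block_riccatiS] the coefficients are the same fixed polynomial expression
    in the entries of either matrix near the cut. *)
Lemma asym_riccati k : (k <= T)%N -> forall a j,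
  asym (fun n => mxe (D n k) (n - a) j) (fun n => mxe (E n k) (n - a) j).
Proof.
elim/ltn_ind: k => -[|k] IH kT a j.
  apply: (asym_ext (asym_cst 0)); exists 0%N => n _.
  have [-> _] := @ricH n; have [-> _] := @ricG n.
  by rewrite /mxe; case: insubP => // ? _ _; case: insubP => // ? _ _; rewrite !mxE.
have [jK|Kj] := ltnP j K; last first.
  apply: (asym_ext (asym_cst 0)); exists 0%N => n _.
  by rewrite /mxe; case: insubP => // ? _ _; rewrite insubF// ltnNge Kj.
have nd u : near_diag (fun n => (n.+1 + u)%N).
  by have [L [n0 h]] := near_diagD u.+1; exists L, n0 => n /h; rewrite addSnnS.
apply: (@asym_ext
 (fun n => k.+1%:R^-1 *
  ((if k == 0%N then H n (n - a)%N (n.+1 + j)%N else 0) +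
   \sum_(u < K) mxe (D n k) (n - a)%N u * H n (n.+1 + u)%N (n.+1 + j)%N -
   \sum_(b < T * d) H n (n - a)%N (n - b)%N * mxe (D n k) (n - b)%N j -
   \sum_(l < k.+1) \sum_(b < T * d)
      (\sum_(u < K) mxe (D n l) (n - a)%N u * H n (n.+1 + u)%N (n - b)%N) *
      mxe (D n (k - l)%N) (n - b)%N j))
 (fun n => k.+1%:R^-1 *
  ((if k == 0%N then G n (n - a)%N (n.+1 + j)%N else 0) +
   \sum_(u < K) mxe (E n k) (n - a)%N u * G n (n.+1 + u)%N (n.+1 + j)%N -
   \sum_(b < T * d) G n (n - a)%N (n - b)%N * mxe (E n k) (n - b)%N j -
   \sum_(l < k.+1) \sum_(b < T * d)
      (\sum_(u < K) mxe (E n l) (n - a)%N u * G n (n.+1 + u)%N (n - b)%N) *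
      mxe (E n (k - l)%N) (n - b)%N j))).
  apply/asymZ/asymB; first apply/asymB; first apply/asymD.
  - by case: (k == 0%N); [apply: HG => //; exact: near_diagB|exact: asym_cst].
  - apply: asym_sum => u; apply: asymM; first by apply: IH => //; exact: ltnW.
    exact: HG.
  - apply: asym_sum => b; apply: asymM; last by apply: IH => //; exact: ltnW.
    by apply: HG; exact: near_diagB.
  apply: asym_sum => l; apply: asym_sum => b; apply: asymM.
    apply: asym_sum => u; apply: asymM.
      by apply: IH => //; rewrite (leq_trans _ (ltnW kT))// -ltnS.
    by apply: HG => //; exact: near_diagB.
  apply: IH; first by rewrite ltnS leq_subr.
  by rewrite (leq_trans (leq_subr _ _))// ltnW.
exists (T * d)%N => n Tn; split; apply: esym.
  by apply: (block_riccatiS (bandH n) (ricH n)) => //; exact: leq_subr.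
by apply: (block_riccatiS (bandG n) (ricG n)) => //; exact: leq_subr.
Qed.

Lemma asym_riccati_trace k : (k <= T)%N ->
  asym (fun n => \tr (D n k *m dlsubmx (bmx (n.+1 + K) (H n))))
       (fun n => \tr (E n k *m dlsubmx (bmx (n.+1 + K) (G n)))).
Proof.
move=> kT.
apply: (@asym_ext
  (fun n => \sum_(b < T * d) \sum_(u < K) mxe (D n k) (n - b)%N u *
     H n (n.+1 + u)%N (n - b)%N)
  (fun n => \sum_(b < T * d) \sum_(u < K) mxe (E n k) (n - b)%N u *
     G n (n.+1 + u)%N (n - b)%N)).
  apply: asym_sum => b; apply: asym_sum => u; apply: asymM; first exact: asym_riccati.
  apply: HG; last exact: near_diagB.
  by have [L [n0 h]] := near_diagD u.+1; exists L, n0 => n /h; rewrite addSnnS.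
exists (T * d)%N => n Tn; split; apply: esym.
  exact: (block_riccati_trace (bandH n) (ricH n)).
exact: (block_riccati_trace (bandG n) (ricG n)).
Qed.

End Compare.
End Asymptotics.

(** * Asymptotics of the multiplication operator in the orthogonal basis *)

Section OperatorAsymptotics.
Variable R : realFieldType.

(** Turns a sum over a window moving with n into one over a fixed index type. *)
Lemma sum_window n M N (F : nat -> R) : (M <= n)%N ->
  (forall u, (N <= u)%N -> F u = 0) ->
  (forall u, (u + M < n)%N || (n + M < u)%N -> F u = 0) ->
  \sum_(u < N) F u = \sum_(i < (M + M).+1) F (n - M + i)%N.
Proof.
move=> Mn FN FM; pose N' := maxn N (n + M).+1.
have -> : \sum_(u < N) F u = \sum_(0 <= u < N') F u.
  rewrite (@big_cat_nat _ _ _ N)//= ?leq_maxl// big_mkord [X in _ + X]big_nat_cond.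
  by rewrite [X in _ + X]big1 ?addr0// => u; rewrite andbT => /andP[/FN].
rewrite (@big_cat_nat _ _ _ (n + M).+1)//= ?leq_maxr// [X in _ + X]big_nat_cond.
rewrite [X in _ + X]big1 ?addr0; last first.
  by move=> u; rewrite andbT => /andP[nu _]; apply: FM; rewrite nu orbT.
rewrite (@big_cat_nat _ _ _ (n - M))//=; last by lia.
rewrite big_nat_cond big1 ?add0r; last first.
  by move=> u; rewrite andbT => /andP[_ nu]; apply: FM; apply/orP; left; lia.
rewrite -{1}[(n - M)%N]add0n big_addn -(big_mkord xpredT (fun i => F (n - M + i)%N)).
have -> : ((n + M).+1 - (n - M) = (M + M).+1)%N by lia.
by apply: eq_bigr => i _; rewrite addnC.
Qed.

Lemma near_diag_pair r s : near_diag r -> near_diag s -> exists L n0, forall n, (n0 <= n)%N ->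
  [/\ (n <= r n + L)%N, (r n <= n + L)%N, (n <= s n + L)%N & (s n <= n + L)%N].
Proof.
move=> [L [n0 h]] [L' [n1 h']]; exists (maxn L L'), (maxn n0 n1) => n.
rewrite geq_max => /andP[/h /andP[h1 h2] /h' /andP[h3 h4]].
by split; lia.
Qed.

Definition opentries (e : nat -> nat -> {poly R}) (O : nat -> {poly R} -> {poly R})
  (n r s : nat) : R := crd (e n) (O n (e n r)) s.

Variables (e e' : nat -> nat -> {poly R}).
Hypotheses (size_e : forall n r, size (e n r) = r.+1).
Hypotheses (size_e' : forall n r, size (e' n r) = r.+1).
Hypotheses (monic_e : forall n r, e n r \is monic).
Hypotheses (monic_e' : forall n r, e' n r \is monic).

(** A product entry is a sum over an intermediate index, which the degree bounds
    confine to a window of fixed length around n. *)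
Lemma opentries_comp (O1 O2 O1' O2' : nat -> {poly R} -> {poly R}) d1 d2 :
  (forall n, linear (O2 n)) -> (forall n, linear (O2' n)) ->
  (forall n q, (size (O1 n q) <= size q + d1)%N) ->
  (forall n q, (size (O1' n q) <= size q + d1)%N) ->
  (forall n q, (size (O2 n q) <= size q + d2)%N) ->
  (forall n q, (size (O2' n q) <= size q + d2)%N) ->
  masym (opentries e O1) (opentries e' O1') ->
  masym (opentries e O2) (opentries e' O2') ->
  masym (opentries e (fun n q => O2 n (O1 n q)))
        (opentries e' (fun n q => O2' n (O1' n q))).
Proof.
move=> l2 l2' b1 b1' b2 b2' m1 m2 r s nr ns.
have [L [n0 h]] := near_diag_pair nr ns; pose M := (L + d1 + d2)%N.
pose F n u := opentries e O1 n (r n) u * opentries e O2 n u (s n).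
pose F' n u := opentries e' O1' n (r n) u * opentries e' O2' n u (s n).
apply: (@asym_ext _ (fun n => \sum_(i < (M + M).+1) F n (n - M + i)%N)
   (fun n => \sum_(i < (M + M).+1) F' n (n - M + i)%N)).
  apply: asym_sum => i; have nu : near_diag (fun n => (n - M + i)%N).
    by exists (M + i)%N, 0%N => n _; apply/andP; split; lia.
  by apply: asymM; [apply: m1|apply: m2].
exists (maxn n0 M) => n; rewrite geq_max => /andP[/h[h1 h2 h3 h4] Mn].
have main (E : nat -> {poly R}) (P1 P2 : {poly R} -> {poly R}) :
    (forall r, size (E r) = r.+1) -> (forall r, E r \is monic) -> linear P2 ->
    (forall q, (size (P1 q) <= size q + d1)%N) ->
    (forall q, (size (P2 q) <= size q + d2)%N) ->
   \sum_(i < (M + M).+1) crd E (P1 (E (r n))) (n - M + i)%N *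
        crd E (P2 (E (n - M + i)%N)) (s n) = crd E (P2 (P1 (E (r n)))) (s n).
  move=> sE mE lP bP1 bP2.
  rewrite (crd_op sE mE (s n) lP (leqnn (size (P1 (E (r n)))))).
  have bP := bP1 (E (r n)); rewrite sE in bP.
  rewrite -(@sum_window n M (size (P1 (E (r n))))
     (fun u => crd E (P1 (E (r n))) u * crd E (P2 (E u)) (s n)))//.
    by move=> u su; rewrite crd_ge ?mul0r.
  move=> u /orP[uM|Mu].
    rewrite [X in _ * X]crd_ge ?mulr0//; apply: leq_trans (bP2 _) _.
    by rewrite sE /M in uM *; lia.
  by rewrite crd_ge ?mul0r//; apply: leq_trans bP _; rewrite /M in Mu; lia.
by split; apply: main.
Qed.

Lemma opentries_iter (O O' : nat -> {poly R} -> {poly R}) :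
  (forall n, linear (O n)) -> (forall n, linear (O' n)) ->
  (forall n q, (size (O n q) <= size q + 1)%N) ->
  (forall n q, (size (O' n q) <= size q + 1)%N) ->
  masym (opentries e O) (opentries e' O') -> forall i,
  masym (opentries e (fun n q => iter i (O n) q))
        (opentries e' (fun n q => iter i (O' n) q)).
Proof.
move=> l l' b b' m; elim=> [|i IH].
  move=> r s nr ns; rewrite /opentries /=.
  apply: (@asym_ext _ (fun n => (s n == r n)%:R) (fun n => (s n == r n)%:R)).
    split.
      by move=> eps e0; exists 0%N => n _; rewrite subrr normr0 ltW.
    by exists 1, 0%N => n _; case: eqP; rewrite /= ?normr1 ?normr0.
  by exists 0%N => n _; rewrite !crd_e.
have sz (P : {poly R} -> {poly R}) (bP : forall q, (size (P q) <= size q + 1)%N) :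
    forall q, (size (iter i P q) <= size q + i)%N.
  move=> q; elim: i {IH} => [|j IHj]; first by rewrite addn0.
  by rewrite iterS (leq_trans (bP _))// addn1 addnS ltnS.
by apply: (@opentries_comp _ O _ O' i 1) => // n q; apply: sz.
Qed.

End OperatorAsymptotics.

Section NearestNeighbor.
Variables (R : realFieldType) (m : nat).
Variables (p : nat -> nat -> {poly R}) (v : nat -> nat -> 'I_m -> {poly R}).
Variables (a b : nat -> nat -> 'I_m -> R) (l : nat -> 'I_m).
Variables (alim blim : 'I_m -> R).
Hypothesis size_p : forall n r, size (p n r) = r.+1.
Hypothesis monic_p : forall n r, p n r \is monic.
Hypothesis rec_p : forall n r,
  'X * p n r = p n r.+1 + b n r (l r) *: p n r + \sum_j v n r j.
Hypothesis rec_v0 : forall n j, v n 0%N j = 0.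
Hypothesis rec_v : forall n r j,
  v n r.+1 j = a n r.+1 j *: p n r + (b n r j - b n r (l r)) *: v n r j.
Hypothesis a_cvg : forall j r, near_diag r -> vanishes (fun n => a n (r n) j - alim j).
Hypothesis b_cvg : forall j r, near_diag r -> vanishes (fun n => b n (r n) j - blim j).

Let beta r := blim (l r).
Local Notation newton := (newton beta).

Lemma asym_a j r : near_diag r -> asym (fun n => a n (r n) j) (fun=> alim j).
Proof. by move=> nr; split; [exact: a_cvg|exists `|alim j|, 0%N]. Qed.

Lemma asym_b j r : near_diag r -> asym (fun n => b n (r n) j) (fun=> blim j).
Proof. by move=> nr; split; [exact: b_cvg|exists `|blim j|, 0%N]. Qed.

Lemma asym_bl r r' : near_diag r ->
  asym (fun n => b n (r n) (l (r' n))) (fun n => blim (l (r' n))).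
Proof.
move=> nr; split.
  have : vanishes (fun n => \sum_j `|b n (r n) j - blim j|).
    apply: (@vanishes_ext _ (fun n => \sum_j `|b n (r n) j - blim j| - \sum_(j < m) 0)).
      by exists 0%N => n _; rewrite [X in _ - X]big1 ?subr0.
    apply: (proj1 (@asym_sum _ _ (fun j n => `|b n (r n) j - blim j|) (fun _ _ => 0) _)) => j.
    split; last by exists 0, 0%N => n _; rewrite normr0.
    move=> eps e0; have [n0 h] := b_cvg j nr e0; exists n0 => n /h.
    by rewrite subr0 normr_id.
  move=> h eps e0; have [n0 hn] := h eps e0; exists n0 => n /hn.
  apply: le_trans; rewrite [leRHS]ger0_norm ?sumr_ge0// (bigD1 (l (r' n)))//=.
  by rewrite lerDl sumr_ge0.
exists (\sum_j `|blim j|), 0%N => n _; rewrite (bigD1 (l (r' n)))//=.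
by rewrite lerDl sumr_ge0.
Qed.

Lemma asym_bool (P : nat -> bool) : asym (fun n => (P n)%:R : R) (fun n => (P n)%:R).
Proof.
split; first by move=> eps e0; exists 0%N => n _; rewrite subrr normr0 ltW.
by exists 1, 0%N => n _; case: (P n); rewrite /= ?normr1 ?normr0.
Qed.

(** v n r j stands for the term a_j p_(k - e_j) of the recurrence at step r. *)
Lemma size_v n r j : (size (v n r j) <= r)%N.
Proof.
elim: r => [|r IH]; first by rewrite rec_v0 size_poly0.
rewrite rec_v; apply: leq_trans (size_polyD _ _) _; rewrite geq_max.
rewrite !(leq_trans (size_scale_leq _ _))//; first exact: ltnW.
by rewrite size_p.
Qed.

(** By induction on r - s: both v and the Newton quotient satisfy a one-step
    recursion along the path, with asymptotically equal coefficients. *)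
Lemma asym_v j c r s : near_diag r -> near_diag s ->
  (exists n0, forall n, (n0 <= n)%N -> (r n <= s n + c)%N) ->
  asym (fun n => crd (p n) (v n (r n) j) (s n))
    (fun n => alim j * crd newton (newton (r n) %/ ('X - (blim j)%:P)) (s n)).
Proof.
have sn r' : (size (newton r' %/ ('X - (blim j)%:P))%R <= r')%N.
  by rewrite size_divp ?polyXsubC_eq0// size_newton size_XsubC subn1.
elim: c r s => [|c IH] r s nr ns [n0 h].
  apply: (asym_ext (asym_cst 0)); exists n0 => n /h; rewrite addn0 => rs.
  rewrite crd_ge ?(leq_trans (size_v _ _ _))//.
  by rewrite crd_ge ?mulr0// (leq_trans (sn _)).
have nr1 : near_diag (fun n => (r n).-1).
  by case: nr => L [n1 h1]; exists L.+1, n1 => n /h1 /andP[? ?]; apply/andP; split; lia.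
have rs1 : exists n0, forall n, (n0 <= n)%N -> ((r n).-1 <= s n + c)%N.
  by exists n0 => n /h; lia.
have IHv := IH _ _ nr1 ns rs1.
have bb : asym (fun n => b n (r n).-1 j - b n (r n).-1 (l (r n).-1))
    (fun n => blim j - blim (l (r n).-1)).
  by apply: asymB; [exact: asym_b|exact: asym_bl].
have := asymD (asymM (asym_a j nr) (asym_bool (fun n => s n == (r n).-1)))
   (asymM bb IHv).
move=> main; apply: (asym_ext main).
case: nr => L [n1 h1]; exists (maxn n1 L.+1) => n; rewrite geq_max.
move=> /andP[/h1 /andP[nrL _] Ln].
have [r' rE] : exists r', r n = r'.+1 by exists (r n).-1; rewrite prednK//; lia.
rewrite rE /= rec_v crdD !crdZ crd_e//; split=> //.
have -> : newton r'.+1 %/ ('X - (blim j)%:P) =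
    newton r' + (blim j - beta r') *: (newton r' %/ ('X - (blim j)%:P)).
  rewrite newtonS.
  have -> : newton r' * ('X - (beta r')%:P) =
     newton r' * ('X - (blim j)%:P) + (blim j - beta r') *: newton r'.
    rewrite -mul_polyC polyCB mulrBl !mulrBr [_%:P * newton r']mulrC.
    by rewrite [(beta r')%:P * _]mulrC addrA subrK.
  by rewrite divpD divpZl mulpK ?polyXsubC_eq0.
rewrite crdD crdZ crd_e; [|exact: size_newton|exact: monic_newton].
by rewrite mulrDr mulrCA.
Qed.

(** The recurrence writes 'X p_r as p_(r+1), a multiple of p_r and the terms v,
    compared with the Newton quotients by [asym_v]. *)
Lemma masym_X : masym (opentries p (fun _ q => 'X * q))
  (opentries (fun=> newton) (fun _ q => limop alim blim q)).
Proof.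
move=> r s nr ns.
have [L [n0 h]] := near_diag_pair nr ns.
have rs : exists n0, forall n, (n0 <= n)%N -> (r n <= s n + (L + L))%N.
  by exists n0 => n /h[]; lia.
have main := asymD (asymD (asym_bool (fun n => s n == (r n).+1))
   (asymM (asym_bl r nr) (asym_bool (fun n => s n == r n))))
  (asym_sum (fun j => asym_v j nr ns rs)).
apply: (asym_ext main); exists 0%N => n _; rewrite /opentries rec_p; split.
  rewrite !crdD crdZ crd_sum !crd_e//.
rewrite /limop.
have -> : 'X * newton (r n) = newton (r n).+1 + beta (r n) *: newton (r n).
  by rewrite newtonS -mul_polyC [_%:P * _]mulrC -mulrDr subrK mulrC.
rewrite !crdD crdZ crd_sum !crd_e; try exact: size_newton; try exact: monic_newton.
by congr (_ + _); apply: eq_bigr => j _; rewrite crdZ.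
Qed.

Variables (f : {poly R}) (d : nat).
Hypothesis size_f : (size f <= d.+1)%N.

(** Iterating [masym_X] handles the monomials of f. *)
Lemma masym_f : masym (opentries p (fun _ q => f * q))
  (opentries (fun=> newton) (fun _ q => flimop alim blim f d q)).
Proof.
move=> r s nr ns.
have main : asym
   (fun n => \sum_(i < d.+1) f`_i *
       opentries p (fun _ q => iter i (fun q => 'X * q) q) n (r n) (s n))
   (fun n => \sum_(i < d.+1) f`_i *
       opentries (fun=> newton) (fun _ q => iter i (limop alim blim) q) n (r n) (s n)).
  apply: asym_sum => i; apply: asymZ; move: nr ns; move: r s. 
  apply: (@opentries_iter _ p (fun=> newton) _ _ _ _
     (fun _ q => 'X * q) (fun _ q => limop alim blim q)) => //.
  - by move=> _ r'; exact: size_newton.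
  - by move=> _ r'; exact: monic_newton.
  - by move=> _ c q q'; rewrite mulrDr scalerAr.
  - by move=> _; exact: limop_linear.
  - move=> _ q; apply: leq_trans (size_polyMleq _ _) _.
    by rewrite size_polyX add2n addn1.
  - by move=> _ q; rewrite addn1 size_limop.
  exact: masym_X.
apply: (asym_ext main); exists 0%N => n _; split.
  rewrite /opentries.
  have {2}-> : f = \sum_(i < d.+1) f`_i *: 'X^i.
    rewrite -poly_def; apply/polyP => i; rewrite coef_poly; case: ltnP => // di.
    by rewrite nth_default// (leq_trans size_f).
  rewrite mulr_suml crd_sum; apply: eq_bigr => i _.
  rewrite -scalerAl crdZ; congr (_ * crd _ _ _).
  by elim: (i : nat) => [|j IH]; rewrite ?mul1r// iterS IH mulrA -exprS.
by rewrite /opentries /flimop crd_sum; apply: eq_bigr => i _; rewrite crdZ.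
Qed.

End NearestNeighbor.

Local Open Scope classical_set_scope.
Local Open Scope ring_scope.

(** * Nearest neighbor recurrences along a path *)

Section RealIntegralSums.
Context d (T : measurableType d) (R : realType).
Variable mu : {measure set T -> \bar R}.
Implicit Types F : T -> R.

Lemma integrable_Rsum (I : Type) (r : seq I) (P : pred I) (F : I -> T -> R) :
  (forall i, mu.-integrable setT (EFin \o F i)) ->
  mu.-integrable setT (fun x => (\sum_(i <- r | P i) F i x)%:E).
Proof.
move=> h; apply: (eq_integrable measurableT
  (fun x => \sum_(i <- r | P i) (F i x)%:E)%E) => [x _|].
  by rewrite sumEFin.
by apply: integrable_sum => // i _; exact: h.
Qed.

Lemma Rintegral_sum (I : Type) (r : seq I) (P : pred I) (F : I -> T -> R) :
  (forall i, mu.-integrable setT (EFin \o F i)) ->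
  Rintegral mu setT (fun x => \sum_(i <- r | P i) F i x) =
  \sum_(i <- r | P i) Rintegral mu setT (F i).
Proof.
move=> h; elim: r => [|i r IH].
  rewrite big_nil -[RHS](mul0r (fine (mu setT))) -(Rintegral_cst mu _ 0)//.
  by apply: eq_Rintegral => x _; rewrite big_nil.
rewrite big_cons -IH; case: ifP => Pi; last first.
  by apply: eq_Rintegral => x _; rewrite big_cons Pi.
rewrite -RintegralD//; last exact: integrable_Rsum.
by apply: eq_Rintegral => x _; rewrite big_cons Pi.
Qed.

Lemma integrable_Rscale (c : R) F : mu.-integrable setT (EFin \o F) ->
  mu.-integrable setT (EFin \o (fun x => c * F x)).
Proof.
move=> h; apply: (eq_integrable measurableT (fun x => c%:E * (F x)%:E)%E) => //.
exact: integrableZl.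
Qed.

End RealIntegralSums.

Section PolynomialIntegral.
Variables (R : realType) (nu : {measure set (measurableTypeR R) -> \bar R}).
Hypothesis mom : forall l : nat,
  nu.-integrable setT (fun x : measurableTypeR R => (x ^+ l)%:E).
Implicit Types p q : {poly R}.

Definition pint p : R := Rintegral nu setT (fun x : measurableTypeR R => p.[x]).

Lemma integrable_horner p :
  nu.-integrable setT (fun x : measurableTypeR R => (p.[x])%:E).
Proof.
apply: (eq_integrable measurableT
  (fun x : measurableTypeR R => (\sum_(i < size p) p`_i * x ^+ i)%:E)) => [x _|].
  by rewrite horner_coef.
apply: (@integrable_Rsum _ _ _ nu _ _ _ (fun (i : 'I_(size p)) x => p`_i * x ^+ i)) => i.
apply: (@integrable_Rscale _ _ _ nu p`_i (fun x : measurableTypeR R => x ^+ i)).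
exact: mom.
Qed.

Lemma pintD p q : pint (p + q) = pint p + pint q.
Proof.
rewrite /pint -RintegralD//; [|exact: integrable_horner|exact: integrable_horner].
by apply: eq_Rintegral => x _; rewrite hornerD.
Qed.

Lemma pintZ c p : pint (c *: p) = c * pint p.
Proof.
rewrite /pint -RintegralZl//; last exact: integrable_horner.
by apply: eq_Rintegral => x _; rewrite hornerZ.
Qed.

Lemma pint0 : pint 0 = 0.
Proof. by rewrite -(scale0r 0) pintZ mul0r. Qed.

Lemma pintB p q : pint (p - q) = pint p - pint q.
Proof. by rewrite pintD -scaleN1r pintZ mulN1r. Qed.

Lemma pint_sum (I : Type) (r : seq I) (P : pred I) (F : I -> {poly R}) :
  pint (\sum_(i <- r | P i) F i) = \sum_(i <- r | P i) pint (F i).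
Proof. by elim/big_rec2 : _ => [|i y1 y2 _ <-]; [exact: pint0|rewrite pintD]. Qed.

Lemma integral_pint p :
  (\int[nu]_x (p.[x])%:E = (pint p)%:E)%E.
Proof. by rewrite /pint /Rintegral fineK//; apply: integrable_fin_num => //; exact: integrable_horner. Qed.

End PolynomialIntegral.

Section NearestNeighborPath.
Variables (R : realType) (m : nat).
Variable mus : 'I_m -> {measure set (measurableTypeR R) -> \bar R}.
Hypothesis mom : finite_moments mus.
Hypothesis perf : perfect mus.
Variables (a b : multi_index m -> 'I_m -> R).
Hypothesis ab_rec : nearest_neighbor_recurrence mus a b.
Implicit Types (k : multi_index m) (j l : 'I_m).

Local Notation mop := (mop mus).
Local Notation pint j := (pint (mus j)).

Lemma orthogonalE k p : mop_orthogonal mus k p <->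
  forall j i, (i < k j)%N -> pint j (p * 'X^i) = 0.
Proof.
have E j i : (\int[mus j]_x (p.[x] * x ^+ i)%:E = (pint j (p * 'X^i))%:E)%E.
  rewrite -(integral_pint (mom j)); apply: eq_integral => x _.
  by rewrite hornerM hornerXn.
by split=> h j i /h; rewrite E; [case|move=> ->].
Qed.

Lemma mop_is_mop k : is_mop mus k (mop k).
Proof.
have [[p hp]|no] := pselect (exists p, is_mop mus k p).
  exact: (@xgetI _ _ [set p | is_mop mus k p] p hp).
have := perf k; rewrite /Defs.mop xgetPN ?size_poly0// => p hp.
by apply: no; exists p.
Qed.

Lemma monic_mop k : mop k \is monic.
Proof. by have [] := mop_is_mop k. Qed.

Lemma mop_orth k j i : (i < k j)%N -> pint j (mop k * 'X^i) = 0.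
Proof. by have [_ /orthogonalE + _] := mop_is_mop k; apply. Qed.

(** The first pairing of mop k with a power that orthogonality does not kill. *)
Definition mop_norm k j := pint j (mop k * 'X^(k j)).

Lemma mi_size_succ k j : mi_size (mi_succ k j) = (mi_size k).+1.
Proof.
rewrite /mi_size (bigD1 j)//= [in RHS](bigD1 j)//= ffunE eqxx addn1 addSn.
congr (_ + _).+1; apply: eq_bigr => i /negPf ij.
by rewrite ffunE ij addn0.
Qed.

(** If it vanished, mop k would be orthogonal for mi_succ k j, against the degree
    imposed by perfectness. *)
Lemma mop_norm_neq0 k j : mop_norm k j != 0.
Proof.
apply/eqP => N0; have [_ _ /(_ (mop k) (monic_mop k))] := mop_is_mop (mi_succ k j).
suff o : mop_orthogonal mus (mi_succ k j) (mop k).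
  by move=> /(_ o); rewrite !perf mi_size_succ ltnn.
apply/orthogonalE => i l; rewrite ffunE; case: (eqVneq i j) => [->|ij].
  rewrite addn1 ltnS leq_eqVlt => /orP[/eqP ->//|]; exact: mop_orth.
by rewrite addn0; exact: mop_orth.
Qed.

Lemma mi_predK k j : (0 < k j)%N -> mi_succ (mi_pred k j) j = k.
Proof.
move=> kj; apply/ffunP => i; rewrite !ffunE; case: eqVneq => [->|_].
  by rewrite subnK.
by rewrite subn0 addn0.
Qed.

Lemma mi_succK k j : mi_pred (mi_succ k j) j = k.
Proof. by apply/ffunP => i; rewrite !ffunE addnK. Qed.

Lemma mi_pred_succ k j l : (0 < k j)%N ->
  mi_pred (mi_succ k l) j = mi_succ (mi_pred k j) l.
Proof.
move=> kj; apply/ffunP => i; rewrite !ffunE; case: (eqVneq i j) => [->|_].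
  by rewrite addnBAC.
by rewrite !subn0.
Qed.

Lemma mop_norm_pred k j : (0 < k j)%N ->
  mop_norm k j = a k j * mop_norm (mi_pred k j) j.
Proof.
move=> kj; have [rec _] := ab_rec.
have kjE : k j = (mi_pred k j j).+1 by rewrite ffunE eqxx subn1 prednK.
have := congr1 (fun q => pint j (q * 'X^(mi_pred k j j))) (rec k j).
rewrite /= -mulrA mulrCA -exprS -kjE -/(mop_norm k j) => ->.
have o1 : pint j (mop k * 'X^(mi_pred k j j)) = 0.
  by apply: mop_orth; rewrite [X in (_ < X)%N]kjE.
have o2 : pint j (mop (mi_succ k j) * 'X^(mi_pred k j j)) = 0.
  by apply: mop_orth; rewrite [X in (_ < X)%N]ffunE eqxx addn1 kjE ltnW.
rewrite !mulrDl -scalerAl !(pintD (mom j)) (pintZ (mom j)) o1 o2.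
rewrite mulr0 !add0r mulr_suml (pint_sum (mom j)) (bigD1 j)//= big1 ?addr0.
  by rewrite -scalerAl (pintZ (mom j)).
move=> i /andP[ki ij]; rewrite -scalerAl (pintZ (mom j)) mop_orth ?mulr0//.
by rewrite [X in (_ < X)%N]ffunE eq_sym (negPf ij) subn0 kjE.
Qed.

Lemma mop_succB k j l :
  mop (mi_succ k l) - mop (mi_succ k j) = (b k j - b k l) *: mop k.
Proof.
have [rec _] := ab_rec; have := rec k l; rewrite (rec k j) => /addIr E.
have -> : mop (mi_succ k l) = mop (mi_succ k j) + b k j *: mop k - b k l *: mop k.
  by rewrite E addrK.
by rewrite scalerBl addrC !addrA addNr add0r.
Qed.

(** Integrate [mop_succB] against x^(k_j), which mop (mi_succ k j) annihilates. *)
Lemma mop_norm_succ k j l : j != l ->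
  mop_norm (mi_succ k l) j = (b k j - b k l) * mop_norm k j.
Proof.
move=> jl; rewrite /mop_norm ffunE (negPf jl) addn0.
have := congr1 (fun q => pint j (q * 'X^(k j))) (mop_succB k j l).
rewrite /= mulrBl (pintB (mom j)) -scalerAl (pintZ (mom j)) => <-.
by rewrite [X in _ - X]mop_orth ?subr0// ffunE eqxx addn1.
Qed.

(** Both sides, multiplied by the nonzero norm at mi_pred k j, equal the norm at
    mi_succ k l computed in two ways. *)
Lemma rec_compat k j l : (0 < k j)%N -> j != l ->
  a (mi_succ k l) j * (b (mi_pred k j) j - b (mi_pred k j) l) =
  (b k j - b k l) * a k j.
Proof.
move=> kj jl; have skj : (0 < mi_succ k l j)%N by rewrite ffunE addn_gt0 kj.
apply: (mulIf (mop_norm_neq0 (mi_pred k j) j)).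
rewrite -mulrA -mop_norm_succ// -mi_pred_succ// -mop_norm_pred//.
by rewrite mop_norm_succ// -mulrA -mop_norm_pred.
Qed.

Variables (kk : nat -> multi_index m) (lk : nat -> 'I_m).
Hypothesis kk_size : forall r, mi_size (kk r) = r.
Hypothesis kk_path : forall r, kk r.+1 = mi_succ (kk r) (lk r).

Definition path_mop r := mop (kk r).
(** Zero when k_j = 0, as mi_pred is then meaningless. *)
Definition path_v r j : {poly R} :=
  if (0 < kk r j)%N then a (kk r) j *: mop (mi_pred (kk r) j) else 0.

Lemma size_path_mop r : size (path_mop r) = r.+1.
Proof. by rewrite /path_mop perf kk_size. Qed.

Lemma monic_path_mop r : path_mop r \is monic.
Proof. exact: monic_mop. Qed.

Lemma path_rec r : 'X * path_mop r =
  path_mop r.+1 + b (kk r) (lk r) *: path_mop r + \sum_j path_v r j.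
Proof.
have [rec _] := ab_rec; rewrite /path_mop (rec _ (lk r)) kk_path; congr (_ + _).
by rewrite big_mkcond.
Qed.

Lemma path_v0 j : path_v 0 j = 0.
Proof.
rewrite /path_v; have := kk_size 0; rewrite /mi_size => /eqP.
by rewrite sum_nat_eq0 => /forallP/(_ j)/= /eqP ->.
Qed.

(** From mop (k - e_j + e_l) - mop k = (b_j - b_l) mop (k - e_j), with coefficients
    moved from k - e_j to k by [rec_compat].  When the step is in direction j
    itself the second term is absent, and so is the factor b_j - b_l. *)
Lemma path_vS r j : path_v r.+1 j = a (kk r.+1) j *: path_mop r +
  (b (kk r) j - b (kk r) (lk r)) *: path_v r j.
Proof.
have [_ a0] := ab_rec; rewrite /path_v /path_mop kk_path.
have [->|jl] := eqVneq j (lk r).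
  by rewrite ffunE eqxx addn1/= mi_succK subrr scale0r addr0.
rewrite ffunE (negPf jl) addn0; case: posnP => [kj|kj].
  by rewrite scaler0 a0 ?scale0r ?addr0// ffunE (negPf jl) addn0.
rewrite mi_pred_succ//.
have := mop_succB (mi_pred (kk r) j) j (lk r); rewrite (mi_predK kj) => /eqP.
rewrite subr_eq => /eqP ->.
by rewrite scalerDr !scalerA rec_compat// addrC.
Qed.

(** Multi-indices increase along the path, hence so do orthogonality relations. *)
Lemma path_orth n r j i : (n <= r)%N -> (i < kk n j)%N ->
  pint j (path_mop r * 'X^i) = 0.
Proof.
move=> nr ij; apply: mop_orth; apply: (leq_trans ij).
elim: r nr => [|r IH]; first by rewrite leqn0 => /eqP ->.
rewrite leq_eqVlt => /orP[/eqP -> //|]; rewrite ltnS => /IH h.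
by rewrite (leq_trans h)// kk_path ffunE leq_addr.
Qed.

End NearestNeighborPath.

(** * Integrals of products against determinantal laws *)

Section Transfer.
Import HBNNSimple.
Context dO dT (Om : measurableType dO) (T : measurableType dT) (R : realType).
Variables (Q : {measure set Om -> \bar R}) (mu : {measure set T -> \bar R}).
Variables (G : Om -> R) (Y : Om -> T) (k : T -> R).
Hypothesis mG : measurable_fun setT G.
Hypothesis G0 : forall o, 0 <= G o.
Hypothesis mY : measurable_fun setT Y.
Hypothesis ik : mu.-integrable setT (EFin \o k).
Hypothesis rect : forall A, measurable A ->
  (\int[Q]_o (G o * \1_A (Y o))%:E =
   (Rintegral mu setT (fun x => \1_A x * k x))%:E)%E.

Lemma integrable_mul_indic A : measurable A ->
  mu.-integrable setT (EFin \o (fun x => \1_A x * k x)).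
Proof.
move=> mA; apply: le_integrable (ik) => //.
  apply/measurable_EFinP; apply: measurable_funM => //.
  by apply/measurable_EFinP; exact: measurable_int ik.
move=> x _ /=; rewrite lee_fin normrM ler_piMl// indicE.
by case: (x \in A); rewrite /= ?normr1 ?normr0.
Qed.

Lemma measurable_mul_comp (g : T -> R) : measurable_fun setT g ->
  measurable_fun setT (fun o => G o * g (Y o)).
Proof.
by move=> mg; apply: measurable_funM => //; exact: (measurableT_comp mg mY).
Qed.

(** Linear combinations of indicators, for which the identity is the hypothesis. *)
Lemma transfer_simple (h : {nnsfun T >-> R}) :
  (\int[Q]_o (G o * h (Y o))%:E = (Rintegral mu setT (fun x => h x * k x))%:E)%E.
Proof.
pose s := fset_set (range h).
pose B (i : 'I_(#|` s|)) := h @^-1` [set s`_i].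
have mB i : measurable (B i) by exact: measurable_sfunP.
have hE x : h x = \sum_(i < #|` s|) s`_i * \1_(B i) x by rewrite fimfunEord.
have iG i : Q.-integrable setT (EFin \o (fun o => G o * \1_(B i) (Y o))).
  apply/integrableP; split.
    by apply/measurable_EFinP; apply: measurable_mul_comp.
  under eq_integral => o _.
    rewrite /= ger0_norm ?mulr_ge0//; over.
  by rewrite rect// ltry.
transitivity ((Rintegral Q setT (fun o => \sum_(i < #|` s|) s`_i * (G o * \1_(B i) (Y o))))%:E)%E.
  rewrite /Rintegral fineK.
    apply: eq_integral => o _; rewrite hE mulr_sumr; congr (_%:E).
    by apply: eq_bigr => i _; rewrite mulrCA.
  apply: integrable_fin_num => //.
  apply: (@integrable_Rsum _ _ _ Q _ _ _ (fun (i : 'I_(#|` s|)) o => s`_i * (G o * \1_(B i) (Y o)))) => i.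
  exact: (@integrable_Rscale _ _ _ Q _ (fun o => G o * \1_(B i) (Y o))).
congr (_%:E).
rewrite (@Rintegral_sum _ _ _ Q _ _ _ (fun (i : 'I_(#|` s|)) o => s`_i * (G o * \1_(B i) (Y o)))); last first.
  move=> i; exact: (@integrable_Rscale _ _ _ Q _ (fun o => G o * \1_(B i) (Y o))).
transitivity (Rintegral mu setT (fun x => \sum_(i < #|` s|) s`_i * (\1_(B i) x * k x))); last first.
  apply: eq_Rintegral => x _; rewrite hE mulr_suml.
  by apply: eq_bigr => i _; rewrite mulrA.
rewrite (@Rintegral_sum _ _ _ mu _ _ _ (fun (i : 'I_(#|` s|)) x => s`_i * (\1_(B i) x * k x))); last first.
  move=> i; apply: (@integrable_Rscale _ _ _ mu _ (fun x => \1_(B i) x * k x)).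
  exact: integrable_mul_indic.
apply: eq_bigr => i _.
rewrite RintegralZl//; rewrite RintegralZl//; last exact: integrable_mul_indic.
by congr (_ * _); rewrite /Rintegral rect.
Qed.

Lemma integral_transfer (g : T -> R) : measurable_fun setT g -> (forall x, 0 <= g x) ->
  mu.-integrable setT (EFin \o (fun x => g x * k x)) ->
  (\int[Q]_o (G o * g (Y o))%:E = (Rintegral mu setT (fun x => g x * k x))%:E)%E.
Proof.
move=> mg g0 igk.
have mgE : measurable_fun setT (EFin \o g) by exact/measurable_EFinP.
pose h := nnsfun_approx measurableT mgE.
have hg x : h n x @[n --> \oo] --> g x.
  have := @cvg_nnsfun_approx _ _ _ _ measurableT _ mgE (fun x _ => g0 x) x I.
  by move/fine_cvgP => [_]; exact.
have ndh := @nd_nnsfun_approx _ _ _ _ measurableT _ mgE.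
have hle n x : h n x <= g x.
  have -> : g x = limn (fun n => h n x) by apply/esym/cvg_lim; [|exact: hg].
  apply: (@nondecreasing_cvgn_le _ (fun n => h n x)); last exact: (cvgP _ (hg x)).
  by move=> a b ab; have /lefP := ndh _ _ ab; apply.
have mh n : measurable_fun setT (h n : T -> R) by exact: measurable_funP.
have mk : measurable_fun setT k by apply/measurable_EFinP; exact: measurable_int ik.
have cl : (fun n => \int[Q]_o (G o * h n (Y o))%:E)%E @ \oo -->
    (\int[Q]_o (G o * g (Y o))%:E)%E.
  have -> : (\int[Q]_o (G o * g (Y o))%:E)%E =
      (\int[Q]_o limn (fun n => (G o * h n (Y o))%:E))%E.
    apply: eq_integral => o _; apply/esym/cvg_lim => //.
    apply: cvg_EFin; first by near=> n.
    by apply: cvgM; [exact: cvg_cst|exact: hg].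
  apply: cvg_monotone_convergence => //.
  - by move=> n; apply/measurable_EFinP; exact: measurable_mul_comp.
  - by move=> n o _; rewrite lee_fin mulr_ge0.
  - move=> o _ a b ab; rewrite lee_fin ler_wpM2l//.
    by have /lefP := ndh _ _ ab; apply.
have cr : (fun n => \int[mu]_x (h n x * k x)%:E)%E @ \oo -->
    (\int[mu]_x (g x * k x)%:E)%E.
  have [//|//||||_ _] := @dominated_convergence _ _ _ mu _ measurableT
    (fun n x => (h n x * k x)%:E) (fun x => (g x * k x)%:E)
    (fun x => `|(g x * k x)%:E|%E).
  - by move=> n; apply/measurable_EFinP; exact: measurable_funM.
  - by apply/measurable_EFinP; exact: measurable_funM.
  - apply: aeW => x _; apply: cvg_EFin; first by near=> n.
    by apply: cvgM; [exact: hg|exact: cvg_cst].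
  - exact: integrable_abse.
  - apply: aeW => x n _; rewrite !abse_EFin lee_fin !normrM ler_wpM2r//.
    by rewrite !ger0_norm.
  by [].
have -> : (Rintegral mu setT (fun x => g x * k x))%:E = (\int[mu]_x (g x * k x)%:E)%E.
  by rewrite /Rintegral fineK//; apply: integrable_fin_num.
apply: (cvg_unique _ cl); first exact: ereal_hausdorff.
rewrite (_ : (fun n => _) = (fun n => \int[mu]_x (h n x * k x)%:E)%E)//.
apply/funext => n; rewrite transfer_simple /Rintegral fineK//.
apply: integrable_fin_num => //; apply: le_integrable igk => //.
  by apply/measurable_EFinP; exact: measurable_funM.
move=> x _; rewrite !abse_EFin lee_fin !normrM ler_wpM2r//.
by rewrite !ger0_norm.
Unshelve. all: by end_near. Qed.

Lemma integral_transfer_ge0 (g : T -> R) : (forall x, 0 <= k x) ->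
  measurable_fun setT g -> (forall x, 0 <= g x) ->
  (\int[Q]_o (G o * g (Y o))%:E = \int[mu]_x (g x * k x)%:E)%E.
Proof.
move=> k0 mg g0; have mgE : measurable_fun setT (EFin \o g) by exact/measurable_EFinP.
pose h := nnsfun_approx measurableT mgE.
have hg x : h n x @[n --> \oo] --> g x.
  have := @cvg_nnsfun_approx _ _ _ _ measurableT _ mgE (fun x _ => g0 x) x I.
  by move/fine_cvgP => [_]; exact.
have ndh := @nd_nnsfun_approx _ _ _ _ measurableT _ mgE.
have mh n : measurable_fun setT (h n : T -> R) by exact: measurable_funP.
have mk : measurable_fun setT k by apply/measurable_EFinP; exact: measurable_int ik.
have cl : (fun n => \int[Q]_o (G o * h n (Y o))%:E)%E @ \oo -->
    (\int[Q]_o (G o * g (Y o))%:E)%E.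
  have -> : (\int[Q]_o (G o * g (Y o))%:E)%E =
      (\int[Q]_o limn (fun n => (G o * h n (Y o))%:E))%E.
    apply: eq_integral => o _; apply/esym/cvg_lim => //.
    apply: cvg_EFin; first by near=> n.
    by apply: cvgM; [exact: cvg_cst|exact: hg].
  apply: cvg_monotone_convergence => //.
  - by move=> n; apply/measurable_EFinP; exact: measurable_mul_comp.
  - by move=> n o _; rewrite lee_fin mulr_ge0.
  - move=> o _ a b ab; rewrite lee_fin ler_wpM2l//.
    by have /lefP := ndh _ _ ab; apply.
have cr : (fun n => \int[mu]_x (h n x * k x)%:E)%E @ \oo -->
    (\int[mu]_x (g x * k x)%:E)%E.
  have -> : (\int[mu]_x (g x * k x)%:E)%E =
      (\int[mu]_x limn (fun n => (h n x * k x)%:E))%E.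
    apply: eq_integral => o _; apply/esym/cvg_lim => //.
    apply: cvg_EFin; first by near=> n.
    by apply: cvgM; [exact: hg|exact: cvg_cst].
  apply: cvg_monotone_convergence => //.
  - by move=> n; apply/measurable_EFinP; exact: measurable_funM.
  - by move=> n o _; rewrite lee_fin mulr_ge0.
  - move=> o _ a b ab; rewrite lee_fin ler_wpM2r//.
    by have /lefP := ndh _ _ ab; apply.
apply: (cvg_unique _ cl); first exact: ereal_hausdorff.
rewrite (_ : (fun n => _) = (fun n => \int[mu]_x (h n x * k x)%:E)%E)//.
apply/funext => n; rewrite transfer_simple /Rintegral fineK//.
apply: integrable_fin_num => //.
have [M [_ hM]] := simple_bounded (h n).
have {}hM x : `|h n x| <= M + 1 by apply: (hM (M + 1)); rewrite ?ltrDl.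
apply: (@le_integrable _ _ _ mu _ measurableT _ (fun x => ((M + 1) * k x)%:E)).
- by apply/measurable_EFinP; exact: measurable_funM.
- move=> x _; rewrite !abse_EFin lee_fin !normrM ler_wpM2r//.
  by rewrite (le_trans (hM x))// ler_norm.
- exact: (@integrable_Rscale _ _ _ mu (M + 1) k).
Unshelve. all: by end_near. Qed.

Definition pospart (g : T -> R) x := Num.max (g x) 0.

Lemma measurable_pospart (g : T -> R) : measurable_fun setT g ->
  measurable_fun setT (pospart g).
Proof. by move=> mg; apply: measurable_maxr. Qed.

Lemma integrable_pospart (g : T -> R) : measurable_fun setT g ->
  mu.-integrable setT (EFin \o (fun x => g x * k x)) ->
  mu.-integrable setT (EFin \o (fun x => pospart g x * k x)).
Proof.
move=> mg igk.
have mk : measurable_fun setT k by apply/measurable_EFinP; exact: measurable_int ik.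
apply: le_integrable igk => //.
  by apply/measurable_EFinP; apply: measurable_funM => //; exact: measurable_pospart.
move=> x _; rewrite !abse_EFin lee_fin !normrM ler_wpM2r//.
rewrite /pospart; case: (leP (g x) 0) => gx; last by rewrite ger0_norm// ltW.
by rewrite normr0.
Qed.

Lemma pospartE (g : T -> R) x : g x = pospart g x - pospart (fun x => - g x) x.
Proof.
rewrite /pospart; case: (leP (g x) 0) => gx.
  by rewrite max_l ?oppr_ge0// sub0r opprK.
by rewrite max_r ?oppr_le0 ?subr0// ltW.
Qed.

Lemma pospart_ge0 (g : T -> R) x : 0 <= pospart g x.
Proof. by rewrite /pospart le_max lexx orbT. Qed.

End Transfer.

Section ProductExpectation.
Context dO dT (Om : measurableType dO) (T : measurableType dT) (R : realType).
Variables (Q : {measure set Om -> \bar R}) (mu : {measure set T -> \bar R}).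
Variables (n : nat) (X : 'I_n -> Om -> T) (I : finType) (c : I -> R)
  (kap : I -> 'I_n -> T -> R).
Hypothesis mX : forall i, measurable_fun setT (X i).
Hypothesis ikap : forall a i, mu.-integrable setT (EFin \o kap a i).
Hypothesis rect : forall A : 'I_n -> set T, (forall i, measurable (A i)) ->
  (\int[Q]_o (\prod_i (\1_(A i) (X i o) : R))%:E =
   (\sum_a c a * \prod_i Rintegral mu setT (fun x => \1_(A i) x * kap a i x))%:E)%E.

(** Replaces the indicators by general functions one coordinate at a time: the
    other factors play the role of the weight G in [integral_transfer]. *)
Lemma expect_prod_step (j : nat) (g : 'I_n -> T -> R) :
  (forall i, measurable_fun setT (g i)) -> (forall i x, 0 <= g i x) ->
  (forall a i, mu.-integrable setT (EFin \o (fun x => g i x * kap a i x))) ->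
  (forall i : 'I_n, (j <= i)%N -> exists2 A, measurable A & g i = \1_A) ->
  (\int[Q]_o (\prod_i g i (X i o))%:E =
   (\sum_a c a * \prod_i Rintegral mu setT (fun x => g i x * kap a i x))%:E)%E.
Proof.
elim: j g => [|j IH] g mg g0 ig gA.
  have /choice[A hA] : forall i, exists A, measurable A /\ g i = \1_A.
    by move=> i; have [A mA gE] := gA i isT; exists A.
  have -> : g = fun i => \1_(A i) by apply/funext => i; have [_ ->] := hA i.
  by apply: rect => i; have [] := hA i.
have [jn|nj] := ltnP j n; last first.
  by apply: IH => // i ji; have := ltn_ord i; rewrite ltnNge (leq_trans nj).
pose j0 := Ordinal jn.
pose G o := \prod_(i | i != j0) g i (X i o).
pose ca a := c a * \prod_(i | i != j0) Rintegral mu setT (fun x => g i x * kap a i x).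
pose k x := \sum_a ca a * kap a j0 x.
have RG h : (forall a, mu.-integrable setT (EFin \o (fun x => h x * kap a j0 x))) ->
    Rintegral mu setT (fun x => h x * k x) =
    \sum_a ca a * Rintegral mu setT (fun x => h x * kap a j0 x).
  move=> ih; transitivity (Rintegral mu setT
      (fun x => \sum_a ca a * (h x * kap a j0 x))).
    apply: eq_Rintegral => x _; rewrite /k mulr_sumr.
    by apply: eq_bigr => a _; rewrite mulrCA.
  rewrite (@Rintegral_sum _ _ _ mu _ _ _ (fun a x => ca a * (h x * kap a j0 x))).
    by apply: eq_bigr => a _; rewrite RintegralZl//; exact: ih.
  by move=> a; exact: (@integrable_Rscale _ _ _ mu _ (fun x => h x * kap a j0 x)).
have iind A : measurable A -> forall a,
    mu.-integrable setT (EFin \o (fun x => \1_A x * kap a j0 x)).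
  by move=> mA a; apply: integrable_mul_indic.
transitivity (\int[Q]_o (G o * g j0 (X j0 o))%:E)%E.
  by apply: eq_integral => o _; rewrite (bigD1 j0)//= mulrC.
have mG : measurable_fun setT G.
  rewrite /G.
  have -> : (fun o => \prod_(i | i != j0) g i (X i o)) =
     (fun o => \prod_(i <- [seq i <- index_enum 'I_n | i != j0]) g i (X i o)).
    by apply/funext => o; rewrite big_filter.
  by apply: measurable_prod => i _; exact: measurableT_comp.
rewrite (@integral_transfer _ _ _ _ _ Q mu G (X j0) k) //.
- congr (_%:E); rewrite RG//.
  by apply: eq_bigr => a _; rewrite [in RHS](bigD1 j0)//= /ca mulrAC mulrA.
- by move=> o; apply: prodr_ge0.
- apply: (@integrable_Rsum _ _ _ mu _ _ _ (fun a x => ca a * kap a j0 x)) => a.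
  exact: (@integrable_Rscale _ _ _ mu _ (kap a j0)).
- move=> A mA; rewrite RG//; last exact: iind.
  pose g' i := if i == j0 then \1_A else g i.
  transitivity (\int[Q]_o (\prod_i g' i (X i o))%:E)%E.
    apply: eq_integral => o _; rewrite [in RHS](bigD1 j0)//= /g' eqxx mulrC.
    by congr (_ * _)%:E; apply: eq_bigr => i /negPf ->.
  rewrite IH.
  - congr (_%:E); apply: eq_bigr => a _; rewrite (bigD1 j0)//= /g' eqxx /ca.
    rewrite -mulrA; congr (_ * _); rewrite mulrC; congr (_ * _).
    by apply: eq_bigr => i /negPf ->.
  - by move=> i; rewrite /g'; case: eqP => // _; exact: measurable_indic.
  - by move=> i x; rewrite /g'; case: eqP.
  - by move=> a i; rewrite /g'; case: eqP => [->|_] //; exact: iind.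
  - move=> i ji; rewrite /g'; case: eqP => [_|/eqP ij]; first by exists A.
    by apply: gA; rewrite ltn_neqAle ji andbT eq_sym.
have -> : (fun x => g j0 x * k x) =
    (fun x => \sum_a ca a * (g j0 x * kap a j0 x)).
  apply/funext => x; rewrite /k mulr_sumr.
  by apply: eq_bigr => a _; rewrite mulrCA.
apply: (@integrable_Rsum _ _ _ mu _ _ _ (fun a x => ca a * (g j0 x * kap a j0 x))) => a.
exact: (@integrable_Rscale _ _ _ mu _ (fun x => g j0 x * kap a j0 x)).
Qed.

Lemma expect_prod_ge0 (g : 'I_n -> T -> R) :
  (forall i, measurable_fun setT (g i)) -> (forall i x, 0 <= g i x) ->
  (forall a i, mu.-integrable setT (EFin \o (fun x => g i x * kap a i x))) ->
  (\int[Q]_o (\prod_i g i (X i o))%:E =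
   (\sum_a c a * \prod_i Rintegral mu setT (fun x => g i x * kap a i x))%:E)%E.
Proof.
move=> mg g0 ig; apply: (@expect_prod_step n) => // i.
by rewrite leqNgt ltn_ord.
Qed.

Lemma expect_prod (g : 'I_n -> T -> R) :
  (forall i, measurable_fun setT (g i)) ->
  (forall a i, mu.-integrable setT (EFin \o (fun x => g i x * kap a i x))) ->
  Q.-integrable setT (EFin \o (fun o => \prod_i g i (X i o))) /\
  Rintegral Q setT (fun o => \prod_i g i (X i o)) =
   \sum_a c a * \prod_i Rintegral mu setT (fun x => g i x * kap a i x).
Proof.
move=> mg ig.
pose gb i (b : bool) : T -> R := if b then pospart (fun x => - g i x) else pospart (g i).
pose sg (b : bool) : R := (-1) ^+ b.
have gE i x : g i x = \sum_(b : bool) sg b * gb i b x.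
  by rewrite big_bool /= {1}pospartE /sg /= expr0 expr1 mul1r mulN1r addrC.
have mgb i b : measurable_fun setT (gb i b).
  rewrite /gb; case: b; apply: measurable_pospart => //.
  exact: measurableT_comp.
have gb0 i b x : 0 <= gb i b x by rewrite /gb; case: b; exact: pospart_ge0.
have igb a i b : mu.-integrable setT (EFin \o (fun x => gb i b x * kap a i x)).
  rewrite /gb; case: b; apply: integrable_pospart => //; first exact: measurableT_comp.
  apply: (eq_integrable measurableT (fun x => (-1 * (g i x * kap a i x))%:E)).
    by move=> x _ /=; rewrite mulN1r mulNr.
  exact: (@integrable_Rscale _ _ _ mu (-1) (fun x => g i x * kap a i x)).
pose Pe (e : {ffun 'I_n -> bool}) o := \prod_i gb i (e i) (X i o).
have PeE e := @expect_prod_ge0 (fun i => gb i (e i)) (fun i => mgb i (e i))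
   (fun i => gb0 i (e i)) (fun a i => igb a i (e i)).
have iPe e : Q.-integrable setT (EFin \o Pe e).
  apply/integrableP; split.
    apply/measurable_EFinP; apply: measurable_prod => i _.
    exact: measurableT_comp.
  under eq_integral => o _.
    rewrite /= ger0_norm; last by apply: prodr_ge0.
    over.
  by rewrite PeE ltry.
have prodE o : \prod_i g i (X i o) =
    \sum_(e : {ffun 'I_n -> bool}) (\prod_i sg (e i)) * Pe e o.
  under eq_bigr do rewrite gE.
  rewrite bigA_distr_bigA/=; apply: eq_bigr => e _.
  by rewrite big_split.
have -> : (fun o => \prod_i g i (X i o)) =
   (fun o => \sum_(e : {ffun 'I_n -> bool}) (\prod_i sg (e i)) * Pe e o).
  by apply/funext.
have isum (e : {ffun 'I_n -> bool}) : Q.-integrable setT (EFin \o (fun o => (\prod_i sg (e i)) * Pe e o)).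
  exact: integrable_Rscale.
split; first exact: (@integrable_Rsum _ _ _ Q _ _ _
  (fun (e : {ffun 'I_n -> bool}) o => (\prod_i sg (e i)) * Pe e o)).
rewrite (@Rintegral_sum _ _ _ Q _ _ _ (fun (e : {ffun 'I_n -> bool}) o => (\prod_i sg (e i)) * Pe e o))//.
transitivity (\sum_(e : {ffun 'I_n -> bool}) \sum_a
   c a * \prod_i (sg (e i) * Rintegral mu setT (fun x => gb i (e i) x * kap a i x))).
  apply: eq_bigr => e _; rewrite RintegralZl// {1}/Rintegral PeE/= mulr_sumr.
  by apply: eq_bigr => a _; rewrite mulrCA big_split.
rewrite exchange_big/=; apply: eq_bigr => a _; rewrite -mulr_sumr; congr (_ * _).
rewrite -(bigA_distr_bigA (fun i b => sg b * Rintegral mu setT (fun x => gb i b x * kap a i x))).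
apply: eq_bigr => i _; rewrite big_bool/= /sg expr0 expr1 mul1r mulN1r addrC.
rewrite -RintegralB//; [|exact: (igb a i false)|exact: (igb a i true)].
by apply: eq_Rintegral => x _; rewrite [in RHS](pospartE (g i)) mulrBl.
Qed.

End ProductExpectation.

Section Density.
Context d (T : measurableType d) (R : realType).
Variables (nu mu : {measure set T -> \bar R}) (k : T -> R).
Hypothesis ik : mu.-integrable setT (EFin \o k).
Hypothesis nu_density : forall A, measurable A -> nu A = (\int[mu]_(x in A) (k x)%:E)%E.

Lemma density_rect (A : set T) : measurable A ->
  (\int[nu]_o (1 * \1_A (idfun o) : R)%:E =
   (Rintegral mu setT (fun x => \1_A x * k x))%:E)%E.
Proof.
move=> mA; under eq_integral do rewrite mul1r.
rewrite integral_indic// setIT nu_density// integral_mkcond /Rintegral fineK.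
  apply: eq_integral => x _; rewrite patchE indicE.
  by case: ifP => _; rewrite ?mul1r ?mul0r.
apply: integrable_fin_num => //.
exact: (integrable_mul_indic ik mA).
Qed.

(** The case of one point and one term of [expect_prod]. *)
Lemma density_integral (q : T -> R) : measurable_fun setT q ->
  mu.-integrable setT (EFin \o (fun x => q x * k x)) ->
  nu.-integrable setT (EFin \o q) /\
  Rintegral nu setT q = Rintegral mu setT (fun x => q x * k x).
Proof.
move=> mq iq.
have rect (A : 'I_1 -> set T) : (forall i, measurable (A i)) ->
    (\int[nu]_o (\prod_i (\1_(A i) (idfun o) : R))%:E =
    (\sum_(a : unit) 1 * \prod_(i < 1) Rintegral mu setT (fun x => \1_(A i) x * k x))%:E)%E.
  move=> mA; transitivity (\int[nu]_o (1 * \1_(A ord0) (idfun o) : R)%:E)%E.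
    by apply: eq_integral => o _; rewrite big_ord1 mul1r.
  rewrite density_rect//.
  by rewrite (big_pred1 tt) ?big_ord1 ?mul1r//; case.
have := @expect_prod _ _ _ _ _ nu mu 1 (fun _ => idfun) unit (fun=> 1)
  (fun _ _ => k) (fun=> @measurable_id _ _ setT) (fun _ _ => ik) rect
  (fun _ => q) (fun=> mq) (fun _ _ => iq).
rewrite (big_pred1 tt) ?big_ord1 ?mul1r; last by case.
move=> [i1 <-]; split; last by apply: eq_Rintegral => x _; rewrite big_ord1.
by apply: eq_integrable i1 => // x _ /=; rewrite big_ord1.
Qed.

End Density.

(** * Exponential moments of linear statistics as corners of an exponential *)

Section Algebra.

(** For fixed st.1 the sum over st.2 is the same determinant. *)
Lemma sum_perm_det (F : comNzRingType) n (M : 'M[F]_n) :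
  \sum_(st : {perm 'I_n} * {perm 'I_n}) (-1) ^+ st.1 * (-1) ^+ st.2 *
    \prod_i M (st.1 i) (st.2 i) = (n`!)%:R * \det M.
Proof.
rewrite -(pair_bigA _ (fun s t : {perm 'I_n} => (-1) ^+ s * (-1) ^+ t *
    \prod_i M (s i) (t i)))/=.
transitivity (\sum_(s : {perm 'I_n}) \det M).
  apply: eq_bigr => s _.
  transitivity ((-1) ^+ s * \det (row_perm s M)).
    rewrite /determinant mulr_sumr; apply: eq_bigr => t _.
    by rewrite mulrA; congr (_ * _); apply: eq_bigr => i _; rewrite mxE.
  by rewrite row_permE det_mulmx det_perm mulrA -signr_addb addbb mul1r.
by rewrite sumr_const card_Sn mulr_natl.
Qed.

(** The change of basis is unitriangular. *)
Lemma det_monic_rows (R : comNzRingType) n (p : nat -> {poly R}) (x : 'I_n -> R) :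
  (forall r, size (p r) = r.+1) -> (forall r, p r \is monic) ->
  \det (\matrix_(i < n, j < n) (x i ^+ j)) = \det (\matrix_(i, j) (p j).[x i]).
Proof.
move=> sp mp; pose U : 'M[R]_n := \matrix_(l, j) (p j)`_l.
have -> : \matrix_(i, j) (p j).[x i] = (\matrix_(i < n, j < n) (x i ^+ j)) *m U.
  apply/matrixP => i j; rewrite !mxE (@horner_coef_wide _ n) ?sp//.
  by apply: eq_bigr => l _; rewrite !mxE mulrC.
rewrite det_mulmx; have -> : \det U = 1; last by rewrite mulr1.
rewrite -det_tr det_trig; last first.
  apply/is_trig_mxP => i j ij; rewrite !mxE nth_default// sp//.
apply: big1 => i _; rewrite !mxE.
by have /monicP := mp i; rewrite lead_coefE sp.
Qed.

Variable R : numFieldType.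

(** Truncated exponential series, the generating function of a linear statistic
    in the formal variable. *)
Definition texp (T : nat) (c : R) : {poly R} := \poly_(a < T.+1) (c ^+ a / a`!%:R).

Lemma prod_texp T (I : Type) (s : seq I) (c : I -> R) k : (k <= T)%N ->
  (\prod_(i <- s) texp T (c i))`_k = (\sum_(i <- s) c i) ^+ k / k`!%:R.
Proof.
elim: s k => [|i s IH] k kT.
  rewrite !big_nil coef1; case: k kT => [|k] _ /=.
    by rewrite expr0 fact0 divr1.
  by rewrite expr0n mul0r.
rewrite !big_cons coefM [c i + _]addrC exprDn mulr_suml; apply: eq_bigr => l _.
have lk : (l <= k)%N by rewrite -ltnS.
rewrite coef_poly ltnS (leq_trans lk)// IH ?(leq_trans (leq_subr _ _))//.
rewrite -mulr_natr -(bin_fact lk) !natrM.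
have f0 a : (a`!%:R : R) != 0 by rewrite pnatr_eq0 -lt0n fact_gt0.
have b0 : ('C(k, l)%:R : R) != 0 by rewrite pnatr_eq0 -lt0n bin_gt0.
have := f0 l; have := f0 (k - l)%N; move: b0.
set A := c i ^+ l; set B := (\sum_(j <- s) c j) ^+ _.
set x := _%:R; set y := (_`!)%:R; set z := (_`!)%:R => x0 y0 z0.
by field; rewrite x0 y0 z0.
Qed.

End Algebra.

Section Ensemble.
Variables (R : realType) (m : nat).
Variable mu : {measure set (measurableTypeR R) -> \bar R}.
Variable w : 'I_m -> measurableTypeR R -> R.
Variable mus : 'I_m -> {measure set (measurableTypeR R) -> \bar R}.
Hypothesis w_meas : forall j, measurable_fun setT (w j).
Hypothesis w_ge0 : forall j x, 0 <= w j x.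
Hypothesis mus_density : forall j (A : set (measurableTypeR R)), measurable A ->
     mus j A = (\int[mu]_(x in A) (w j x)%:E)%E.
Hypothesis mom : finite_moments mus.

Lemma integrable_weight j : mu.-integrable setT (EFin \o w j).
Proof.
apply/integrableP; split; first exact/measurable_EFinP.
under eq_integral => x _ do rewrite /= ger0_norm//.
rewrite -mus_density//.
have /integrableP[_] := mom j 0.
under eq_integral => x _ do rewrite /= normr1.
by rewrite integral_cst// mul1e.
Qed.

Lemma measurable_horner (q : {poly R}) :
  measurable_fun setT (fun x : measurableTypeR R => q.[x]).
Proof.
have -> : (fun x : measurableTypeR R => q.[x]) =
   (fun x => \sum_(i < size q) q`_i * x ^+ i).
  by apply/funext => x; rewrite horner_coef.
apply: measurable_sum => i; apply: measurable_funM => //.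
Qed.

(** Moments are assumed finite for the densities; this transfers them back to the
    reference measure. *)
Lemma integrable_horner_weight j (q : {poly R}) :
  mu.-integrable setT (EFin \o (fun x : measurableTypeR R => q.[x] * w j x)).
Proof.
have mq := measurable_horner q.
apply/integrableP; split; first by apply/measurable_EFinP; apply: measurable_funM.
have := @integral_transfer_ge0 _ _ _ _ _ (mus j) mu (fun=> 1) idfun (w j)
  (@measurable_cst _ _ _ _ setT (1 : R)) (fun=> ler01) (@measurable_id _ _ setT)
  (integrable_weight j) (@density_rect _ _ _ (mus j) mu (w j) (integrable_weight j) (@mus_density j))
  (fun x => `|q.[x]|) (w_ge0 j)
  (measurableT_comp (@normr_measurable _ setT) mq) (fun x => normr_ge0 _).
under [X in _ = X -> _]eq_integral => x _.
  rewrite -{1}[w j x]ger0_norm// -normrM; over.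
move=> <-; have /integrableP[_] := integrable_horner (mom j) q.
by congr (_ < _)%E; apply: eq_integral => x _; rewrite mul1r.
Qed.

Lemma Rintegral_horner_weight j (q : {poly R}) :
  Rintegral mu setT (fun x : measurableTypeR R => q.[x] * w j x) = pint (mus j) q.
Proof.
by rewrite /pint; have [_ <-] := density_integral (integrable_weight j) (@mus_density j)
  (measurable_horner q) (integrable_horner_weight j q).
Qed.

(** On products the iterated integral factors one variable at a time, whatever the
    reference measure. *)
Lemma iterated_lincomb (I : finType) n (c : I -> R)
    (F : I -> 'I_n -> measurableTypeR R -> R) :
  (forall a i, mu.-integrable setT (EFin \o F a i)) ->
  iterated_integral mu (fun t : n.-tuple (measurableTypeR R) =>
     (\sum_a c a * \prod_i F a i (tnth t i))%:E) =
  (\sum_a c a * \prod_i Rintegral mu setT (F a i))%:E.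
Proof.
elim: n c F => [|n IH] c F iF /=.
  by congr (_%:E); apply: eq_bigr => a _; rewrite !big_ord0.
transitivity (\int[mu]_x (\sum_a (c a * \prod_(i < n)
    Rintegral mu setT (F a (lift ord0 i))) * F a ord0 x)%:E)%E.
  apply: eq_integral => x _.
  transitivity (iterated_integral mu (fun t : n.-tuple (measurableTypeR R) =>
     (\sum_a (c a * F a ord0 x) * \prod_i F a (lift ord0 i) (tnth t i))%:E)).
    congr (iterated_integral mu _); apply/funext => t; congr (_%:E).
    apply: eq_bigr => a _; rewrite big_ord_recl tnth0 mulrA.
    by congr (_ * _); apply: eq_bigr => i _; rewrite tnthS.
  rewrite (IH (fun a => c a * F a ord0 x) (fun a i => F a (lift ord0 i))); last first.
    by move=> a i; exact: iF.
  by congr (_%:E); apply: eq_bigr => a _; rewrite mulrAC.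
pose G a x := (c a * \prod_(i < n) Rintegral mu setT (F a (lift ord0 i))) * F a ord0 x.
have iG a : mu.-integrable setT (EFin \o G a) by exact: integrable_Rscale.
transitivity ((Rintegral mu setT (fun x => \sum_a G a x))%:E).
  by rewrite /Rintegral fineK//; apply: integrable_fin_num => //; exact: integrable_Rsum.
rewrite Rintegral_sum//; congr (_%:E); apply: eq_bigr => a _.
rewrite RintegralZl// big_ord_recl -mulrA; congr (_ * _); exact: mulrC.
Qed.

Lemma mope_functions_nth k c : (c < mi_size k)%N ->
  exists jl : 'I_m * nat, (jl.2 < k jl.1)%N /\
    nth (fun=> 0) (mope_functions w k) c = (fun x : R => x ^+ jl.2 * w jl.1 x).
Proof.
move=> ck; pose idx : seq ('I_m * nat) :=
  flatten [seq [seq (j, l) | l <- iota 0 (k j)] | j <- enum 'I_m].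
pose F (jl : 'I_m * nat) : R -> R := fun x : R => x ^+ jl.2 * w jl.1 x.
have fE : mope_functions w k = map F idx.
  rewrite /mope_functions /idx map_flatten; congr flatten.
  rewrite -[RHS]map_comp; by apply: eq_map => j; rewrite /= -[RHS]map_comp.
have sE : size idx = mi_size k.
  rewrite /idx size_flatten /shape -map_comp sumnE big_map /mi_size big_enum/=.
  by apply: eq_bigr => j _; rewrite size_map size_iota.
have cs : (c < size idx)%N by rewrite sE.
have [x0 _] : exists x : 'I_m * nat, True by case: (idx) cs => // x ? _; exists x.
exists (nth x0 idx c); split; last by rewrite fE (nth_map x0).
have /flattenP[s /mapP[j _ ->] /mapP[l]] := mem_nth x0 cs.
by rewrite mem_iota add0n => /andP[_ lk] ->.
Qed.

Section Law.
Variables (k : multi_index m) (n : nat).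
Hypothesis k_size : mi_size k = n.
Context d (Om : measurableType d) (P : probability Om R).
Variable X : {RV P >-> n.-tuple (measurableTypeR R)}.
Hypothesis X_mope : is_mope mu w k (distribution P X).
Variable p : nat -> {poly R}.
Hypothesis size_p : forall r, size (p r) = r.+1.
Hypothesis monic_p : forall r, p r \is monic.
Hypothesis orth_p : forall r j i, (n <= r)%N -> (i < k j)%N ->
  pint (mus j) (p r * 'X^i) = 0.
Variable J : 'I_n -> 'I_m * nat.
Hypothesis J_lt : forall c, ((J c).2 < k (J c).1)%N.
Hypothesis J_fun : forall c : 'I_n, nth (fun=> 0) (mope_functions w k) c =
  (fun x : R => x ^+ (J c).2 * w (J c).1 x).

Let Z := mope_Z mu w k n.
Let S2 := ({perm 'I_n} * {perm 'I_n})%type.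
Let sgn2 (a : S2) : R := Z^-1 * ((-1) ^+ a.1 * (-1) ^+ a.2).
Let kap (a : S2) (i : 'I_n) (x : measurableTypeR R) : R :=
  (p (a.1 i) * 'X^((J (a.2 i)).2)).[x] * w (J (a.2 i)).1 x.

Lemma mope_weightE (x : n.-tuple (measurableTypeR R)) :
  Z^-1 * mope_weight w k x = \sum_a sgn2 a * \prod_i kap a i (tnth x i).
Proof.
rewrite /mope_weight (det_monic_rows (fun i => tnth x i : R) size_p monic_p).
rewrite /determinant big_distrlr/= pair_bigA/= mulr_sumr; apply: eq_bigr => -[s t] _ /=.
rewrite mulrACA /sgn2/= -!mulrA; congr (_ * (_ * (_ * _))).
rewrite -big_split/=; apply: eq_bigr => i _; rewrite !mxE J_fun.
by rewrite /kap/= hornerM hornerXn mulrA.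
Qed.

Lemma integrable_kap a i : mu.-integrable setT (EFin \o kap a i).
Proof. exact: integrable_horner_weight. Qed.

Lemma measurable_rectangle (A : 'I_n -> set (measurableTypeR R)) :
  (forall i, measurable (A i)) ->
  measurable [set t : n.-tuple (measurableTypeR R) | forall i, A i (tnth t i)].
Proof.
move=> mA; have -> : [set t : n.-tuple (measurableTypeR R) | forall i, A i (tnth t i)] =
    \bigcap_(i in [set: 'I_n]) ((fun t => tnth t i) @^-1` A i).
  by apply/seteqP; split => t h i; [move=> _; exact: h|exact: h].
apply: fin_bigcap_measurable => // i _.
by rewrite -[X in measurable X]setTI; apply: measurable_tnth.
Qed.

(** The ensemble evaluated on rectangles, where its density is a combination of
    products by [mope_weightE]. *)
Lemma rectangle_law (A : 'I_n -> set (measurableTypeR R)) :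
  (forall i, measurable (A i)) ->
  (\int[P]_o (\prod_i (\1_(A i) (tnth (X o) i) : R))%:E =
   (\sum_a sgn2 a * \prod_i Rintegral mu setT (fun x => \1_(A i) x * kap a i x))%:E)%E.
Proof.
move=> mA; set B := [set t : n.-tuple (measurableTypeR R) | forall i, A i (tnth t i)].
have mB : measurable B by exact: measurable_rectangle.
have BE t : \1_B t = \prod_i (\1_(A i) (tnth t i) : R).
  rewrite indicE; have [tB|tB] := pselect (B t).
    by rewrite mem_set// big1// => i _; rewrite indicE mem_set//; exact: tB.
  have [i Ai] : exists i, ~ A i (tnth t i) by apply/existsNP.
  rewrite memNset//.
  by rewrite (bigD1 i)//= indicE memNset// mul0r.
transitivity (distribution P X B).
  rewrite /distribution /pushforward/=.
  transitivity (\int[P]_o (\1_(X @^-1` B) o)%:E)%E.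
    by apply: eq_integral => o _; rewrite -BE.
  rewrite integral_indic ?setIT//.
  by rewrite -[X in measurable X]setTI; exact: measurable_funP.
rewrite X_mope// -(@iterated_lincomb _ _ sgn2 (fun a i x => \1_(A i) x * kap a i x)).
  congr (iterated_integral mu _); apply/funext => t; congr (_%:E).
  rewrite mope_weightE BE mulr_sumr; apply: eq_bigr => a _.
  by rewrite mulrCA -big_split.
by move=> a i; apply: integrable_mul_indic => //; exact: integrable_kap.
Qed.

Lemma expect_horner (q : 'I_n -> {poly R}) :
  P.-integrable setT (EFin \o (fun o => \prod_i (q i).[tnth (X o) i])) /\
  Rintegral P setT (fun o => \prod_i (q i).[tnth (X o) i]) =
  \sum_a sgn2 a * \prod_i pint (mus (J (a.2 i)).1)
     (q i * (p (a.1 i) * 'X^((J (a.2 i)).2))).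
Proof.
have iq a i : mu.-integrable setT (EFin \o (fun x => (q i).[x] * kap a i x)).
  apply: (eq_integrable measurableT _ _ _
   (integrable_horner_weight (J (a.2 i)).1 (q i * (p (a.1 i) * 'X^((J (a.2 i)).2))))).
  by move=> x _ /=; rewrite /kap hornerM mulrA.
have := @expect_prod _ _ _ _ _ P mu n (fun i o => tnth (X o) i) S2 sgn2 kap _
  integrable_kap rectangle_law (fun i x => (q i).[x]) (fun i => measurable_horner (q i)) iq.
case=> [i|iP ->].
  by apply: (@measurableT_comp _ _ _ _ _ _ (fun t => tnth t i)) => //; exact: measurable_tnth.
split=> //; apply: eq_bigr => a _; congr (_ * _); apply: eq_bigr => i _.
rewrite -Rintegral_horner_weight; apply: eq_Rintegral => x _.
by rewrite /kap [in RHS]hornerM mulrA.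
Qed.

Variables (f : {poly R}) (deg T K : nat).
Hypothesis size_f : (size f <= deg.+1)%N.
Hypothesis K_large : (T * deg <= K)%N.

Let S o : R := \sum_(i < n) f.[tnth (X o) i].
Let H : 'M[R]_(n + K) := opmx p (n + K) (fun q => f * q).

(** n x n corner of exp (t H), H truncated at size n + K: the truncation does not
    affect the coefficients of order at most T when T deg <= K. *)
Definition moment_corner : nat -> 'M[R]_n :=
  corner (ulsubmx H) (ursubmx H) (dlsubmx H) (drsubmx H).

Lemma moment_cornerE a (i j : 'I_n) : (a <= T)%N ->
  moment_corner a i j = (a`!%:R)^-1 * crd p (f ^+ a * p i) j.
Proof.
move=> aT; rewrite /moment_corner /corner submxK /fexp !mxE; congr (_ * _).
have lf : linear (fun q : {poly R} => f * q) by move=> c q q'; rewrite mulrDr scalerAr.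
have iterE l : iter l (fun q => f * q) (p i) = f ^+ l * p i.
  by elim: l => [|l IH]; rewrite ?mul1r//= IH exprS mulrA.
rewrite (opmxX size_p monic_p)//= ?iterE// => l la; rewrite iterE.
have fl : (size (f ^+ l) <= (l * deg).+1)%N.
  apply: (leq_trans (size_poly_exp_leq _ _)); rewrite ltnS mulnC leq_mul2l.
  by rewrite -subn1 leq_subLR add1n size_f orbT.
apply: leq_trans (size_polyMleq _ _) _; rewrite size_p.
have : (l * deg <= T * deg)%N by rewrite leq_mul2r (leq_trans (ltnW la))// orbT.
by have := ltn_ord i; lia.
Qed.

Let Mgen : 'M[{poly R}]_n := \matrix_(r, c) \poly_(a < T.+1)
  (pint (mus (J c).1) (f ^+ a * (p r * 'X^((J c).2))) / a`!%:R).
Let G0 : 'M[R]_n := \matrix_(r, c) pint (mus (J c).1) (p r * 'X^((J c).2)).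

(** Expanding f^a p_r in the basis p_s, the terms with n <= s are annihilated by
    orthogonality, which leaves the corner times the Gram matrix G0. *)
Lemma Mgen_factor : Mgen = fpoly T.+1 moment_corner *m map_mx polyC G0.
Proof.
apply/matrixP => r c; apply/polyP => a; rewrite !mxE coef_sum coef_poly.
under eq_bigr => s _ do rewrite !mxE coefMC coef_poly.
case: ltnP => aT; last by rewrite big1// => s _; rewrite mul0r.
under eq_bigr => s _ do rewrite moment_cornerE// -mulrA.
rewrite -mulr_sumr mulrC; congr (_ * _).
set q := f ^+ a * p r; rewrite mulrA -/q.
have qN : (size q <= n + size q)%N by rewrite leq_addl.
rewrite {1}(crd_expand size_p monic_p qN) mulr_suml (pint_sum (mom (J c).1)).
rewrite big_split_ord/= [X in _ + X]big1 ?addr0; last first.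
  move=> i _; rewrite -scalerAl (pintZ (mom _)) orth_p ?mulr0// leq_addr//.
by apply: eq_bigr => s _; rewrite -scalerAl (pintZ (mom _)).
Qed.

Lemma coef_prod_poly (F : 'I_n -> nat -> R) l :
  (\prod_(i < n) \poly_(a < T.+1) F i a)`_l =
  \sum_(A : {ffun 'I_n -> 'I_T.+1}) (l == \sum_i A i)%N%:R * \prod_i F i (A i).
Proof.
under eq_bigr do rewrite poly_def.
rewrite bigA_distr_bigA/= coef_sum; apply: eq_bigr => A _.
have -> : \prod_i (F i (A i) *: 'X^(A i)) = (\prod_i F i (A i)) *: 'X^(\sum_i A i).
  rewrite scaler_prod; congr (_ *: _).
  by elim/big_rec2 : _ => [|i y1 y2 _ ->]; rewrite ?expr0// exprD.
by rewrite coefZ coefXn mulrC.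
Qed.

(** An Andreief-type identity: the expectation of a product over the points is
    the determinant of the one-point integrals. *)
Lemma expect_coef l : 
  P.-integrable setT (EFin \o (fun o => (\prod_(i < n) texp T f.[tnth (X o) i])`_l)) /\
  Rintegral P setT (fun o => (\prod_(i < n) texp T f.[tnth (X o) i])`_l) =
  Z^-1 * (n`!)%:R * (\det Mgen)`_l.
Proof.
pose q a : {poly R} := (a`!%:R)^-1 *: f ^+ a.
pose F (A : {ffun 'I_n -> 'I_T.+1}) o := (l == \sum_i A i)%N%:R *
   \prod_i (q (A i)).[tnth (X o) i].
have E : (fun o => (\prod_(i < n) texp T f.[tnth (X o) i])`_l) = (fun o => \sum_A F A o).
  apply/funext => o; rewrite /texp (coef_prod_poly (fun i a => f.[tnth (X o) i] ^+ a / a`!%:R)).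
  apply: eq_bigr => A _; congr (_ * _); apply: eq_bigr => i _.
  by rewrite /q hornerZ horner_exp mulrC.
have iF A : P.-integrable setT (EFin \o F A).
  apply: integrable_Rscale.
  by have [] := expect_horner (fun i => q (A i)).
rewrite E; split; first exact: (@integrable_Rsum _ _ _ P _ _ _ F).
rewrite (@Rintegral_sum _ _ _ P _ _ _ F)//.
transitivity (\sum_(A : {ffun 'I_n -> 'I_T.+1}) \sum_a sgn2 a *
   ((l == \sum_i A i)%N%:R * \prod_i pint (mus (J (a.2 i)).1)
     (q (A i) * (p (a.1 i) * 'X^((J (a.2 i)).2))))).
  apply: eq_bigr => A _.
  have [iA EA] := expect_horner (fun i => q (A i)).
  rewrite RintegralZl// EA mulr_sumr; apply: eq_bigr => a _.
  by rewrite mulrCA.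
rewrite exchange_big/=.
transitivity (\sum_(a : S2) (sgn2 a *: \prod_i Mgen (a.1 i) (a.2 i))`_l).
  apply: eq_bigr => a _; rewrite coefZ -mulr_sumr; congr (_ * _).
  transitivity ((\prod_i \poly_(b < T.+1)
    (pint (mus (J (a.2 i)).1) (f ^+ b * (p (a.1 i) * 'X^((J (a.2 i)).2))) / b`!%:R))`_l).
    rewrite (coef_prod_poly (fun i b =>
     pint (mus (J (a.2 i)).1) (f ^+ b * (p (a.1 i) * 'X^((J (a.2 i)).2))) / b`!%:R)).
    apply: eq_bigr => A _; congr (_ * _); apply: eq_bigr => i _.
    by rewrite /q -scalerAl (pintZ (mom _)) mulrC.
  by congr (fun q : {poly R} => q`_l); apply: eq_bigr => i _; rewrite mxE.
rewrite -coef_sum -mulrA mulr_natl -coefMn -mulr_natl -sum_perm_det.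
rewrite -coefZ scaler_sumr; congr (fun q : {poly R} => q`_l); apply: eq_bigr => a _.
rewrite -scalerA; congr (_ *: _).
rewrite -mul_polyC; congr (_ * _).
by rewrite !rmorphM/= !rmorphXn/= polyCN polyC1.
Qed.

Lemma fpoly_corner0 : (\det (fpoly T.+1 moment_corner))`_0 = 1.
Proof.
rewrite -horner_coef0 -[_.[0]]/(horner_eval 0 _) -det_map_mx.
have -> : map_mx (horner_eval 0) (fpoly T.+1 moment_corner) = 1%:M; last exact: det1.
apply/matrixP => i j; rewrite !mxE /horner_eval horner_coef0 coef_poly/=.
rewrite moment_cornerE// fact0 invr1 !mul1r (crd_e size_p monic_p).
by rewrite eq_sym.
Qed.

(** The determinant of the Gram matrix is the normalizing constant: compare the
    coefficients of order 0. *)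
Theorem moment_corner_det l : (l <= T)%N ->
  P.-integrable setT (EFin \o (fun o => S o ^+ l)) /\
  Rintegral P setT (fun o => S o ^+ l) / l`!%:R = (\det (fpoly T.+1 moment_corner))`_l.
Proof.
have SE b o : (b <= T)%N ->
    (\prod_(i < n) texp T f.[tnth (X o) i])`_b = S o ^+ b / b`!%:R.
  by move=> bT; rewrite prod_texp.
have detE b : (\det Mgen)`_b = (\det (fpoly T.+1 moment_corner))`_b * \det G0.
  by rewrite Mgen_factor det_mulmx det_map_mx coefMC.
have norm : Z^-1 * (n`!)%:R * \det G0 = 1.
  have [_] := expect_coef 0; rewrite detE fpoly_corner0 mul1r => <-.
  transitivity (Rintegral P setT (fun=> 1)); last first.
    rewrite (Rintegral_cst P _ 1)// mul1r.
    exact: (congr1 fine (probability_setT P)).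
  by apply: eq_Rintegral => o _; rewrite SE// expr0 fact0 divr1.
move=> lT; have [iE EE] := expect_coef l.
have f0 : (l`!%:R : R) != 0 by rewrite pnatr_eq0 -lt0n fact_gt0.
have iS : P.-integrable setT (EFin \o (fun o => S o ^+ l)).
  apply: (eq_integrable measurableT (EFin \o (fun o => l`!%:R *
     (\prod_(i < n) texp T f.[tnth (X o) i])`_l))).
    by move=> o _ /=; rewrite SE// mulrC divfK.
  exact: integrable_Rscale.
split=> //.
have -> : (\det (fpoly T.+1 moment_corner))`_l = Z^-1 * (n`!)%:R * (\det Mgen)`_l.
  by rewrite detE mulrA mulrAC norm mul1r.
rewrite -EE.
rewrite -RintegralZr//; apply: eq_Rintegral => o _.
by rewrite SE.
Qed.

End Law.
End Ensemble.

(** * Polynomial approximation *)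

Section Bernstein.
Variable R : realType.
Implicit Types (F : nat -> R) (n : nat).

(** De Casteljau's recursion, whose form makes positivity and induction direct. *)
Fixpoint bernstein n F : {poly R} :=
  if n is n'.+1 then
    (1 - 'X) * bernstein n' F + 'X * bernstein n' (fun k => F k.+1)
  else (F 0%N)%:P.

Lemma bernsteinS n F x : (bernstein n.+1 F).[x] =
  (1 - x) * (bernstein n F).[x] + x * (bernstein n (fun k => F k.+1)).[x].
Proof. by rewrite /= !(hornerD, hornerM, hornerN, hornerX, hornerC). Qed.

Lemma bernstein_lin n a F G x : (bernstein n (fun k => a * F k + G k)).[x] =
  a * (bernstein n F).[x] + (bernstein n G).[x].
Proof.
elim: n F G => [|n IH] F G; first by rewrite /= !hornerC.
by rewrite !bernsteinS IH (IH (fun k => F k.+1) (fun k => G k.+1)); ring.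
Qed.

Lemma bernstein_le n F G x : 0 <= x <= 1 -> (forall k, (k <= n)%N -> F k <= G k) ->
  (bernstein n F).[x] <= (bernstein n G).[x].
Proof.
move=> /andP[x0 x1]; elim: n F G => [|n IH] F G FG; first by rewrite /= !hornerC FG.
rewrite !bernsteinS lerD// ler_wpM2l ?subr_ge0//; apply: IH => k kn.
  by apply: FG; exact: leqW.
exact: FG.
Qed.

Lemma bernstein_cst n c x : (bernstein n (fun=> c)).[x] = c.
Proof. by elim: n => [|n IH]; rewrite ?bernsteinS ?IH /= ?hornerC//; ring. Qed.

Lemma bernstein_sqr n a x :
  (bernstein n (fun k => (k%:R - a) ^+ 2)).[x] =
  (n%:R * x - a) ^+ 2 + n%:R * (x * (1 - x)).
Proof.
elim: n a => [|n IH] a; first by rewrite /= hornerC; ring.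
have -> : (bernstein n.+1 (fun k => (k%:R - a) ^+ 2)).[x] =
   (1 - x) * (bernstein n (fun k => (k%:R - a) ^+ 2)).[x] +
   x * (bernstein n (fun k => (k%:R - (a - 1)) ^+ 2)).[x].
  rewrite bernsteinS; congr (_ + x * (bernstein n _).[x]).
  by apply/funext => k; rewrite -natr1; congr (_ ^+ 2); ring.
by rewrite !IH -natr1; ring.
Qed.

(** Heine's theorem; only one of the two points is required to lie in [0, 1]. *)
Lemma uniform_continuity (G : R -> R) : continuous G -> forall eps, 0 < eps ->
  exists2 del, 0 < del &
    forall x y, 0 <= x <= 1 -> `|x - y| < del -> `|G x - G y| <= eps.
Proof.
move=> cG eps e0.
have cK : compact `[(0:R), 1]%classic by exact: segment_compact.
pose Pd (del x : R) := forall y, `|x - y| < del -> `|G x - G y| <= eps.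
have /compact_near_coveringP/(_ R (0^'+) Pd) := cK.
have loc x : `[(0:R), 1]%classic x -> \forall x' \near x & i \near (0:R)^'+, Pd i x'.
  move=> _; have e2 : 0 < eps / 2 by rewrite divr_gt0.
  have /cvgrPdist_le/(_ _ e2) := cG x.
  rewrite /= -filter_from_ballE => -[r /= r0 hr].
  have r2 : 0 < r / 2 by rewrite divr_gt0.
  exists (ball x (r / 2), [set d | d < r / 2]) => /=.
    by split; [exact: nbhsx_ballx|exact: nbhs_right_lt].
  move=> [x' d] [/= xx' dr] y x'y.
  have hx' : `|G x - G x'| <= eps / 2.
    by apply: hr; rewrite /ball/=; apply: lt_trans xx' _; rewrite ltr_pdivrMr// ltr_pMr// ltr1n.
  have hy : `|G x - G y| <= eps / 2.
    apply: hr; rewrite /ball/=.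
    have -> : x - y = (x - x') + (x' - y) by ring.
    apply: le_lt_trans (ler_normD _ _) _; rewrite [r]splitr ltrD//.
    exact: lt_trans x'y dr.
  have -> : G x' - G y = (G x - G y) - (G x - G x') by ring.
  by rewrite (le_trans (ler_normB _ _))// [eps]splitr lerD.
move=> /(_ _ loc) H.
near (0:R)^'+ => del.
have Hd : `[(0:R), 1]%classic `<=` Pd del by near: del; exact: H.
by exists del => // x y x01; apply: Hd; rewrite /= in_itv.
Unshelve. all: by end_near. Qed.


(** Chebyshev's inequality for the binomial law, in the form of a quadratic
    majorant whose Bernstein polynomial is explicit. *)
Lemma bernstein_upper (G : R -> R) n x y B eps del : (0 < n)%N ->
  0 <= x <= 1 -> 0 < del -> 0 <= B ->
  (forall z, `|x - z| < del -> G z <= y + eps) ->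
  (forall z, 0 <= z <= 1 -> G z <= y + B) ->
  0 <= eps ->
  (bernstein n (fun k => G (k%:R / n%:R))).[x] <= y + eps + B / (del ^+ 2 * n%:R).
Proof.
move=> n0 x01 del0 B0 near_ far eps0.
have nR : (0 : R) < n%:R by rewrite ltr0n.
have n_neq0 : (n%:R : R) != 0 by rewrite gt_eqF.
have d_neq0 : del != 0 by rewrite gt_eqF.
pose C := B / (del ^+ 2 * n%:R ^+ 2).
apply: (@le_trans _ _ (bernstein n (fun k => C * (k%:R - n%:R * x) ^+ 2 + (y + eps))).[x]).
  apply: bernstein_le => // k kn.
  have [h|h] := ltP `|x - k%:R / n%:R| del.
    rewrite (le_trans (near_ _ h))// lerDr mulr_ge0 ?sqr_ge0//.
    by rewrite divr_ge0// mulr_ge0 ?exprn_ge0// ltW.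
  have z01 : 0 <= (k%:R / n%:R : R) <= 1.
    by rewrite divr_ge0//= ler_pdivrMr// mul1r ler_nat.
  apply: (le_trans (far _ z01)).
  have -> : C * (k%:R - n%:R * x) ^+ 2 = B * ((x - k%:R / n%:R) ^+ 2 / del ^+ 2).
    by rewrite /C; field; rewrite n_neq0 d_neq0.
  suff : B <= B * ((x - k%:R / n%:R) ^+ 2 / del ^+ 2).
    by set u := B * _ => Bu; lra.
  rewrite -[leLHS]mulr1 ler_wpM2l// ler_pdivlMr ?exprn_gt0// mul1r.
  by rewrite -[leRHS]real_normK ?num_real// lerXn2r// nnegrE ltW.
rewrite bernstein_lin bernstein_cst bernstein_sqr subrr expr0n/= add0r addrC lerD2l.
have -> : C * (n%:R * (x * (1 - x))) = B / (del ^+ 2 * n%:R) * (x * (1 - x)).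
  by rewrite /C; field; rewrite n_neq0 d_neq0.
rewrite -[leRHS]mulr1 ler_wpM2l//.
  by rewrite divr_ge0// mulr_ge0 ?exprn_ge0// ltW.
by case/andP: x01 => x0 x1; nra.
Qed.

Lemma bernsteinN n F x : (bernstein n (fun k => - F k)).[x] = - (bernstein n F).[x].
Proof.
have := bernstein_lin n (-1) F (fun=> 0) x; rewrite bernstein_cst addr0 mulN1r => <-.
by congr (bernstein n _).[x]; apply/funext => k; rewrite mulN1r addr0.
Qed.

(** Bernstein polynomials of G and of - G, bounded above by [bernstein_upper]. *)
Lemma weierstrass (G : R -> R) B : continuous G -> (forall x, `|G x| <= B) ->
  forall eps, 0 < eps ->
  exists p : {poly R}, forall x, 0 <= x <= 1 -> `|G x - p.[x]| <= eps.
Proof.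
move=> cG GB eps e0; have e2 : 0 < eps / 2 by rewrite divr_gt0.
have B0 : 0 <= B by rewrite (le_trans _ (GB 0)).
have [del del0 hdel] := uniform_continuity cG e2.
pose n := (Num.bound ((eps / 2 * del ^+ 2)^-1 * (B + B))).+1.
have hn : (B + B) / (del ^+ 2 * n%:R) <= eps / 2.
  rewrite ler_pdivrMr ?mulr_gt0 ?exprn_gt0 ?ltr0n//.
  rewrite mulrA -ler_pdivrMl ?mulr_gt0 ?exprn_gt0//.
  apply: le_trans (ltW (archi_boundP _)) _; last by rewrite ler_nat leqnSn.
  by rewrite mulr_ge0 ?addr_ge0// invr_ge0 mulr_ge0 ?exprn_ge0// ltW.
(* n is such that the quadratic term is below eps / 2 *)
exists (bernstein n (fun k => G (k%:R / n%:R))) => x x01.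
have GB1 z : G z <= B by rewrite (le_trans (ler_norm _)).
have GB2 z : - B <= G z by rewrite lerNl (le_trans (ler_norm _))// normrN.
rewrite ler_distlC; apply/andP; split.
  have := @bernstein_upper (fun z => - G z) n x (- G x) (B + B) (eps / 2) del isT x01 del0.
  rewrite (bernsteinN n (fun k => G (k%:R / n%:R))) => H.
  have {}H : - (bernstein n (fun k => G (k%:R / n%:R))).[x] <=
     - G x + eps / 2 + (B + B) / (del ^+ 2 * n%:R).
    apply: H; rewrite ?addr_ge0 ?(ltW e2)// => z hz.
      have := hdel x z x01 hz; rewrite ler_distlC => /andP[h _]; lra.
    have := GB1 x; have := GB2 z; lra.
  by move: H hn; move: (bernstein _ _).[x] ((B + B) / _) => b c; lra.
have H : (bernstein n (fun k => G (k%:R / n%:R))).[x] <=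
     G x + eps / 2 + (B + B) / (del ^+ 2 * n%:R).
  apply: bernstein_upper; rewrite ?addr_ge0 ?(ltW e2)// => z hz.
    have := hdel x z x01 hz; rewrite ler_distlC => /andP[_ h]; lra.
  have := GB1 z; have := GB2 x; lra.
by move: H hn; move: (bernstein _ _).[x] ((B + B) / _) => b c; lra.
Qed.

End Bernstein.

Section Taylor.
Variable R : realType.

(** The primitive vanishing at 0. *)
Definition antideriv (q : {poly R}) : {poly R} :=
  \poly_(i < (size q).+1) (if i is j.+1 then q`_j / j.+1%:R else 0).

Lemma deriv_antideriv q : (antideriv q)^`() = q.
Proof.
apply/polyP => i; rewrite coef_deriv coef_poly ltnS; case: ltnP => iq.
  by rewrite /= -[LHS]mulr_natr divfK// pnatr_eq0.
by rewrite mul0rn nth_default.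
Qed.

Lemma antideriv0 q : (antideriv q).[0] = 0.
Proof. by rewrite horner_coef0 coef_poly. Qed.

Lemma integrated_bound n (g dg : R -> R) : g 0 = 0 ->
  (forall x, is_derive x (1 : R) g (dg x)) ->
  (forall x, `|dg x| <= `|x| ^+ n / n`!%:R) ->
  forall x, `|g x| <= `|x| ^+ n.+1 / n.+1`!%:R.
Proof.
have upper (h dh : R -> R) : h 0 = 0 -> (forall x, is_derive x (1 : R) h (dh x)) ->
   (forall x, 0 <= x -> dh x <= x ^+ n / n`!%:R) ->
   forall x, 0 <= x -> h x <= x ^+ n.+1 / n.+1`!%:R.
  move=> h0 hd hb x x0.
  pose P : {poly R} := (n.+1`!%:R)^-1 *: 'X^(n.+1).
  pose k y := P.[y] - h y.
  have kd y : is_derive y (1 : R) k (y ^+ n / n`!%:R - dh y).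
    have -> : y ^+ n / n`!%:R - dh y = P^`().[y] - dh y.
      rewrite /P derivZ derivXn hornerZ hornerMn hornerXn/=; congr (_ - _).
      have f0 : (n`!%:R : R) != 0 by rewrite pnatr_eq0 -lt0n fact_gt0.
      have n0 : (n.+1%:R : R) != 0 by rewrite pnatr_eq0.
      rewrite factS natrM -[y ^+ n *+ n.+1]mulr_natr; move: f0 n0.
      move: (n`!%:R : R) (n.+1%:R : R) => A C A0 C0.
      by field; rewrite A0 C0.
    exact: is_deriveB.
  have : k 0 <= k x.
    apply: (@ger0_derive1_ndecr _ k 0 x); rewrite ?lexx//.
      move=> y; rewrite in_itv/= => /andP[y0 _].
      by rewrite derive1E; have [_ ->] := kd y; rewrite subr_ge0 hb// ltW.
    apply: continuous_subspaceT => y; apply: differentiable_continuous.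
    by apply/derivable1_diffP; have [] := kd y.
  rewrite /k h0 /P !hornerZ !hornerXn expr0n/= mulr0 subrr subr_ge0.
  by rewrite mulrC.
have both (h dh : R -> R) : h 0 = 0 -> (forall x, is_derive x (1 : R) h (dh x)) ->
   (forall x, 0 <= x -> `|dh x| <= x ^+ n / n`!%:R) ->
   forall x, 0 <= x -> `|h x| <= x ^+ n.+1 / n.+1`!%:R.
  move=> h0 hd hb x x0; rewrite ler_norml; apply/andP; split; last first.
    by apply: (upper h dh) => // y y0; apply: le_trans (hb _ y0); exact: ler_norm.
  rewrite lerNl; apply: (upper (fun y => - h y) (fun y => - dh y)) => //.
  - by rewrite h0 oppr0.
  - by move=> y y0; apply: le_trans (hb _ y0); rewrite -normrN; exact: ler_norm.
move=> g0 gd gb x; have [x0|x0] := leP 0 x.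
  rewrite [in leRHS]ger0_norm//; apply: (both g dg) => // y y0.
  by rewrite -[X in X ^+ _]ger0_norm.
have nx0 : 0 <= - x by rewrite oppr_ge0 ltW.
rewrite [in leRHS]ltr0_norm//.
have -> : g x = (g \o -%R) (- x) by rewrite /= opprK.
apply: (both (g \o -%R) (fun y => - dg (- y))) => //.
- by rewrite /= oppr0.
- move=> y; have := @is_derive1_comp R g (-%R) y _ _ (gd (- y)) (is_deriveNid y 1).
  by rewrite mulrN1.
- by move=> y y0; rewrite normrN; apply: le_trans (gb _) _; rewrite normrN ger0_norm.
Qed.

(** By induction on n: the derivative of cos (x + phi) is cos (x + (phi + pi / 2)),
    and integrating the previous approximation gains one power of x. *)
Lemma cos_taylor n (phi : R) : exists q : {poly R},
  forall x, `|cos (x + phi) - q.[x]| <= `|x| ^+ n / n`!%:R.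
Proof.
elim: n phi => [|n IH] phi.
  exists 0 => x; rewrite horner0 subr0 expr0 fact0 divr1 ler_norml.
  by rewrite cos_geN1 cos_le1.
have [q hq] := IH (phi + pi / 2).
exists (antideriv q + (cos phi)%:P).
apply: (@integrated_bound n _ (fun x => cos (x + (phi + pi / 2)) - q.[x])) => //.
  by rewrite hornerD antideriv0 hornerC !add0r subrr.
move=> x; rewrite addrA cosDpihalf.
apply: is_deriveB.
  rewrite -[- sin _]mulr1; apply: (@is_derive1_comp R (@cos R) (fun y => y + phi)).
  rewrite -[1 in X in is_derive _ _ _ X]addr0; apply: is_deriveD.
have -> : q.[x] = (antideriv q + (cos phi)%:P)^`().[x].
  by rewrite derivD derivC addr0 deriv_antideriv.
exact: is_derive_poly.
Qed.

End Taylor.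

(** * The method of moments *)

Section OneLaw.
Context d (Om : measurableType d) (R : realType) (mu : {measure set Om -> \bar R}).
Hypothesis mu1 : mu setT = 1%E.
Variable Y : Om -> R.
Hypothesis mY : measurable_fun setT Y.
Hypothesis iY : forall l : nat, mu.-integrable setT (EFin \o (fun o => Y o ^+ l)).

Lemma integrable_polyY (q : {poly R}) :
  mu.-integrable setT (EFin \o (fun o => q.[Y o])).
Proof.
apply: (eq_integrable measurableT (fun o => (\sum_(i < size q) q`_i * Y o ^+ i)%:E)).
  by move=> o _ /=; rewrite horner_coef.
apply: (@integrable_Rsum _ _ _ mu _ _ _ (fun (i : 'I_(size q)) o => q`_i * Y o ^+ i)) => i.
by apply: (@integrable_Rscale _ _ _ mu q`_i (fun o => Y o ^+ i)); exact: iY.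
Qed.

Lemma Rintegral_polyY (q : {poly R}) : Rintegral mu setT (fun o => q.[Y o]) =
  \sum_(i < size q) q`_i * Rintegral mu setT (fun o => Y o ^+ i).
Proof.
transitivity (Rintegral mu setT (fun o => \sum_(i < size q) q`_i * Y o ^+ i)).
  by apply: eq_Rintegral => o _; rewrite horner_coef.
rewrite (@Rintegral_sum _ _ _ mu _ _ _ (fun (i : 'I_(size q)) o => q`_i * Y o ^+ i)).
  by apply: eq_bigr => i _; rewrite RintegralZl//; exact: iY.
by move=> i; apply: (@integrable_Rscale _ _ _ mu q`_i (fun o => Y o ^+ i)); exact: iY.
Qed.

(** A polynomial error is integrated exactly into a moment. *)
Lemma Rintegral_approx (h u : R -> R) eps c j :
  mu.-integrable setT (EFin \o (fun o => h (Y o))) ->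
  mu.-integrable setT (EFin \o (fun o => u (Y o))) ->
  (forall x, `|h x - u x| <= eps + c * x ^+ j) ->
  `|Rintegral mu setT (fun o => h (Y o)) - Rintegral mu setT (fun o => u (Y o))| <=
   eps + c * Rintegral mu setT (fun o => Y o ^+ j).
Proof.
move=> ih iu hu; rewrite -RintegralB//.
have ihu : mu.-integrable setT (EFin \o (fun o => h (Y o) - u (Y o))).
  apply: (eq_integrable measurableT (fun o => (h (Y o))%:E - (u (Y o))%:E)%E).
    by move=> o _ /=; rewrite EFinB.
  exact: (integrableB measurableT ih iu).
apply: (le_trans (le_normr_Rintegral _ ihu)) => //.
have ic : mu.-integrable setT (EFin \o (fun o => c * Y o ^+ j)).
  exact: (@integrable_Rscale _ _ _ mu c (fun o => Y o ^+ j) (iY j)).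
have ie : mu.-integrable setT (EFin \o (fun _ : Om => eps)).
  have := integrable_polyY eps%:P; apply: eq_integrable => // o _ /=.
  by rewrite hornerC.
have -> : eps + c * Rintegral mu setT (fun o => Y o ^+ j) =
    Rintegral mu setT (fun o => eps + c * Y o ^+ j).
  rewrite RintegralD// RintegralZl//.
  by rewrite (Rintegral_cst mu _ eps)// mu1/= mulr1.
apply: le_Rintegral => //.
- by apply: (integrable_norm ihu).
- apply: (eq_integrable measurableT (fun o => eps%:E + (c * Y o ^+ j)%:E)%E).
    by move=> o _ /=; rewrite EFinD.
  exact: (integrableD measurableT ie ic).
Qed.

End OneLaw.

Section MethodOfMoments.
Variable R : realType.
Context (d : nat -> measure_display) (Om : forall n, measurableType (d n)).
Variables (P : forall n, {measure set (Om n) -> \bar R}) (Y : forall n, Om n -> R).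
Variable (Q : {measure set (measurableTypeR R) -> \bar R}).
Hypothesis P1 : forall n, P n setT = 1%E.
Hypothesis Q1 : Q setT = 1%E.
Hypothesis mY : forall n, measurable_fun setT (@Y n).
Hypothesis iY : forall n (l : nat), (P n).-integrable setT (EFin \o (fun o => Y o ^+ l)).
Hypothesis iQ : forall (l : nat), Q.-integrable setT
  (EFin \o (fun x : measurableTypeR R => x ^+ l)).
Let M n l := Rintegral (P n) setT (fun o => @Y n o ^+ l).
Let g l := Rintegral Q setT (fun x : measurableTypeR R => x ^+ l).
Hypothesis M_cvg : forall l, vanishes (fun n => M n l - g l).
(* The moments of the limit grow slowly enough to determine it. *)
Hypothesis g_growth : forall a eps : R, 0 < eps ->
  exists j, `|a| ^+ j.*2 / j.*2`!%:R * g j.*2 <= eps.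

(** The class of test functions for which convergence in law is verified. *)
Definition tested (u : R -> R) := [/\ measurable_fun setT (u : measurableTypeR R -> R),
  forall n, (P n).-integrable setT (EFin \o (fun o => u (@Y n o))),
  Q.-integrable setT (EFin \o (fun x : measurableTypeR R => u x)) &
  vanishes (fun n => Rintegral (P n) setT (fun o => u (@Y n o)) -
     Rintegral Q setT (fun x : measurableTypeR R => u x))].

Lemma tested_poly (q : {poly R}) : tested (horner q).
Proof.
split.
- exact: measurable_horner.
- by move=> n; exact: (integrable_polyY (@iY n)).
- exact: (integrable_polyY iQ).
apply: (@vanishes_ext _ (fun n => \sum_(i < size q) q`_i * M n i - \sum_(i < size q) q`_i * g i)).
  exists 0%N => n _; rewrite (Rintegral_polyY (@iY n)).
  by rewrite (Rintegral_polyY iQ).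
apply: (proj1 (@asym_sum _ _ (fun (i : 'I_(size q)) n => q`_i * M n i)
  (fun (i : 'I_(size q)) n => q`_i * g i) _)) => i.
by apply: asymZ; split; [exact: M_cvg|exists `|g i|, 0%N].
Qed.

Lemma tested_lin a u v : tested u -> tested v -> tested (fun x => a * u x + v x).
Proof.
move=> [mu iu iQu vu] [mv iv iQv vv].
have add dT (T : measurableType dT) (nu : {measure set T -> \bar R}) (f1 f2 : T -> R) :
    nu.-integrable setT (EFin \o f1) -> nu.-integrable setT (EFin \o f2) ->
    nu.-integrable setT (EFin \o (fun o => a * f1 o + f2 o)) /\
    Rintegral nu setT (fun o => a * f1 o + f2 o) =
    a * Rintegral nu setT f1 + Rintegral nu setT f2.
  move=> i1 i2; have ia : nu.-integrable setT (EFin \o (fun o => a * f1 o)).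
    exact: (@integrable_Rscale _ _ _ nu a f1).
  split.
    apply: (eq_integrable measurableT (fun o => (a * f1 o)%:E + (f2 o)%:E)%E) => //.
    exact: (integrableD measurableT ia i2).
  by rewrite RintegralD// RintegralZl.
split.
- by apply: measurable_funD => //; exact: measurable_funM.
- by move=> n; have [] := add _ _ _ _ _ (iu n) (iv n).
- by have [] := add _ _ _ _ _ iQu iQv.
have [_ E2] := add _ _ _ _ _ iQu iQv.
have [C hC] : ev_bounded (fun _ : nat => a) by exists `|a|, 0%N.
have va := vanishesM vu (ex_intro _ C hC : ev_bounded (fun=> a)).
apply: vanishes_ext (vanishesD va vv); exists 0%N => n _.
have [_ ->] := add _ _ _ _ _ (iu n) (iv n); rewrite E2.
set x := Rintegral _ _ _; set y := Rintegral _ _ _; set z := Rintegral _ _ _.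
by set t := Rintegral _ _ _; ring.
Qed.

Lemma tested_sum (I : Type) (r : seq I) (c : I -> R) (u : I -> R -> R) :
  (forall i, tested (u i)) -> tested (fun x => \sum_(i <- r) c i * u i x).
Proof.
move=> hu; elim: r => [|i r IH].
  have := tested_poly 0; rewrite (_ : horner 0 = fun x => \sum_(i <- [::]) c i * u i x)//.
  by apply/funext => x; rewrite big_nil horner0.
have := tested_lin (c i) (hu i) IH; congr tested.
by apply/funext => x; rewrite big_cons.
Qed.

(** The error c x^j is controlled in the limit by the moment g j, and for large n
    by the convergence of moments. *)
Lemma tested_close (h : R -> R) : measurable_fun setT (h : measurableTypeR R -> R) ->
  (forall eps, 0 < eps -> exists u, tested u /\ exists c j,
    [/\ 0 <= c, c * g j <= eps & forall x, `|h x - u x| <= eps + c * x ^+ j]) ->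
  tested h.
Proof.
move=> mh hh.
have int dT (T : measurableType dT) (nu : {measure set T -> \bar R}) (X : T -> R) :
   nu setT = 1%E -> measurable_fun setT X ->
   (forall l : nat, nu.-integrable setT (EFin \o (fun o => X o ^+ l))) ->
   (forall u, tested u -> nu.-integrable setT (EFin \o (fun o => u (X o)))) ->
   nu.-integrable setT (EFin \o (fun o => h (X o))).
  move=> nu1 mX iX iu; have [u [tu [c [j [c0 _ hu]]]]] := hh 1 ltr01.
  have := iu u tu; set v := EFin \o _ => iv.
  have iw := integrable_polyY iX (1%:P + c *: 'X^j).
  apply: (@le_integrable _ _ _ nu _ measurableT _
     (fun o => `|(u (X o))%:E| + ((1%:P + c *: 'X^j).[X o])%:E)%E).
  - by apply/measurable_EFinP; exact: (measurableT_comp mh mX).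
  - move=> o _; rewrite hornerD hornerC hornerZ hornerXn.
    rewrite lee_fin; apply: le_trans (ler_norm _).
    have -> : h (X o) = u (X o) + (h (X o) - u (X o)) by ring.
    by rewrite (le_trans (ler_normD _ _))// lerD2l.
  - by apply: integrableD => //; exact: integrable_abse.
split=> //.
- by move=> n; apply: int => // u [_ + _ _]; apply.
- by apply: int => // u [_ _ + _].
move=> e e0; have e6 : 0 < e / 6%:R by rewrite divr_gt0.
have [u [[mu iu iQu vu] [c [j [c0 cg hu]]]]] := hh _ e6.
have ih n : (P n).-integrable setT (EFin \o (fun o => h (@Y n o))).
  by apply: int => // u' [_ + _ _]; apply.
have iQh : Q.-integrable setT (EFin \o (fun x : measurableTypeR R => h x)).
  by apply: int => // u' [_ _ + _].
have c1 : 0 < c + 1 by rewrite ltr_wpDl.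
have [n0 hn0] := vu _ e6.
have [n1 hn1] := M_cvg j (divr_gt0 e6 c1).
exists (maxn n0 n1) => n; rewrite geq_max => /andP[/hn0 hA /hn1 hB].
have B1 := Rintegral_approx (P1 n) (@iY n) (ih n) (iu n) hu.
have B2 := Rintegral_approx Q1 iQ iQh iQu hu.
have hcM : c * M n j <= e / 6%:R + e / 6%:R.
  have -> : M n j = g j + (M n j - g j) by ring.
  rewrite mulrDr lerD//; apply: (@le_trans _ _ (c * (e / 6%:R / (c + 1)))).
    by rewrite ler_wpM2l// (le_trans (ler_norm _)).
  rewrite mulrA ler_pdivrMr// mulrC; apply: ler_wpM2l; first exact: ltW.
  by rewrite lerDl.
move: B1 B2 hA hcM cg; rewrite -/(M n j) -/(g j).
move: (Rintegral (P n) _ (fun o => h _)) (Rintegral (P n) _ (fun o => u _))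
  (Rintegral Q _ (fun o => h _)) (Rintegral Q _ (fun o => u _)) => a1 a2 a3 a4.
rewrite !ler_norml => /andP[? ?] /andP[? ?] /andP[? ?] ? ?.
by apply/andP; split; lra.
Qed.

(** Taylor polynomials of large degree: their error is a moment divided by a
    factorial, small by the growth condition. *)
Lemma tested_cos a b : tested (fun x => cos (a * x + b)).
Proof.
apply: tested_close.
  apply: (@measurableT_comp _ _ _ _ _ _ (@cos R : measurableTypeR R -> measurableTypeR R)).
    by apply: continuous_measurable_fun; exact: continuous_cos.
  by apply: measurable_funD => //; apply: measurable_funM.
move=> eps e0; have [j hj] := g_growth a e0.
have [q hq] := cos_taylor j.*2 b.
exists (horner (q \Po (a *: 'X))); split; first exact: tested_poly.
exists (`|a| ^+ j.*2 / j.*2`!%:R), j.*2; split=> //.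
move=> x; rewrite horner_comp hornerZ hornerX; apply: (le_trans (hq _)).
rewrite normrM exprMn mulrAC -(normrX _ x) (ger0_norm (exprn_even_ge0 _ _)) ?odd_double//.
by rewrite lerDr ltW.
Qed.

(** Product-to-sum formulas reduce the power of the sine by one. *)
Lemma tested_sin_cos t k a b : tested (fun x => sin (t * x) ^+ k * cos (a * x + b)).
Proof.
elim: k a b => [|k IH] a b.
  by have := tested_cos a b; congr tested; apply/funext => x; rewrite expr0 mul1r.
have := tested_lin (1/2) (IH (a + t) (b - pi / 2))
   (tested_lin (1/2) (IH (t - a) (- b - pi / 2)) (tested_poly 0)).
congr tested; apply/funext => x; rewrite horner0 addr0.
have -> : (a + t) * x + (b - pi / 2) = (t * x + (a * x + b)) - pi / 2 by ring.
have -> : (t - a) * x + (- b - pi / 2) = (t * x - (a * x + b)) - pi / 2 by ring.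
rewrite !cosBpihalf sinD sinB exprSr.
set S := sin (t * x); set s := sin (a * x + b); set C := cos _; set c := cos _.
by field.
Qed.

Lemma tested_poly_sin (p : {poly R}) t : tested (fun x => p.[sin (t * x)]).
Proof.
have := @tested_sum _ (index_enum 'I_(size p)) (fun i => p`_i)
  (fun i x => sin (t * x) ^+ i * cos (0 * x + 0)) (fun i => tested_sin_cos t i 0 0).
congr tested; apply/funext => x; rewrite horner_coef; apply: eq_bigr => i _.
by rewrite mul0r add0r cos0 mulr1.
Qed.

(** On [- M, M] a continuous function is a continuous function of sin (x / (2 M)),
    hence close to a polynomial in it; the second moment controls the rest. *)
Lemma tested_bounded_continuous (h : R -> R) B : continuous h ->
  (forall x, `|h x| <= B) -> tested h.
Proof.
move=> ch hB; apply: tested_close; first exact: continuous_measurable_fun.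
move=> eps e0; have B0 : 0 <= B by rewrite (le_trans _ (hB 0)).
have g20 : 0 <= g 2.
  by apply: Rintegral_ge0 => x _; rewrite sqr_ge0.
pose K := B + B + eps.
have K0 : 0 < K by rewrite ltr_wpDl// addr_ge0.
pose M2 := K * g 2 / eps + 1.
have M20 : 0 < M2 by rewrite ltr_wpDl// divr_ge0 ?mulr_ge0// ltW.
pose M0 := Num.sqrt M2; have M00 : 0 < M0 by rewrite sqrtr_gt0.
(* |x| <= M0 amounts to |t x| <= 1 / 2, where the sine is injective *)
pose t := (M0 *+ 2)^-1.
have t0 : 0 < t by rewrite invr_gt0 mulr2n addr_gt0.
pose half : R := 1 / 2.
have ph1 : 1 <= pi / 2 :> R by exact: pihalf_ge1.
pose c : R := sin half.
have c_lt1 : c < 1.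
  rewrite -sin_pihalf /c ltr_sin ?in_itv/= /half; first lra.
    by apply/andP; split; lra.
  by apply/andP; split; lra.
have c_gt0 : 0 < c.
  rewrite -sin0 /c ltr_sin ?in_itv/= /half; first lra.
    by apply/andP; split; lra.
  by apply/andP; split; lra.
(* s will be (sin (t x) + 1) / 2; clipping 2 s - 1 = sin (t x) to [- c, c] keeps
   it inside the domain where asin is continuous *)
pose clip (s : R) := Num.max (- c) (Num.min c (2 * s - 1)).
have clip_bd s : -1 < clip s < 1.
  rewrite /clip /Num.max /Num.min; case: ifP; case: ifP; lra.
pose G (s : R) := h (asin (clip s) / t).
have cG : continuous G.
  move=> s; apply: (@continuous_comp _ _ _ (fun s => asin (clip s) / t) h); last exact: ch.
  apply: cvgM; last exact: cvg_cst.
  apply: (@continuous_comp _ _ _ clip (@asin R)); last exact: continuous_asin.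
  rewrite /clip; apply: continuous_max; first exact: cvg_cst.
  apply: continuous_min; first exact: cvg_cst.
  by apply: cvgB; [apply: cvgM; [exact: cvg_cst|exact: cvg_id]|exact: cvg_cst].
have [p hp] := weierstrass cG (fun s => hB _) e0.
pose q := p \Po ((1 / 2) *: ('X + 1)).
exists (fun x => q.[sin (t * x)]); split; first exact: tested_poly_sin.
exists (K / M2), 2%N; split.
- by rewrite divr_ge0// ltW.
- rewrite mulrAC ler_pdivrMr// /M2 mulrDr mulr1 mulrCA divff ?gt_eqF// mulr1.
  by rewrite lerDl ltW.
move=> x; pose s := 1 / 2 * (sin (t * x) + 1).
have -> : q.[sin (t * x)] = p.[s].
  by rewrite /q horner_comp hornerZ hornerD hornerX hornerC.
have s01 : 0 <= s <= 1.
  by rewrite /s; have := sin_geN1 (t * x); have := sin_le1 (t * x) => ? ?; apply/andP; split; lra.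
have hps := hp s s01.
have [xM|Mx] := leP `|x| M0.
  have -> : h x = G s.
    rewrite /G; have tx : `|t * x| <= half.
      rewrite normrM gtr0_norm// /t mulrC ler_pdivrMr ?mulr2n ?addr_gt0//.
      by rewrite /half; lra.
    move: tx; rewrite ler_norml => /andP[tx1 tx2].
    have xi : t * x \in `[(- (pi/2)), pi/2].
      by rewrite in_itv/= /half in tx1 tx2 *; apply/andP; split; lra.
    have hi : half \in `[(- (pi/2) : R), pi/2].
      by rewrite in_itv/= /half; apply/andP; split; lra.
    have nhi : - half \in `[(- (pi/2) : R), pi/2].
      by rewrite in_itv/= /half; apply/andP; split; lra.
    have sx1 : sin (t * x) <= c by rewrite /c leNgt ltr_sin// -leNgt.
    have sx2 : - c <= sin (t * x) by rewrite /c -sinN leNgt ltr_sin// -leNgt.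
    have -> : clip s = sin (t * x).
      have -> : clip s = Num.max (- c) (Num.min c (sin (t * x))).
        by congr (Num.max _ (Num.min _ _)); rewrite /s; field.
      by rewrite min_r// max_r.
    by rewrite sinK// mulrC mulKf// gt_eqF.
  by rewrite (le_trans hps)// lerDl mulr_ge0 ?sqr_ge0// divr_ge0// ltW.
have -> : h x - p.[s] = h x - G s + (G s - p.[s]) by ring.
have KM : K <= K / M2 * x ^+ 2.
  rewrite mulrAC ler_pdivlMr//; apply: ler_wpM2l; first exact: ltW.
  rewrite -(sqr_sqrtr (ltW M20)) -/M0 -(@real_normK _ x) ?num_real//.
  by apply: lerXn2r; rewrite ?nnegrE ?normr_ge0 ?(ltW M00) ?(ltW Mx).
apply: (le_trans (ler_normD _ _)).
have : `|h x - G s| <= B + B.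
  by rewrite (le_trans (ler_normB _ _))// lerD// hB.
move: KM; rewrite {1}/K; move: (K / M2 * _) => w; lra.
Qed.

End MethodOfMoments.

(** * Moments of Gaussian laws *)

Section GaussianMoments.
Variable R : realType.
Local Notation leb := (@lebesgue_measure R).
Variable s : R.
Hypothesis s0 : 0 < s.
Let s_neq0 : s != 0. Proof. by rewrite gt_eqF. Qed.
Let s2_neq0 : s *+ 2 != 0. Proof. by rewrite gt_eqF// mulr2n addr_gt0. Qed.
Local Notation phi := (normal_pdf 0 s).

(** A power against an exponential, from a single term of the exponential series. *)
Lemma expr_le_fact (y : R) l : 0 <= y -> y ^+ l * expR (- y) <= l`!%:R.
Proof.
move=> y0; rewrite expRN ler_pdivrMr ?expR_gt0//.
case: l => [|l]; first by rewrite expr0 fact0 mul1r -[leLHS]expR0 ler_expR.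
have f0 : 0 < (l.+1)`!%:R :> R by rewrite ltr0n fact_gt0.
rewrite mulrC -ler_pdivrMr//; apply: le_trans (expR_ge1Dxn l y0).
by rewrite lerDr.
Qed.

(** Part of the Gaussian decay absorbs the power, the rest is a density with twice
    the standard deviation. *)
Lemma pdf_moment_bound l : exists2 C, 0 <= C &
  forall x, `|x ^+ l * phi x| <= C * normal_pdf 0 (s *+ 2) x.
Proof.
have pe r : 0 < r -> r != 0 by move=> ?; rewrite gt_eqF.
pose r := normal_peak s / normal_peak (s *+ 2).
have k2 : 0 < normal_peak (s *+ 2) by exact: normal_peak_gt0.
have r0 : 0 <= r by rewrite divr_ge0// normal_peak_ge0.
pose c : R := 8%:R / 3%:R * s ^+ 2.
have c0 : 0 < c by rewrite mulr_gt0// exprn_gt0.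
exists (r * (1 + c ^+ l * l`!%:R)).
  by rewrite mulr_ge0// addr_ge0// mulr_ge0// exprn_ge0// ltW.
move=> x; rewrite !normal_pdfE// /normal_fun !subr0.
pose y := x ^+ 2 / c.
have y0 : 0 <= y by rewrite divr_ge0 ?sqr_ge0// ltW.
have -> : - x ^+ 2 / (s ^+ 2 *+ 2) = - y + - x ^+ 2 / ((s *+ 2) ^+ 2 *+ 2).
  by rewrite /y /c; field.
rewrite expRD; set E := expR (- x ^+ 2 / ((s *+ 2) ^+ 2 *+ 2)).
have E0 : 0 <= E by exact: expR_ge0.
have -> : x ^+ l * (normal_peak s * (expR (- y) * E)) =
   (x ^+ l * expR (- y)) * r * (normal_peak (s *+ 2) * E).
  by rewrite /r; field; exact: pe.
have -> : r * (1 + c ^+ l * l`!%:R) * (normal_peak (s *+ 2) * E) =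
   (1 + c ^+ l * l`!%:R) * r * (normal_peak (s *+ 2) * E) by ring.
have kE : 0 <= normal_peak (s *+ 2) * E by rewrite mulr_ge0// ltW.
rewrite normrM (ger0_norm kE) ler_wpM2r// normrM (ger0_norm r0) ler_wpM2r//.
rewrite normrM (ger0_norm (expR_ge0 _)) normrX.
have xl : `|x| ^+ l <= 1 + (x ^+ 2) ^+ l.
  have [x1|/ltW x1] := leP `|x| 1.
    by rewrite (le_trans (exprn_ile1 _ _ _))// lerDl exprn_ge0// sqr_ge0.
  rewrite -(@real_normK _ x) ?num_real// -exprM mul2n -addnn exprD.
  by rewrite ler_wpDl// ler_peMr ?exprn_ge0// exprn_ege1.
apply: (le_trans (ler_wpM2r (expR_ge0 _) xl)).
rewrite mulrDl lerD ?mul1r//.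
  by rewrite -[leRHS]expR0 ler_expR oppr_le0.
have -> : x ^+ 2 = c * y by rewrite /y; field; rewrite ?s_neq0 ?pe.
by rewrite exprMn -mulrA ler_wpM2l ?exprn_ge0 ?(ltW c0)// expr_le_fact.
Qed.

Lemma measurable_pdf_moment l : measurable_fun setT (fun x : measurableTypeR R => x ^+ l * phi x).
Proof. by apply: measurable_funM => //; exact: measurable_normal_pdf. Qed.

Lemma integrable_pdf_moment l :
  leb.-integrable setT (EFin \o (fun x : measurableTypeR R => x ^+ l * phi x)).
Proof.
have [C C0 hC] := pdf_moment_bound l.
have i2 := integrable_normal_pdf 0 (s *+ 2).
apply: (@le_integrable _ _ _ leb _ measurableT _
  (EFin \o (fun x => C * normal_pdf 0 (s *+ 2) x))).
- by apply/measurable_EFinP; exact: measurable_pdf_moment.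
- move=> x _; rewrite lee_fin (le_trans (hC x))// ler_norm//.
- exact: (@integrable_Rscale _ _ _ leb C (normal_pdf 0 (s *+ 2))).
Qed.

Lemma pdf_moment_bounded l : exists2 B, 0 <= B & forall x, `|x ^+ l * phi x| <= B.
Proof.
have [C C0 hC] := pdf_moment_bound l; exists (C * normal_peak (s *+ 2)).
  by rewrite mulr_ge0// normal_peak_ge0.
by move=> x; rewrite (le_trans (hC x))// ler_wpM2l// normal_pdf_ub.
Qed.

Let mom l := Rintegral leb setT (fun x : measurableTypeR R => x ^+ l * phi x).

Let is_derive_pdf (x : R) : is_derive x 1 (phi : R -> R) (- (x / s ^+ 2) * phi x).
Proof.
rewrite normal_pdfE//.
have -> : (fun x0 : R => normal_peak s * normal_fun 0 s x0) =
  (normal_peak s) \*: (expR \o (fun x => (- (s ^+ 2 *+ 2)^-1) * x ^+ 2)).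
  apply/funext => z /=; rewrite /normal_fun subr0; congr (_ * expR _).
  by rewrite mulNr mulrC mulNr.
apply: is_derive_eq; rewrite /normal_fun subr0 /GRing.scale/= /GRing.scale/=.
have -> : - (s ^+ 2 *+ 2)^-1 * x ^+ 2 = - x ^+ 2 / (s ^+ 2 *+ 2).
  by rewrite mulNr mulrC mulNr.
by field.
Qed.

(** Integration by parts: the derivative of x^l phi has integral 0, as x^l phi
    vanishes at infinity. *)
Lemma pdf_moment_by_parts l : mom l.+1 = l%:R * s ^+ 2 * mom l.-1.
Proof.
pose F x := x ^+ l * phi x.
pose f x := l%:R * (x ^+ l.-1 * phi x) - (s ^+ 2)^-1 * (x ^+ l.+1 * phi x).
have dF (x : R) : is_derive x 1 F (f x).
  have -> : F = (id ^+ l : R -> R) * phi.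
    by apply/funext => y; rewrite /F [in RHS]/GRing.mul/= exprfctE.
  apply: (is_derive_eq (is_deriveM (is_deriveX l (is_derive_id x 1)) (is_derive_pdf x))).
  rewrite exprfctE /f /GRing.scale/= !exprS; field.
  by rewrite s_neq0.
have mf : measurable_fun setT (f : measurableTypeR R -> R).
  by apply: measurable_funB; apply: measurable_funM => //; exact: measurable_pdf_moment.
have i1 : leb.-integrable setT (EFin \o (fun x : measurableTypeR R => l%:R * (x ^+ l.-1 * phi x))).
  exact: (@integrable_Rscale _ _ _ leb l%:R _ (integrable_pdf_moment l.-1)).
have i2 : leb.-integrable setT (EFin \o (fun x : measurableTypeR R => (s ^+ 2)^-1 * (x ^+ l.+1 * phi x))).
  exact: (@integrable_Rscale _ _ _ leb (s ^+ 2)^-1 _ (integrable_pdf_moment l.+1)).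
have intf : leb.-integrable setT (EFin \o f).
  apply: (eq_integrable measurableT (fun x : measurableTypeR R =>
    (l%:R * (x ^+ l.-1 * phi x))%:E - ((s ^+ 2)^-1 * (x ^+ l.+1 * phi x))%:E)%E).
    by move=> o _ /=; rewrite EFinB.
  exact: (integrableB measurableT i1 i2).
have fE : Rintegral leb setT f = l%:R * mom l.-1 - (s ^+ 2)^-1 * mom l.+1.
  rewrite RintegralB// !RintegralZl//; exact: integrable_pdf_moment.
suff f0 : Rintegral leb setT f = 0.
  have := fE; rewrite f0 => /eqP; rewrite eq_sym subr_eq0 => /eqP E.
  by rewrite mulrAC E mulrAC mulVf ?mul1r// expf_neq0.
(* dominated convergence along the intervals [- n.+1, n.+1] *)
pose fn (n : nat) x : \bar R := (f x * \1_(`[(- n.+1%:R), n.+1%:R] : set R) x)%:E.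
have fnE n : (\int[leb]_x fn n x)%E = (F n.+1%:R - F (- n.+1%:R))%:E.
  transitivity (\int[leb]_(x in `[(- n.+1%:R)%R : R, (n.+1%:R)%R]) (f x)%:E)%E.
    rewrite [RHS]integral_mkcond; apply: eq_integral => x _; rewrite patchE /fn indicE.
    by case: ifP; rewrite ?mulr1 ?mulr0.
  rewrite EFinB; apply: continuous_FTC2.
  - by rewrite -subr_gt0 opprK addr_gt0.
  - apply: continuous_subspaceT => x; apply: cvgB; apply: cvgM; try exact: cvg_cst.
      by apply: cvgM; [exact: exprn_continuous|exact: continuous_normal_pdf].
    by apply: cvgM; [exact: exprn_continuous|exact: continuous_normal_pdf].
  - have cF (x : R) : {for x, continuous F}.
      by apply/differentiable_continuous/derivable1_diffP; exact: ex_derive.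
    split.
    + by move=> x _; exact: ex_derive.
    + exact: (cvg_at_right_filter (cF _)).
    + exact: (cvg_at_left_filter (cF _)).
  - by move=> x _; rewrite derive1E; exact: derive_val.
have lim1 : (\int[leb]_x fn n x)%E @[n --> \oo] --> (\int[leb]_x (f x)%:E)%E.
  have := @dominated_convergence _ _ _ leb setT measurableT fn (EFin \o f)
    (fun x => `|(EFin \o f) x|%E) _ _ _ _ _.
  case.
  - move=> n; apply/measurable_EFinP; apply: measurable_funM => //.
  - exact/measurable_EFinP.
  - apply: aeW => x _; apply/fine_cvgP; split; first exact: nearW.
    apply: cvg_near_cst.
    near=> n; rewrite /fn/= indicE mem_set ?mulr1//=.
    rewrite in_itv/= -ler_norml.
    have : (Num.truncn `|x| <= n)%N by near: n; exact: nbhs_infty_ge.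
    rewrite -(leq_add2r 1) !addn1 -(@ler_nat R); apply: le_trans.
    by rewrite ltW// truncnS_gt.
  - exact: integrable_abse.
  - apply: aeW => x n _; rewrite /fn/= lee_fin normrM ler_piMr//.
    by rewrite indicE; case: (_ \in _); rewrite /= ?normr1 ?normr0.
  - by [].
have lim2 : (\int[leb]_x fn n x)%E @[n --> \oo] --> (0 : \bar R)%E.
  under eq_cvg do rewrite fnE.
  apply/fine_cvgP; split; first exact: nearW.
  have [B B0 hB] := pdf_moment_bounded l.+1.
  have hF x : 0 < `|x| -> `|F x| <= B / `|x|.
    move=> x0; rewrite ler_pdivlMr// -normrM (le_trans _ (hB x))//.
    by rewrite /F mulrC mulrA -exprS.
  have c0 : (B *+ 2 / n.+1%:R) @[n --> \oo] --> (0 : R).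
    rewrite -(mulr0 (B *+ 2)); apply: cvgM; first exact: cvg_cst.
    exact: (@cvg_harmonic R).
  apply/cvgr0Pnorm_le => e e0.
  have /cvgr0Pnorm_le /(_ e e0) := c0.
  apply: filterS => n; apply: le_trans => /=.
  have n0 : 0 < n.+1%:R :> R by rewrite ltr0n.
  have -> : `|B *+ 2 / n.+1%:R| = B *+ 2 / n.+1%:R by rewrite ger0_norm ?divr_ge0 ?mulrn_wge0.
  apply: (le_trans (ler_normB _ _)); rewrite mulr2n mulrDl.
  have h1 := hF n.+1%:R; have h2 := hF (- n.+1%:R).
  by rewrite !normrN !(gtr0_norm n0) in h1 h2; rewrite lerD// ?h1 ?h2.
have := cvg_unique (@ereal_hausdorff R) lim1 lim2.
by rewrite /Rintegral => ->.
Unshelve. all: by end_near.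
Qed.

End GaussianMoments.

(** Covers the degenerate case, where the Gaussian law is a Dirac mass. *)
Lemma gaussian_moments (R : realType) (v : R) : 0 <= v ->
  exists (Q : {measure set (measurableTypeR R) -> \bar R}) (g : nat -> R),
  [/\ (Q : set (measurableTypeR R) -> \bar R) = gaussian 0 v, Q setT = 1%E,
    forall l : nat, Q.-integrable setT (EFin \o (fun x : measurableTypeR R => x ^+ l)) /\
      Rintegral Q setT (fun x : measurableTypeR R => x ^+ l) = g l,
    g 0 = 1 & forall l, g l.+1 = l%:R * v * g l.-1].
Proof.
move=> v0; rewrite /gaussian; have [->|vn0] := eqVneq v 0.
  exists (\d_(0 : measurableTypeR R)), (fun l => 0 ^+ l); split.
  - by [].
  - by rewrite /= diracT.
  - move=> l; have mX : measurable_fun setT (fun x : measurableTypeR R => x ^+ l) by [].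
    have mE : measurable_fun setT (fun x : measurableTypeR R => (x ^+ l)%:E).
      exact/measurable_EFinP.
    split; last by rewrite /Rintegral (integral_dirac _ _ mE)// diracT mul1e.
    apply/integrableP; split=> //.
    have mA := measurableT_comp (@abse_measurable R setT) mE.
    by rewrite (integral_dirac _ _ mA)// diracT mul1e ltry.
  - by rewrite expr0.
  - by move=> l; rewrite mulr0 mul0r exprS mul0r.
have vp : 0 < v by rewrite lt_neqAle eq_sym vn0.
pose s := Num.sqrt v; have s0 : 0 < s by rewrite sqrtr_gt0.
exists (normal_prob 0 s), (fun l => Rintegral (@lebesgue_measure R) setT
   (fun x : measurableTypeR R => x ^+ l * normal_pdf 0 s x)); split.
- by [].
- exact: (@probability_setT _ _ _ (normal_prob 0 s)).
- move=> l; apply: (@density_integral _ _ _ (normal_prob 0 s) (@lebesgue_measure R)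
    (normal_pdf 0 s)) => //; first exact: integrable_normal_pdf.
  exact: integrable_pdf_moment.
- under eq_Rintegral do rewrite expr0 mul1r.
  by rewrite /Rintegral integral_normal_pdf.
- by move=> l; rewrite pdf_moment_by_parts// sqr_sqrtr.
Qed.

(** The recursion gives the moments explicitly, and the quotient is c^j / j! with
    c = a^2 v / 2. *)
Lemma gaussian_moment_growth (R : realType) (v : R) (g : nat -> R) :
  g 0 = 1 -> (forall l, g l.+1 = l%:R * v * g l.-1) ->
  forall a eps : R, 0 < eps -> exists j, `|a| ^+ j.*2 / j.*2`!%:R * g j.*2 <= eps.
Proof.
move=> g0 gS a eps e0; pose c := a ^+ 2 * v / 2.
have E j : `|a| ^+ j.*2 / j.*2`!%:R * g j.*2 = c ^+ j / j`!%:R.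
  elim: j => [|j IH]; first by rewrite !expr0 !fact0 g0 mulr1.
  have f0 n : (n`!%:R : R) != 0 by rewrite pnatr_eq0 -lt0n fact_gt0.
  have p0 n : (n.+1%:R : R) != 0 by rewrite pnatr_eq0.
  transitivity (`|a| ^+ j.*2 / j.*2`!%:R * g j.*2 * (c / j.+1%:R)).
    rewrite doubleS gS/= !exprS !factS !natrM mulrA -(expr2 `|a|) real_normK ?num_real//.
    rewrite /c; have -> : j.*2.+2%:R = 2 * j.+1%:R :> R by rewrite -natrM mul2n doubleS.
    by field; rewrite f0 !(natr1, nat1r) !p0.
  rewrite IH exprS factS natrM; field.
  by rewrite f0 !(natr1, nat1r) p0.
have := cvg_series_cvg_0 (is_cvg_series_exp_coeff c).
move=> /cvgr0Pnorm_le /(_ eps e0) [j _ hj]; exists j.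
rewrite E; apply: le_trans (hj j (leqnn j)).
by rewrite ler_norm.
Qed.

Local Open Scope complex_scope.
Local Open Scope ring_scope.

(** * Contour integrals of rational functions *)

Section IntervalIntegral.
Variable R : realType.
Implicit Types (f : R -> R) (a b c v : R).
Local Notation leb := (@lebesgue_measure R).

(** Integrability is part of the notion: the total integral has no linearity
    without it. *)
Definition has_integral f a b v :=
  leb.-integrable `[a, b] (EFin \o f) /\ Rintegral leb `[a, b] f = v.

Lemma has_integral_cat f a b c v w : a < b -> b < c ->
  has_integral f a b v -> has_integral f b c w -> has_integral f a c (v + w).
Proof.
move=> ab bc [i1 v1] [i2 v2].
have U : `[a, c]%classic = `[a, b]%classic `|` `]b, c]%classic :> set R.
  by rewrite -itv_bndbnd_setU// bnd_simp ltW.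
have i2' : leb.-integrable `]b, c] (EFin \o f).
  apply: integrableS i2 => //; apply: subset_itvr.
  by rewrite bnd_simp.
have ac : leb.-integrable `[a, c] (EFin \o f).
  have /integrableP[m1 f1] := i1; have /integrableP[m2 f2] := i2'.
  have mU : measurable_fun `[a, c]%classic (EFin \o f).
    by rewrite U; apply/measurable_funU.
  apply/integrableP; split=> //; rewrite U ge0_integral_setU//.
  - by rewrite lte_add_pinfty.
  - by rewrite -U; exact: measurableT_comp.
  - apply/disj_setPS => x [/=]; rewrite !in_itv/= => /andP[_ h1] /andP[h2 _].
    by move: (le_lt_trans h1 h2); rewrite ltxx.
split=> //; have := @Rintegral_itvB _ f (BLeft a) (BRight c) b ac.
rewrite !bnd_simp => /(_ (ltW ab) (ltW bc)) E.
have : Rintegral leb `]b, c] f = w by rewrite Rintegral_itv_obnd_cbnd.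
by rewrite -E -v1 => <-; rewrite addrC subrK.
Qed.

Lemma has_integral_eq f g a b v : a < b -> {in `]a, b[, f =1 g} ->
  has_integral g a b v -> has_integral f a b v.
Proof.
move=> ab fg [ig vg].
have igo : leb.-integrable `]a, b[ (EFin \o g).
  by apply: integrableS ig => //; exact: subset_itv_oo_cc.
have ifo : leb.-integrable `]a, b[ (EFin \o f).
  by apply: eq_integrable igo => // x; rewrite inE => /fg/= ->.
have mf : measurable_fun `]a, b[ f by apply/measurable_EFinP; exact: measurable_int ifo.
have mg : measurable_fun `]a, b[ g by apply/measurable_EFinP; exact: measurable_int igo.
split; last by rewrite /Rintegral (eq_integral_itv_bounded _ _ mf mg).
have mfc : measurable_fun `[a, b] f by exact: (measurable_fun_itv_cc mf).
apply/integrableP; split; first exact/measurable_EFinP.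
rewrite integral_itv_bndoo; first by have /integrableP[] := ifo.
by apply: measurableT_comp => //; exact/measurable_EFinP.
Qed.

Lemma has_integral_continuous f a b : {within `[a, b], continuous f} ->
  exists v, has_integral f a b v.
Proof.
move=> cf; exists (Rintegral leb `[a, b] f); split=> //.
by apply: continuous_compact_integrable => //; exact: segment_compact.
Qed.

Lemma has_integral_FTC f (df : R -> R) a b : a < b ->
  {within `[a, b], continuous f} -> {within `[a, b], continuous df} ->
  {in `]a, b[, forall x : R, is_derive x (1 : R) f (df x)} ->
  has_integral df a b (f b - f a).
Proof.
move=> ab cf cdf fdf; split.
  by apply: continuous_compact_integrable => //; exact: segment_compact.
rewrite /Rintegral (@continuous_FTC2 _ df f)//.
  have /(continuous_within_itvP _ ab)[_ fa fb] := cf.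
  by split=> // x xab; have := fdf x xab => ?; exact: ex_derive.
by move=> x xab; rewrite derive1E; have := fdf x xab => ?; exact: derive_val.
Qed.

Lemma has_integralD f g a b v w : has_integral f a b v -> has_integral g a b w ->
  has_integral (fun t => f t + g t) a b (v + w).
Proof.
move=> [i1 <-] [i2 <-]; split; last by rewrite RintegralD.
have -> : EFin \o (fun t => f t + g t) = ((EFin \o f) \+ (EFin \o g))%E by apply/funext.
exact: integrableD.
Qed.

Lemma has_integralZ c f a b v : has_integral f a b v ->
  has_integral (fun t => c * f t) a b (c * v).
Proof.
move=> [i1 <-]; split; last by rewrite RintegralZl.
have -> : EFin \o (fun t => c * f t) = (fun t => c%:E * (EFin \o f) t)%E by apply/funext.
exact: integrableZl.
Qed.

End IntervalIntegral.

Section Curves.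
Variable R : realType.
Implicit Types (z w dz dw : R -> R[i]) (a b : R) (c : R[i]).

Definition curve a b z :=
  {within `[a, b], continuous (fun t => complex.Re (z t))} /\
  {within `[a, b], continuous (fun t => complex.Im (z t))}.

(** Complex differentiability is only needed along curves, where it is that of the
    real and imaginary parts. *)
Definition curve_derive a b z dz := [/\ curve a b z, curve a b dz &
  {in `]a, b[, forall t : R, is_derive t 1 (fun t => complex.Re (z t)) (complex.Re (dz t)) /\
                     is_derive t 1 (fun t => complex.Im (z t)) (complex.Im (dz t))}].

Lemma curve_ext a b z w : z =1 w -> curve a b z -> curve a b w.
Proof. by move=> /funext ->. Qed.

Lemma curve_derive_ext a b z w dz dw : z =1 w -> dz =1 dw ->
  curve_derive a b z dz -> curve_derive a b w dw.
Proof. by move=> /funext -> /funext ->. Qed.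

Lemma ReM (x y : R[i]) :
  complex.Re (x * y) = complex.Re x * complex.Re y - complex.Im x * complex.Im y.
Proof. by case: x; case: y. Qed.

Lemma ImM (x y : R[i]) :
  complex.Im (x * y) = complex.Re x * complex.Im y + complex.Im x * complex.Re y.
Proof. by case: x => ? ?; case: y => ? ?. Qed.

Lemma ReN (x : R[i]) : complex.Re (- x) = - complex.Re x. Proof. by case: x. Qed.

Lemma ImN (x : R[i]) : complex.Im (- x) = - complex.Im x. Proof. by case: x. Qed.

Lemma ReD (x y : R[i]) : complex.Re (x + y) = complex.Re x + complex.Re y.
Proof. by case: x; case: y. Qed.

Lemma ImD (x y : R[i]) : complex.Im (x + y) = complex.Im x + complex.Im y.
Proof. by case: x; case: y. Qed.

Let fRe z t : R := complex.Re (z t).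
Let fIm z t : R := complex.Im (z t).

Let fReM z w : (fun t : R => complex.Re (z t * w t)) =
  fun t => fRe z t * fRe w t - fIm z t * fIm w t.
Proof. by apply/funext => t; rewrite ReM. Qed.
Let fImM z w : (fun t : R => complex.Im (z t * w t)) =
  fun t => fRe z t * fIm w t + fIm z t * fRe w t.
Proof. by apply/funext => t; rewrite ImM. Qed.
Let fReD z w : (fun t : R => complex.Re (z t + w t)) = fun t => fRe z t + fRe w t.
Proof. by apply/funext => t; rewrite ReD. Qed.
Let fImD z w : (fun t : R => complex.Im (z t + w t)) = fun t => fIm z t + fIm w t.
Proof. by apply/funext => t; rewrite ImD. Qed.

Lemma curve_cst a b c : curve a b (fun=> c).
Proof. by split=> x; exact: cvg_cst. Qed.

Lemma curveD a b z w : curve a b z -> curve a b w -> curve a b (fun t => z t + w t).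
Proof.
move=> [z1 z2] [w1 w2]; split.
  rewrite fReD.
  by move=> x; apply: cvgD; [exact: z1|exact: w1].
rewrite fImD.
by move=> x; apply: cvgD; [exact: z2|exact: w2].
Qed.

Lemma curveM a b z w : curve a b z -> curve a b w -> curve a b (fun t => z t * w t).
Proof.
move=> [z1 z2] [w1 w2]; split.
  rewrite fReM.
  by move=> x; apply: cvgB; apply: cvgM; [exact: z1|exact: w1|exact: z2|exact: w2].
rewrite fImM.
by move=> x; apply: cvgD; apply: cvgM; [exact: z1|exact: w2|exact: z2|exact: w1].
Qed.

Definition sqn c : R := complex.Re c ^+ 2 + complex.Im c ^+ 2.

Lemma sqn_neq0 c : c != 0 -> sqn c != 0.
Proof.
case: c => x y; apply: contraNneq; rewrite /sqn/= => /eqP.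
rewrite paddr_eq0 ?sqr_ge0// !sqrf_eq0 => /andP[/eqP -> /eqP ->].
by [].
Qed.

Lemma ReV c : complex.Re c^-1 = complex.Re c / sqn c.
Proof. by case: c. Qed.

Lemma ImV c : complex.Im c^-1 = - (complex.Im c / sqn c).
Proof. by case: c. Qed.

Let fReV z : (fun t : R => complex.Re (z t)^-1) = fun t => fRe z t * (sqn (z t))^-1.
Proof. by apply/funext => t; rewrite ReV. Qed.
Let fImV z : (fun t : R => complex.Im (z t)^-1) = fun t => - (fIm z t * (sqn (z t))^-1).
Proof. by apply/funext => t; rewrite ImV. Qed.

(** Outside of the interval the subspace topology is discrete, so the inverse may
    be taken even where the function vanishes. *)
Lemma within_continuousV a b (h : R -> R) : {in `[a, b], forall t, h t != 0} ->
  {within `[a, b], continuous h} -> {within `[a, b], continuous (fun t => (h t)^-1)}.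
Proof.
move=> h0 ch x; move: (ch x); rewrite /continuous_at.
case: (nbhs_subspaceP `[a, b]%classic x) => /= xab cx.
  by have hx : h x != 0 := h0 x xab; exact: cvgV cx.
by move=> B /nbhs_singleton hB y ->.
Qed.

Lemma curveV a b z : {in `[a, b], forall t, z t != 0} -> curve a b z ->
  curve a b (fun t => (z t)^-1).
Proof.
move=> z0 [z1 z2].
(* 1 / z is the conjugate of z divided by its squared modulus *)
have s1 : {within `[a, b], continuous (fun t => (sqn (z t))^-1)}.
  apply: within_continuousV => [t /z0|]; first exact: sqn_neq0.
  have -> : (fun t => sqn (z t)) = fun t => fRe z t * fRe z t + fIm z t * fIm z t.
    by apply/funext => t; rewrite /sqn !expr2.
  by move=> x; apply: cvgD; apply: cvgM; [exact: z1|exact: z1|exact: z2|exact: z2].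
split.
  rewrite fReV.
  by move=> x; apply: cvgM; [exact: z1|exact: s1].
rewrite fImV.
by move=> x; apply: cvgN; apply: cvgM; [exact: z2|exact: s1].
Qed.

Lemma curve_derive_cst a b c : curve_derive a b (fun=> c) (fun=> 0).
Proof.
split; [exact: curve_cst|exact: curve_cst|move=> t _; split; exact: is_derive_cst].
Qed.

Lemma curve_deriveD a b z w dz dw : curve_derive a b z dz -> curve_derive a b w dw ->
  curve_derive a b (fun t => z t + w t) (fun t => dz t + dw t).
Proof.
move=> [z1 z2 z3] [w1 w2 w3]; split; try exact: curveD.
move=> t /[dup] /z3[r1 r2] /w3[s1 s2]; split.
  rewrite fReD.
  by apply: is_derive_eq; rewrite ReD.
rewrite fImD.
by apply: is_derive_eq; rewrite ImD.
Qed.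

Lemma curve_deriveM a b z w dz dw : curve_derive a b z dz -> curve_derive a b w dw ->
  curve_derive a b (fun t => z t * w t) (fun t => z t * dw t + dz t * w t).
Proof.
move=> [z1 z2 z3] [w1 w2 w3]; split; first exact: curveM.
  by apply: curveD; exact: curveM.
move=> t /[dup] /z3[r1 r2] /w3[s1 s2]; split.
  rewrite fReM.
  apply: is_derive_eq; rewrite ReD !ReM /GRing.scale/=; ring.
rewrite fImM.
apply: is_derive_eq; rewrite ImD !ImM /GRing.scale/=; ring.
Qed.

Lemma curve_deriveV a b z dz : {in `[a, b], forall t, z t != 0} ->
  curve_derive a b z dz ->
  curve_derive a b (fun t => (z t)^-1) (fun t => - (dz t * (z t)^-1 ^+ 2)).
Proof.
move=> z0 [z1 z2 z3]; split; first exact: curveV.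
  have : curve a b (fun t => (- 1) * (dz t * ((z t)^-1 * (z t)^-1))).
    by apply: curveM; [exact: curve_cst|apply: curveM => //; apply: curveM; exact: curveV].
  by apply: curve_ext => t; rewrite mulN1r expr2.
move=> t tab; have [r1 r2] := z3 t tab.
have n0 : sqn (z t) != 0 by apply/sqn_neq0/z0; apply: subset_itv_oo_cc.
have dN : is_derive t (1 : R) (fun t => (sqn (z t))^-1)
  (- (sqn (z t)) ^- 2 * (2 * complex.Re (z t) * complex.Re (dz t) +
     2 * complex.Im (z t) * complex.Im (dz t))).
  have : is_derive t (1 : R) (fun t => sqn (z t)) (2 * complex.Re (z t) * complex.Re (dz t) +
     2 * complex.Im (z t) * complex.Im (dz t)).
    have -> : (fun t => sqn (z t)) = fun t => fRe z t * fRe z t + fIm z t * fIm z t.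
      by apply/funext => u; rewrite /sqn !expr2.
    apply: is_derive_eq; rewrite /GRing.scale/=; ring.
  by move=> h; apply: is_deriveV.
split.
  rewrite fReV.
  apply: is_derive_eq; rewrite (expr2 (z t)^-1) /GRing.scale/= /fRe /fIm.
  rewrite !(ReN, ImN, ReM, ImM, ReV, ImV) /=; move: n0; rewrite /sqn.
  set X := complex.Re (z t); set Y := complex.Im (z t) => n0.
  by field.
rewrite fImV.
apply: is_derive_eq; rewrite (expr2 (z t)^-1) /GRing.scale/= /fRe /fIm.
rewrite !(ReN, ImN, ReM, ImM, ReV, ImV) /=; move: n0; rewrite /sqn.
set X := complex.Re (z t); set Y := complex.Im (z t) => n0.
by field.
Qed.

Lemma curve_deriveX a b z dz n : curve_derive a b z dz ->
  curve_derive a b (fun t => z t ^+ n.+1) (fun t => n.+1%:R * (z t ^+ n * dz t)).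
Proof.
move=> zd; elim: n => [|n IH].
  by apply: curve_derive_ext zd => t; rewrite ?expr1// expr0 !mul1r.
apply: curve_derive_ext (curve_deriveM zd IH) => t; first by rewrite [RHS]exprS.
by rewrite -[n.+2%:R]natr1 !exprS; ring.
Qed.

End Curves.

Section ResidueRecursion.
Variable R : numFieldType.
Implicit Types (u v q : {poly R}).

(** Adding a root c: the quotient by 'X - c keeps the residue, and the remainder
    only matters when c is the sole pole. *)
Lemma residue_factor q v c r : v \is monic ->
  residue (q * ('X - c%:P) + r%:P) (('X - c%:P) * v) =
  residue q v + r * (size v == 1)%:R.
Proof.
move=> mv; have v0 := monic_neq0 mv.
have szv : (0 < size v)%N by rewrite size_poly_gt0.
pose rho := q %% v; have srho : (size rho < size v)%N by rewrite ltn_modp.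
have szL : size (('X - c%:P) * v) = (size v).+1.
  by rewrite mulrC size_Mmonic ?monicXsubC// size_XsubC addn2.
rewrite /residue szL.
have -> : (q * ('X - c%:P) + r%:P) %% (('X - c%:P) * v) = rho * ('X - c%:P) + r%:P.
  rewrite [in LHS](divp_eq q v) -/rho.
  have -> : (q %/ v * v + rho) * ('X - c%:P) + r%:P =
    (q %/ v) * (('X - c%:P) * v) + (rho * ('X - c%:P) + r%:P) by ring.
  rewrite modpD modp_mull add0r modp_small// szL ltnS.
  apply: leq_trans (size_polyD _ _) _; rewrite geq_max.
  rewrite (leq_trans (size_polyC_leq1 r) szv) andbT.
  have [->|rho0] := eqVneq rho 0; first by rewrite mul0r size_poly0.
  by rewrite size_Mmonic ?monicXsubC// size_XsubC addn2.
rewrite -/rho mulrBr coefD coefB coefMX coefMC coefC.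
have rk : rho`_(size v).-1 = 0 by rewrite nth_default// -ltnS prednK.
rewrite /= rk mul0r subr0; case E : (size v) szv srho => [|[|k]]//= _ srho.
  by rewrite mulr1 nth_default// -ltnS (leq_trans srho).
by rewrite mulr0.
Qed.

End ResidueRecursion.

Section Residue.
Variables (R : realType) (g : R -> R[i]).
Hypothesis g_contour : simple_closed_contour g.
Implicit Types (F G : R[i] -> R[i]) (c v : R[i]) (s : seq R).

(** A value of the contour integral together with integrability. *)
Definition has_contour F v :=
  has_integral (fun t => complex.Re (F (g t) * velocity g t)) 0 1 (complex.Re v) /\
  has_integral (fun t => complex.Im (F (g t) * velocity g t)) 0 1 (complex.Im v).

Lemma has_contour_value F v : has_contour F v -> contour_integral g F = v.
Proof. by case: v => x y [[_ h1] [_ h2]]; rewrite /contour_integral h1 h2. Qed.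

Lemma has_contour_ext F G v : {in `[0, 1], forall t, F (g t) = G (g t)} ->
  has_contour G v -> has_contour F v.
Proof.
move=> FG [h1 h2]; split.
  by apply: has_integral_eq h1 => // t /subset_itv_oo_cc /FG ->.
by apply: has_integral_eq h2 => // t /subset_itv_oo_cc /FG ->.
Qed.

Lemma has_contourD F G v w : has_contour F v -> has_contour G w ->
  has_contour (fun z => F z + G z) (v + w).
Proof.
move=> [f1 f2] [g1 g2]; split.
  rewrite ReD; apply: has_integral_eq (has_integralD f1 g1) => // t _.
  by rewrite mulrDl ReD.
rewrite ImD; apply: has_integral_eq (has_integralD f2 g2) => // t _.
by rewrite mulrDl ImD.
Qed.

Lemma has_contourZ c F v : has_contour F v -> has_contour (fun z => c * F z) (c * v).
Proof.
move=> [f1 f2]; split.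
  rewrite ReM -mulNr.
  apply: has_integral_eq (has_integralD (has_integralZ (complex.Re c) f1)
    (has_integralZ (- complex.Im c) f2)) => // t _.
  by rewrite -mulrA ReM mulNr.
rewrite ImM; apply: has_integral_eq (has_integralD (has_integralZ (complex.Re c) f2)
  (has_integralZ (complex.Im c) f1)) => // t _.
by rewrite -mulrA ImM.
Qed.

Lemma interval_chain (Pr : R -> R -> Prop) s :
  (forall a b c : R, a < b -> b < c -> Pr a b -> Pr b c -> Pr a c) ->
  sorted <%R s -> (forall i, (i.+1 < size s)%N -> Pr s`_i s`_i.+1) ->
  (1 < size s)%N -> Pr s`_0 (last 0 s).
Proof.
move=> cat; case: s => [|x [|y s]]//= + + _.
elim: s x y => [|z s IH] x y srt step; first by have := step 0%N isT.
move: srt => /andP[xy srt]; apply: (cat x y) => //.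
- have := order_path_min lt_trans srt => /allP; apply.
  by rewrite /= mem_last.
- by have := step 0%N isT.
- by apply: (IH y z srt) => i hi; exact: (step i.+1 hi).
Qed.

(** The velocity is not controlled at the finitely many corners, hence the
    equality with dg on open intervals only. *)
Lemma pieces_ind (Pr : R -> R -> Prop) :
  (forall a b c : R, a < b -> b < c -> Pr a b -> Pr b c -> Pr a c) ->
  (forall a b dg, 0 <= a -> a < b -> b <= 1 -> curve_derive a b g dg ->
     {in `]a, b[, velocity g =1 dg} -> Pr a b) -> Pr 0 1.
Proof.
move=> cat step; have [[s [s0 s1 srt pc]] _ _] := g_contour.
have s_gt1 : (1 < size s)%N.
  case: (s) s0 s1 => [|x [|]]//=; first by move=> _ /eqP; rewrite eq_sym oner_eq0.
  by move=> -> /eqP; rewrite eq_sym oner_eq0.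
rewrite -{1}s0 -s1; apply: interval_chain => // i hi.
have mono := sorted_ltn_nth lt_trans 0 srt.
have [[cR [dR cdR hR]] [cI [dI cdI hI]]] := pc i hi.
have lt1 : s`_i < s`_i.+1.
  by apply: mono => //; rewrite inE// (leq_trans _ hi).
apply: (step _ _ (fun t => (dR t +i* dI t)%C)) => //.
- have : s`_0 <= s`_i; last by rewrite s0.
  have [->//|i0] := posnP i.
  by apply/ltW/mono; rewrite ?inE// (leq_trans _ hi)// ltnW.
- have : s`_i.+1 <= s`_(size s).-1; last by rewrite nth_last s1.
  have [E|ni] := eqVneq i.+1 (size s).-1; first by rewrite E.
  apply/ltW/mono; rewrite ?inE//; first by rewrite prednK// (leq_trans _ hi).
  by rewrite ltn_neqAle ni -ltnS prednK// (leq_trans _ hi).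
- by split=> // t ht; split; [exact: hR|exact: hI].
- move=> t ht; rewrite /velocity !derive1E.
  by have := hR t ht; have := hI t ht => ? ?; rewrite !derive_val.
Qed.

Lemma contour_exists F :
  (forall a b, 0 <= a -> a < b -> b <= 1 -> curve a b g -> curve a b (F \o g)) ->
  exists v, has_contour F v.
Proof.
move=> hF; pose Pr (a b : R) := exists v1 v2 : R,
  has_integral (fun t => complex.Re (F (g t) * velocity g t)) a b v1 /\
  has_integral (fun t => complex.Im (F (g t) * velocity g t)) a b v2.
suff [v1 [v2 [h1 h2]]] : Pr 0 1 by exists (v1 +i* v2)%C.
apply: pieces_ind => [a b c ab bc [v1 [v2 [h1 h2]]] [w1 [w2 [k1 k2]]]|a b dg a0 ab b1 [cg cdg _] hv].
  by exists (v1 + w1), (v2 + w2); split; exact: (has_integral_cat ab bc).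
have [c1 c2] := curveM (hF _ _ a0 ab b1 cg) cdg.
have [v1 h1] := has_integral_continuous c1; have [v2 h2] := has_integral_continuous c2.
exists v1, v2; split.
  by apply: has_integral_eq h1 => // t ht; rewrite hv.
by apply: has_integral_eq h2 => // t ht; rewrite hv.
Qed.

(** The fundamental theorem of calculus on each piece; the contour is closed. *)
Lemma contour_primitive F G :
  (forall a b dg, 0 <= a -> a < b -> b <= 1 -> curve_derive a b g dg ->
    curve_derive a b (G \o g) (fun t => F (g t) * dg t)) ->
  has_contour F 0.
Proof.
move=> hF; pose Pr a b :=
  has_integral (fun t => complex.Re (F (g t) * velocity g t)) a b
    (complex.Re (G (g b)) - complex.Re (G (g a))) /\
  has_integral (fun t => complex.Im (F (g t) * velocity g t)) a b
    (complex.Im (G (g b)) - complex.Im (G (g a))).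
suff : Pr 0 1 by rewrite /Pr; have [_ -> _] := g_contour; rewrite !subrr.
apply: pieces_ind => [a b c ab bc [h1 h2] [k1 k2]|a b dg a0 ab b1 cg hv].
  split.
    have := has_integral_cat ab bc h1 k1; congr has_integral; ring.
  have := has_integral_cat ab bc h2 k2; congr has_integral; ring.
have [[c1 c2] [d1 d2] hd] := hF _ _ _ a0 ab b1 cg.
split.
  apply: (@has_integral_eq _ _ (fun t => complex.Re (F (g t) * dg t))) => //.
    by move=> t ht; rewrite hv.
  by apply: (@has_integral_FTC _ (fun t => complex.Re (G (g t)))) => // t /hd[].
apply: (@has_integral_eq _ _ (fun t => complex.Im (F (g t) * dg t))) => //.
  by move=> t ht; rewrite hv.
by apply: (@has_integral_FTC _ (fun t => complex.Im (G (g t)))) => // t /hd[].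
Qed.

Definition peval (p : {poly R}) z := (map_poly (real_complex R) p).[z].

Lemma pevalM p q z : peval (p * q) z = peval p z * peval q z.
Proof. by rewrite /peval rmorphM hornerM. Qed.

Lemma pevalD p q z : peval (p + q) z = peval p z + peval q z.
Proof. by rewrite /peval rmorphD hornerD. Qed.

Lemma pevalXsubC x z : peval ('X - x%:P) z = z - x%:C.
Proof. by rewrite /peval rmorphB/= map_polyX map_polyC hornerXsubC. Qed.

Lemma pevalC x z : peval x%:P z = x%:C.
Proof. by rewrite /peval map_polyC hornerC. Qed.

Lemma contour_monomial n : has_contour (fun z => z ^+ n) 0.
Proof.
apply: (@contour_primitive _ (fun z => n.+1%:R^-1 * z ^+ n.+1)) => a b dg _ _ _ dgg.
have := curve_deriveM (curve_derive_cst a b (n.+1%:R^-1)) (curve_deriveX n dgg).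
apply: curve_derive_ext => t //=.
by rewrite mul0r addr0 mulrA mulVf ?mul1r// pnatr_eq0.
Qed.

Lemma contour_peval p : has_contour (peval p) 0.
Proof.
have h (r : seq nat) : has_contour (fun z => \sum_(i <- r) (p`_i)%:C * z ^+ i) 0.
  elim: r => [|i r IH].
    have := has_contourZ 0 (contour_monomial 0); rewrite mulr0; apply: has_contour_ext => t _.
    by rewrite big_nil mul0r.
  have := has_contourD (has_contourZ (p`_i)%:C (contour_monomial i)) IH.
  by rewrite mulr0 addr0; apply: has_contour_ext => t _; rewrite big_cons.
apply: has_contour_ext (h (index_iota 0 (size p))) => t _.
rewrite /peval (horner_coef_wide _ (size_poly _ _)) big_mkord.
by apply: eq_bigr => i _; rewrite coef_map.
Qed.

Let ok x := goes_around_ccw g x%:C.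
Let linprod s : {poly R} := \prod_(x <- s) ('X - x%:P).

Lemma linprod_neq0 s t : t \in `[0, 1] -> (forall x, x \in s -> ok x) ->
  peval (linprod s) (g t) != 0.
Proof.
move=> t01; rewrite /linprod; elim: s => [|x s IH] hs.
  by rewrite big_nil pevalC oner_neq0.
rewrite big_cons pevalM mulf_neq0 ?IH//; last by move=> y ys; apply: hs; rewrite inE ys orbT.
by have [+ _] := hs x (mem_head _ _); rewrite pevalXsubC subr_eq0; apply.
Qed.

Lemma two_pi_i_neq0 : two_pi_i R != 0.
Proof.
rewrite /two_pi_i eq_complex/= eqxx/= mulf_neq0 ?pnatr_eq0//.
by rewrite gt_eqF// pi_gt0.
Qed.

Let curve_sub x a b dg : ok x -> 0 <= a -> b <= 1 -> curve_derive a b g dg ->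
  {in `[a, b], forall t, g t - x%:C != 0} /\ curve_derive a b (fun t => g t - x%:C) dg.
Proof.
move=> [gx _] a0 b1 dgg; split.
  move=> t; rewrite in_itv/= => /andP[at_ tb]; rewrite subr_eq0; apply: gx.
  by rewrite in_itv/= (le_trans a0)//= (le_trans tb).
have := curve_deriveD dgg (curve_derive_cst a b (- x%:C)).
by apply: curve_derive_ext => t //; rewrite addr0.
Qed.

(** The winding number, once integrability is known. *)
Lemma contour_simple_pole x : ok x -> has_contour (fun z => (z - x%:C)^-1) (two_pi_i R).
Proof.
move=> okx; have [v hv] : exists v, has_contour (fun z => (z - x%:C)^-1) v.
  apply: contour_exists => a b a0 ab b1 cg; apply: curveV; last first.
    by apply: curveD => //; exact: curve_cst.
  have [gx _] := okx => t; rewrite in_itv/= => /andP[at_ tb]; rewrite subr_eq0.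
  by apply: gx; rewrite in_itv/= (le_trans a0)//= (le_trans tb).
have E := has_contour_value hv; have [_] := okx.
rewrite /winding_number E => /(congr1 (fun y => two_pi_i R * y)).
by rewrite mulrA divff ?two_pi_i_neq0// mul1r mulr1 => <-.
Qed.

(** Poles of order at least 2 have primitives. *)
Lemma contour_multiple_pole x n : ok x ->
  has_contour (fun z => (z - x%:C)^-1 ^+ n.+2) 0.
Proof.
move=> okx.
apply: (@contour_primitive _ (fun z => - n.+1%:R^-1 * (z - x%:C)^-1 ^+ n.+1)).
move=> a b dg a0 ab b1 dgg; have [nz d1] := curve_sub okx a0 b1 dgg.
have := curve_deriveM (curve_derive_cst a b (- n.+1%:R^-1))
  (curve_deriveX n (curve_deriveV nz d1)).
apply: curve_derive_ext => t //=; rewrite mul0r addr0.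
have n0 : (n.+1%:R : R[i]) != 0 by rewrite pnatr_eq0.
set w := (g t - x%:C)^-1; transitivity (n.+1%:R^-1 * n.+1%:R * (w ^+ n.+2 * dg t)).
  by rewrite !exprS; set y := n.+1%:R^-1; ring.
by rewrite mulVf// mul1r.
Qed.

(** Two distinct roots x, y are separated by
    1 / ((z - x) (z - y)) = ((z - x)^-1 - (z - y)^-1) / (x - y), which reduces the
    number of factors; with two factors the two winding numbers cancel. *)
Lemma contour_inv_linprod n s : size s = n.+1 -> (forall x, x \in s -> ok x) ->
  has_contour (fun z => (peval (linprod s) z)^-1) (if n == 0%N then two_pi_i R else 0).
Proof.
elim: n s => [|n IH] s.
  case: s => [|x []]//= _ hs; apply: has_contour_ext (contour_simple_pole (hs x _)).
    by move=> t _; rewrite /linprod big_seq1 pevalXsubC.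
  by rewrite inE.
case: s => [//|x s] /= [szs] hs.
have okx : ok x by apply: hs; rewrite inE eqxx.
have [sx|] := boolP (all (pred1 x) s).
  apply: has_contour_ext (contour_multiple_pole n okx) => t _.
  have -> : x :: s = nseq n.+2 x by rewrite (all_pred1P _ _ sx) szs.
  rewrite /linprod; have -> k : \prod_(y <- nseq k x) ('X - y%:P) = ('X - x%:P) ^+ k.
    by elim: k => [|k IHk]; rewrite ?big_nil// big_cons exprS IHk.
  by rewrite /peval rmorphXn horner_exp -/(peval _ _) pevalXsubC exprVn.
case/allPn => y ys /= yx.
have oky : ok y by apply: hs; rewrite inE ys orbT.
pose s' := rem y s.
have ps : perm_eq s (y :: s') by exact: perm_to_rem.
have szs' : size s' = n by rewrite size_rem// szs.
have hs' z : z \in s' -> ok z by move=> /mem_rem zs; apply: hs; rewrite inE zs orbT.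
have hx z : z \in x :: s' -> ok z by rewrite inE => /orP[/eqP->|/hs'].
have hy z : z \in y :: s' -> ok z by rewrite inE => /orP[/eqP->|/hs'].
have sz1 : size (x :: s') = n.+1 by rewrite /= szs'.
have sz2 : size (y :: s') = n.+1 by rewrite /= szs'.
have d0 : (x - y)%:C != 0 :> R[i].
  by rewrite eq_complex/= eqxx andbT subr_eq0 eq_sym.
have := has_contourZ ((x - y)%:C)^-1 (has_contourD (IH _ sz1 hx)
   (has_contourZ (-1) (IH _ sz2 hy))).
rewrite mulN1r subrr mulr0; apply: has_contour_ext => t t01.
have nz := linprod_neq0 t01 hs; move: nz.
have -> : linprod (x :: s) = ('X - x%:P) * (('X - y%:P) * linprod s').
  by rewrite /linprod big_cons (perm_big _ ps) big_cons.
rewrite /linprod !big_cons -/(linprod s') !pevalM !pevalXsubC.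
rewrite !mulf_eq0 !negb_or => /and3P[nx ny nl].
move: nx ny d0; rewrite rmorphB/= => nx ny d0.
by field; rewrite nx ny nl d0.
Qed.

(** Divide u by 'X - x and induct on the number of roots, as in
    [residue_factor]. *)
Theorem contour_residue u s : (forall x, x \in s -> ok x) ->
  has_contour (fun z => peval u z / peval (linprod s) z)
    (two_pi_i R * (residue u (linprod s))%:C).
Proof.
elim: s u => [|x s IH] u hs.
  have -> : residue u (linprod [::]) = 0.
    by rewrite /residue /linprod big_nil modp1 coef0.
  rewrite mulr0; apply: has_contour_ext (contour_peval u) => t _.
  by rewrite /linprod big_nil pevalC divr1.
have hs' z : z \in s -> ok z by move=> zs; apply: hs; rewrite inE zs orbT.
pose q := u %/ ('X - x%:P); pose r := u.[x].
have uE : u = q * ('X - x%:P) + r%:P by rewrite {1}(divp_eq u ('X - x%:P)) modp_XsubC.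
have := has_contourD (IH q hs') (has_contourZ r%:C
  (contour_inv_linprod (erefl : size (x :: s) = (size s).+1) hs)).
have -> : linprod (x :: s) = ('X - x%:P) * linprod s by rewrite /linprod big_cons.
have ms : linprod s \is monic by rewrite /linprod monic_prod_XsubC.
rewrite {2}uE residue_factor// rmorphD rmorphM/= mulrDr.
have -> : (size (linprod s) == 1) = (size s == 0)%N.
  by rewrite /linprod (size_prod_XsubC s id) eqSS.
have -> : r%:C * (if size s == 0%N then two_pi_i R else 0) =
   two_pi_i R * (r%:C * ((size s == 0%N)%:R)%:C).
  by case: ifP => _; rewrite ?mulr1 ?mulr0// mulrC.
apply: has_contour_ext => t t01; have nz := linprod_neq0 t01 hs; move: nz.
have -> : linprod (x :: s) = ('X - x%:P) * linprod s by rewrite /linprod big_cons.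
rewrite {1}uE pevalD !pevalM pevalC pevalXsubC mulf_eq0 negb_or => /andP[nx ns].
by field; rewrite nx ns.
Qed.

End Residue.

(** * The variance as a series of Fourier coefficients *)

Section ResidueAtInfinity.
Variable R : numFieldType.
Implicit Types (u v p : {poly R}).

Lemma coef_mul_monic p v k : v \is monic -> (size p <= k.+1)%N ->
  (p * v)`_((size v).-1 + k) = p`_k.
Proof.
move=> mv sp; rewrite coefM.
have kl : (k < ((size v).-1 + k).+1)%N by rewrite ltnS leq_addl.
rewrite (bigD1 (Ordinal kl))//= addnK -lead_coefE (monicP mv) mulr1.
rewrite big1 ?addr0// => i; rewrite -val_eqE/= => ik.
have [lik|] := ltnP i k; last first.
  rewrite leq_eqVlt eq_sym (negbTE ik)/= => ki.
  by rewrite [p`_i]nth_default ?mul0r// (leq_trans sp).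
rewrite [v`_ _]nth_default ?mulr0//.
have : (0 < size v)%N by rewrite size_poly_gt0 monic_neq0.
by move: lik; move: (size v) (nat_of_ord i) => a b; lia.
Qed.

(** The division of u by v yields the Laurent coefficients at infinity; the pole
    at the origin selects one of nonnegative index. *)
Lemma residue_mulXn u v l : v \is monic ->
  residue u (v * 'X^(l.+1)) = (u %/ v)`_l.
Proof.
move=> mv; set Q := u %/ v; set rho := u %% v.
have v0 := monic_neq0 mv.
have srho : (size rho < size v)%N by rewrite ltn_modp.
pose Q0 := take_poly l.+1 Q; pose Q1 := drop_poly l.+1 Q.
have QE : Q = Q0 + Q1 * 'X^(l.+1) by rewrite poly_take_drop.
have sQ0 : (size Q0 <= l.+1)%N by exact: size_take_poly.
have szL : size (v * 'X^(l.+1)) = (size v + l.+1)%N.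
  by rewrite size_Mmonic ?monicXn// size_polyXn addnS.
have sv : (0 < size v)%N by rewrite size_poly_gt0.
have -> : u = Q1 * (v * 'X^(l.+1)) + (Q0 * v + rho).
  by rewrite {1}(divp_eq u v) -/Q -/rho {1}QE; ring.
rewrite /residue modpD modp_mull add0r modp_small; last first.
  rewrite szL; apply: leq_ltn_trans (size_polyD _ _) _.
  rewrite gtn_max (leq_trans srho) ?leq_addr// andbT.
  have [->|Q00] := eqVneq Q0 0; first by rewrite mul0r size_poly0 addn_gt0 sv.
  rewrite size_Mmonic//; move: sQ0 sv; move: (size Q0) (size v) => a b; lia.
have -> : (size (v * 'X^(l.+1))).-2 = ((size v).-1 + l)%N.
  by rewrite szL; move: sv; move: (size v) => a; lia.
rewrite coefD coef_mul_monic// [rho`_ _]nth_default ?addr0.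
  by rewrite /Q0 coef_take_poly ltnSn.
by rewrite -ltnS -addSn prednK// (leq_trans srho)// leq_addr.
Qed.

(** The polynomial part of u / v times p has no residue. *)
Lemma residue_modp u v p : residue (u * p) v = residue (p * (u %% v)) v.
Proof. by rewrite /residue modp_mul mulrC. Qed.

End ResidueAtInfinity.

Section FourierCoefficients.
Variables (R : realType) (m : nat) (alim blim : 'I_m -> R) (g : R -> R[i]).
Hypothesis g_contour : simple_closed_contour g.
Hypothesis g_b : forall j, goes_around_ccw g (blim j)%:C.
Hypothesis g_0 : goes_around_ccw g 0.
Variables (f : {poly R}) (d : nat).
Hypothesis size_f : (size f <= d.+1)%N.
Let num := hnum alim blim f d.
Let den := hden blim d.

Let bs := flatten (nseq d [seq blim j | j <- index_enum 'I_m]).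

Lemma hden_linprod : den = \prod_(x <- bs) ('X - x%:P).
Proof.
rewrite /den /hden /bs; elim: (d) => [|k IH]; first by rewrite big_nil expr0.
by rewrite exprS /= big_cat/= -IH big_map.
Qed.

Lemma bs_ok x : x \in bs -> goes_around_ccw g x%:C.
Proof.
move=> /flattenP[s]; rewrite mem_nseq => /andP[_ /eqP ->] /mapP[j _ ->].
exact: g_b.
Qed.

Lemma peval_gden_neq0 t : t \in `[0, 1] -> peval (gden blim) (g t) != 0.
Proof.
move=> t01; have := @linprod_neq0 _ g [seq blim j | j <- index_enum 'I_m] t t01.
rewrite big_map; apply => x /mapP[j _ ->]; exact: g_b.
Qed.

Lemma peval_sum (I : Type) (r : seq I) (Q : pred I) (p : I -> {poly R}) (z : R[i]) :
  peval (\sum_(i <- r | Q i) p i) z = \sum_(i <- r | Q i) peval (p i) z.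
Proof. by rewrite /peval rmorph_sum/= horner_sum. Qed.

Lemma pevalX (p : {poly R}) (z : R[i]) n : peval (p ^+ n) z = peval p z ^+ n.
Proof. by rewrite /peval rmorphXn horner_exp. Qed.

Lemma pevalZ x (p : {poly R}) (z : R[i]) : peval (x *: p) z = x%:C * peval p z.
Proof. by rewrite -mul_polyC pevalM pevalC. Qed.

Lemma peval_symbol t : t \in `[0, 1] ->
  g t + \sum_(j < m) (alim j)%:C / (g t - (blim j)%:C) =
  peval (gnum alim blim) (g t) / peval (gden blim) (g t).
Proof.
move=> t01; have nz := peval_gden_neq0 t01.
apply: (mulIf nz); rewrite mulfVK// mulrDl mulr_suml /gnum pevalD pevalM.
congr (_ * _ + _); first by rewrite /peval map_polyX hornerX.
rewrite peval_sum; apply: eq_bigr => j _; rewrite pevalZ -mulrA; congr (_ * _).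
rewrite /gden (bigD1 j)//= pevalM pevalXsubC mulrA mulVf ?mul1r//.
by rewrite subr_eq0; have [+ _] := g_b j; apply.
Qed.

Lemma peval_hnum t : t \in `[0, 1] ->
  (map_poly (real_complex R) f).[g t + \sum_(j < m) (alim j)%:C / (g t - (blim j)%:C)] =
  peval num (g t) / peval den (g t).
Proof.
move=> t01; have nz := peval_gden_neq0 t01.
rewrite peval_symbol// /num /den /hnum /hden pevalX peval_sum mulr_suml.
rewrite (@horner_coef_wide _ d.+1); last exact: leq_trans (size_poly _ _) size_f.
apply: eq_bigr => i _; rewrite coef_map pevalZ pevalM !pevalX -!mulrA; congr (_ * _).
have id : (i <= d)%N by rewrite -ltnS.
rewrite exprMn exprVn; congr (_ * _); apply: (mulfI (expf_neq0 d nz)).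
rewrite [RHS]mulrCA divff ?expf_neq0// mulr1 -{1}(subnK id) exprD mulfK//.
by rewrite expf_neq0.
Qed.

Let pi0 := two_pi_i_neq0 R.

Lemma symbol_coef_pos (l : nat) :
  symbol_coef alim blim g f l%:Z = ((num %/ den)`_l)%:C.
Proof.
rewrite -(residue_mulXn _ _ (monic_hden blim d)) /symbol_coef.
have := @contour_residue _ g g_contour num (bs ++ nseq l.+1 0) _.
have -> : \prod_(x <- bs ++ nseq l.+1 0) ('X - x%:P) = den * 'X^(l.+1) :> {poly R}.
  rewrite big_cat -hden_linprod; congr (_ * _).
  by elim: (l.+1) => [|k IH]; rewrite ?big_nil// big_cons IH subr0 exprS.
have ok x : x \in bs ++ nseq l.+1 0 -> goes_around_ccw g x%:C.
  by rewrite mem_cat mem_nseq => /orP[/bs_ok//|/andP[_ /eqP ->]].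
move=> /(_ ok) h; rewrite (@has_contour_value _ g _ (two_pi_i R * (residue num (den * 'X^(l.+1)))%:C)).
  by rewrite mulrA mulVf// mul1r.
apply: has_contour_ext h => t t01; rewrite peval_hnum// pevalM invfM mulrA.
congr (_ / _); rewrite -PoszD addn1.
by rewrite pevalX /peval map_polyX hornerX.
Qed.

Lemma symbol_coef_neg (l : nat) :
  symbol_coef alim blim g f (- l.+1%:Z) = (residue ('X^l * (num %% den)) den)%:C.
Proof.
rewrite -residue_modp /symbol_coef.
have := @contour_residue _ g g_contour (num * 'X^l) bs bs_ok.
rewrite -hden_linprod => h.
rewrite (@has_contour_value _ g _ (two_pi_i R * (residue (num * 'X^l) den)%:C)).
  by rewrite mulrA mulVf// mul1r.
apply: has_contour_ext h => t t01; rewrite peval_hnum// pevalM [RHS]mulrAC.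
congr (_ * _); have -> : - l.+1%:Z + 1 = - l%:Z by lia.
by rewrite -invr_expz -exprnP invrK pevalX /peval map_polyX hornerX.
Qed.

(** Coefficients of index l > d vanish because the symbol grows like z^d, so the
    series is eventually constant. *)
Lemma variance_series :
  complex_series_cvg (fun l : nat => l%:R * symbol_coef alim blim g f l%:Z *
     symbol_coef alim blim g f (- l%:Z))
   (model_variance (num %/ den) (num %% den) den d)%:C.
Proof.
pose r l := l%:R * (num %/ den)`_l * residue ('X^(l.-1) * (num %% den)) den.
have uE N : \sum_(1 <= l < N) (l%:R * symbol_coef alim blim g f l%:Z *
     symbol_coef alim blim g f (- l%:Z)) = (\sum_(1 <= l < N) r l)%:C.
  rewrite rmorph_sum/=; apply: eq_big_nat => -[|l]// _.
  by rewrite symbol_coef_pos symbol_coef_neg /r !rmorphM/= rmorph_nat.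
have sz : (size (num %/ den)%R <= d.+1)%N by exact: (size_hpol alim blim size_f).
have rE N : (d < N)%N -> \sum_(1 <= l < N) r l = model_variance (num %/ den) (num %% den) den d.
  move=> dN; rewrite /model_variance -(big_mkord xpredT r).
  have r0 : r 0%N = 0 by rewrite /r !mul0r.
  rewrite [in RHS]big_ltn// r0 add0r (@big_cat_nat _ _ _ d.+1)//=.
  suff -> : \sum_(d.+1 <= l < N) r l = 0 by rewrite addr0.
  rewrite big_nat_cond big1// => l /andP[/andP[dl _] _].
  rewrite /r [(num %/ den)`_l]nth_default ?mulr0 ?mul0r//.
  exact: leq_trans sz dl.
split; apply: cvg_near_cst; exists d.+1 => // N /= dN; rewrite uE//=.
by rewrite rE.
Qed.

End FourierCoefficients.

(** * The central limit theorem *)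

Section Centering.
Variable R : numFieldType.

Lemma texp0 T c : (texp T c)`_0 = 1 :> R.
Proof. by rewrite coef_poly expr0 fact0 divr1. Qed.

Lemma texp_deriv T c k : (k < T)%N ->
  (texp T c)`_k.+1 *+ k.+1 = c * (texp T c)`_k :> R.
Proof.
move=> kT; rewrite !coef_poly !ltnS kT (ltnW kT) factS natrM exprS.
have f0 : (k`!%:R : R) != 0 by rewrite pnatr_eq0 -lt0n fact_gt0.
have k0 : (k.+1%:R : R) != 0 by rewrite pnatr_eq0.
by rewrite -mulr_natr; field; rewrite f0 nat1r k0.
Qed.

(** Logarithmic derivatives add up under products: multiplying by exp (c t) adds c
    to the derivative of the cumulant generating function. *)
Lemma log_deriv_texp (F t : {poly R}) T c :
  (forall k, (k < T)%N -> F`_k.+1 *+ k.+1 = (F * t)`_k) ->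
  forall k, (k < T)%N ->
    (F * texp T c)`_k.+1 *+ k.+1 = (F * texp T c * (t + c%:P))`_k.
Proof.
move=> hF k kT; rewrite -coef_deriv derivM.
have -> : F * texp T c * (t + c%:P) = F * t * texp T c + F * (c%:P * texp T c) by ring.
rewrite !coefD; congr (_ + _); rewrite !coefM; apply: eq_bigr => i _.
  by rewrite coef_deriv hF// (leq_ltn_trans _ kT)// -ltnS.
by rewrite coef_deriv texp_deriv ?coefCM// (leq_ltn_trans _ kT)// leq_subr.
Qed.

End Centering.

Section CumulantLimit.
Variables (R : realFieldType) (T : nat) (v : R) (M t : nat -> nat -> R) (g : nat -> R).
Hypothesis M0 : forall n, M n 0%N = 1.
Hypothesis MS : forall n k, (k < T)%N ->
  M n k.+1 *+ k.+1 = \sum_(i < k) M n i * t n (k - i)%N.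
Hypothesis t_lim : forall k, (0 < k <= T)%N ->
  asym (fun n => t n k) (fun=> if k == 1%N then v else 0).
Hypothesis g0 : g 0%N = 1.
Hypothesis gS : forall k, g k.+1 = k%:R * v * g k.-1.

(** Moments are polynomials in the cumulants; with a single nonzero limit cumulant
    the recursion becomes that of the Gaussian moments. *)
Lemma cumulant_limit k : (k <= T)%N ->
  asym (fun n => M n k) (fun=> g k / k`!%:R).
Proof.
elim/ltn_ind: k => -[|k] IH kT.
  apply: (asym_ext (asym_cst 1)); exists 0%N => n _.
  by rewrite M0 g0 fact0 divr1.
have hs : asym (fun n => \sum_(i < k) M n i * t n (k - i)%N)
  (fun n => \sum_(i < k) (g i / i`!%:R) * (if (k - i == 1)%N then v else 0)).
  apply: asym_sum => i; apply: asymM.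
    by apply: IH; [rewrite ltnS ltnW|rewrite ltnW// (ltn_trans _ kT)].
  apply: t_lim; rewrite subn_gt0 ltn_ord (leq_trans (leq_subr _ _))//.
  exact: ltnW.
apply: (asym_ext (asymZ (k.+1%:R)^-1 hs)); exists 0%N => n _.
rewrite -MS//; split; first by rewrite -(mulr_natl (M n _)) mulKf// pnatr_eq0.
rewrite gS factS natrM.
have k0 : (k.+1%:R : R) != 0 by rewrite pnatr_eq0.
case: k {IH kT hs} k0 => [|k] k0; first by rewrite big_ord0 mulr0 !mul0r.
rewrite big_ord_recr/= subSnn eqxx big1 ?add0r => [|i _].
  rewrite factS natrM.
  have f0 : (k`!%:R : R) != 0 by rewrite pnatr_eq0 -lt0n fact_gt0.
  have k1 : (k.+1%:R : R) != 0 by rewrite pnatr_eq0.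
  by field; rewrite f0 nat1r k1 -natrD; exact: k0.
have -> : (k.+1 - i == 1)%N = false by have := ltn_ord i; lia.
by rewrite mulr0.
Qed.

End CumulantLimit.

Section VanishesTopology.
Variable R : realType.

Lemma vanishesP (u : nat -> R) (l : R) :
  u @ \oo --> l <-> vanishes (fun n => u n - l).
Proof.
split=> [/cvgrPdist_le h e e0|h].
  have [N _ hN] := h e e0; exists N => n Nn; rewrite distrC; exact: hN.
apply/cvgrPdist_le => e e0; have [N hN] := h e e0.
by exists N => // n Nn; rewrite distrC; exact: hN.
Qed.

(** Along a near-diagonal sequence only finitely many shifts s occur, so the
    pointwise hypotheses are uniform. *)
Lemma cvg_near_diag (u : nat -> nat -> R) (l : R) :
  (forall s : int, (fun n : nat => u n `|(n%:Z + s)%R|%N) @ \oo --> l) ->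
  forall r, near_diag r -> vanishes (fun n => u n.+1 (r n) - l).
Proof.
move=> hu r [L [n0 hr]] e e0.
(* for large n, r n = n.+1 + s for one of the shifts s = i - L.+1 *)
have /choice[N hN] : forall i : 'I_(L + L).+2, exists N, forall n, (N <= n)%N ->
    `|u n `|(n%:Z + (i%:Z - L.+1%:Z))%R|%N - l| <= e.
  by move=> i; have /vanishesP := hu (i%:Z - L.+1%:Z)%R; apply.
exists (maxn (n0 + L) (\max_i N i)) => n; rewrite geq_max => /andP[n0n Nn].
have /andP[h1 h2] := hr n (leq_trans (leq_addr _ _) n0n).
have iL : (r n + L - n < (L + L).+2)%N by lia.
pose i := Ordinal iL; have := hN i n.+1 (leq_trans (leq_bigmax i) (leq_trans Nn (leqnSn n))).
have -> // : `|(n.+1%:Z + (i%:Z - L.+1%:Z))%R|%N = r n.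
by rewrite /i/=; lia.
Qed.

End VanishesTopology.

Section CentralLimit.
Variables (R : realType) (m : nat).
Variables (mu : nat -> {measure set (measurableTypeR R) -> \bar R})
  (w : nat -> 'I_m -> measurableTypeR R -> R)
  (mus : nat -> 'I_m -> {measure set (measurableTypeR R) -> \bar R}).
Hypotheses (w_meas : forall n j, measurable_fun setT (w n j))
  (w_ge0 : forall n j x, 0 <= w n j x)
  (mus_density : forall n j (A : set (measurableTypeR R)), measurable A ->
     mus n j A = (\int[mu n]_(x in A) (w n j x)%:E)%E)
  (mus_moments : forall n, finite_moments (mus n))
  (mus_perfect : forall n, perfect (mus n)).
Variables (a b : nat -> multi_index m -> 'I_m -> R).
Hypothesis ab_rec : forall n, nearest_neighbor_recurrence (mus n) (a n) (b n).
Variable k : nat -> multi_index m.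
Hypotheses (k_size : forall n, mi_size (k n) = n)
  (k_path : forall n, exists j : 'I_m, k n.+1 = mi_succ (k n) j).
Variables (alim blim : 'I_m -> R).
Hypotheses (a_lim : forall (j : 'I_m) (s : int),
     (fun n : nat => a n (k `|(n%:Z + s)%R|%N) j) @ \oo --> alim j)
  (b_lim : forall (j : 'I_m) (s : int),
     (fun n : nat => b n (k `|(n%:Z + s)%R|%N) j) @ \oo --> blim j).
Variables (d : nat -> measure_display) (Omega : forall n, measurableType (d n))
  (P : forall n, probability (Omega n) R)
  (X : forall n, {RV P n >-> n.-tuple (measurableTypeR R)}).
Hypothesis X_mope : forall n, is_mope (mu n) (w n) (k n) (distribution (P n) (X n)).
Variables (f : {poly R}) (deg : nat).
Hypothesis size_f : (size f <= deg.+1)%N.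

Let S (n : nat) (o : Omega n) : R := \sum_(i < n) f.[tnth (X n o) i].
Let mean n := Rintegral (P n) setT (@S n).
Let Y n (o : Omega n) : R := S o - mean n.
Let p n r := path_mop (mus n.+1) k r.
Let hp := hnum alim blim f deg %/ hden blim deg.
Let hr := hnum alim blim f deg %% hden blim deg.
(** The second cumulant in the limit. *)
Definition limit_variance : R := model_variance hp hr (hden blim deg) deg.

Section Truncation.
Variable T : nat.
Let K := (T.+1 * deg).+1.
Let KT : (T * deg <= K)%N. Proof. by rewrite /K mulSn; lia. Qed.
Let Hent n : nat -> nat -> R := opentries p (fun _ q => f * q) n.
Let HM n := bmx (n.+1 + K) (Hent n).
Let D n : nat -> 'M[R]_(n.+1, K) := sval (cid (riccati_exists
  (ulsubmx (HM n)) (ursubmx (HM n)) (dlsubmx (HM n)) (drsubmx (HM n)))).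
Let ricD n T' : block_riccati T' (Hent n) (D n).
Proof. exact: (svalP (cid (riccati_exists
  (ulsubmx (HM n)) (ursubmx (HM n)) (dlsubmx (HM n)) (drsubmx (HM n))))). Qed.
Let crn n := corner (ulsubmx (HM n)) (ursubmx (HM n)) (dlsubmx (HM n)) (drsubmx (HM n)).
Let F n : {poly R} := \det (fpoly T.+1 (crn n)).
Let t n := trace_coef (ulsubmx (HM n)) (dlsubmx (HM n)) (D n).

(** The system of index n + 1 is used for the matrix of size n + 1, so that the
    blocks are never empty. *)
Lemma moments_S n l : (l <= T)%N ->
  (P n.+1).-integrable setT (EFin \o (fun o => S o ^+ l)) /\
  Rintegral (P n.+1) setT (fun o => @S n.+1 o ^+ l) / l`!%:R = (F n)`_l.
Proof.
move=> lT.
have /choice[J hJ] : forall c : 'I_n.+1, exists jl : 'I_m * nat, (jl.2 < k n.+1 jl.1)%N /\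
    nth (fun=> 0%R) (mope_functions (w n.+1) (k n.+1)) c =
    (fun x : R => x ^+ jl.2 * w n.+1 jl.1 x).
  by move=> c; apply: mope_functions_nth; rewrite k_size.
have [lk k_lk] := choice k_path.
exact: (moment_corner_det (@w_meas n.+1) (@w_ge0 n.+1) (@mus_density n.+1)
  (@mus_moments n.+1) (k_size n.+1) (@X_mope n.+1)
  (size_path_mop (mus_perfect n.+1) k_size) (monic_path_mop (mus_perfect n.+1) k)
  (fun r j i => @path_orth _ _ _ (mus_moments n.+1) (mus_perfect n.+1) _ _ k_lk n.+1 r j i)
  (fun c => (hJ c).1) (fun c => (hJ c).2) size_f KT lT).
Qed.

Let mean0 n : (0 < T)%N -> mean n.+1 = t n 0.
Proof.
move=> T0; have [_] := @moments_S n 1 T0; rewrite divr1.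
under eq_Rintegral do rewrite expr1.
have [_] := @moments_S n 0 isT; rewrite divr1 => F0; rewrite /mean => ->.
(* the first coefficient of the logarithmic derivative *)
have := det_corner_log_deriv (ricD n) T0; rewrite big_ord1 subn0 -/(F n) mulr1n => ->.
rewrite -F0; under eq_Rintegral do rewrite expr0.
rewrite Rintegral_cst// mul1r [X in fine X](@probability_setT _ _ _ (P n.+1)).
by rewrite mul1r.
Qed.

Let Mc n l : R := (F n * texp T (- mean n.+1))`_l.

Lemma moments_Y n l : (l <= T)%N ->
  (P n.+1).-integrable setT (EFin \o (fun o => @Y n.+1 o ^+ l)) /\
  Rintegral (P n.+1) setT (fun o => @Y n.+1 o ^+ l) = Mc n l * l`!%:R.
Proof.
move=> lT.
have f0 i : (i`!%:R : R) != 0 by rewrite pnatr_eq0 -lt0n fact_gt0.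
pose c i := l`!%:R / i`!%:R * (texp T (- mean n.+1))`_(l - i).
have YE o : @Y n.+1 o ^+ l = \sum_(i < l.+1) c i * @S n.+1 o ^+ i.
  (* powers of S - mean are coefficients of exp (t S) exp (- t mean) *)
  have := @prod_texp _ T _ [:: S o; - mean n.+1] id l lT.
  rewrite !big_cons !big_nil mulr1 addr0 -/(Y o) => E.
  rewrite -[LHS](divfK (f0 l)) -E coefM mulr_suml; apply: eq_bigr => i _.
  have il : (i <= T)%N by rewrite (leq_trans _ lT)// -ltnS.
  rewrite [(texp T (S o))`_i]coef_poly ltnS il /c.
  by have := f0 i; set x := i`!%:R => x0; field.
have iS (i : 'I_l.+1) : (P n.+1).-integrable setT (EFin \o (fun o => c i * @S n.+1 o ^+ i)).
  apply: integrable_Rscale; have [|//] := @moments_S n i.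
  by rewrite (leq_trans _ lT)// -ltnS.
have YF : (fun o => @Y n.+1 o ^+ l) = (fun o => \sum_(i < l.+1) c i * @S n.+1 o ^+ i).
  by apply/funext => o; exact: YE.
rewrite YF; split; first exact: integrable_Rsum.
rewrite Rintegral_sum// /Mc coefM mulr_suml; apply: eq_bigr => i _.
have iT : (i <= T)%N by rewrite (leq_trans _ lT)// -ltnS.
have [iSi <-] := @moments_S n i iT.
by rewrite RintegralZl// /c; have := f0 i; set x := i`!%:R => x0; field.
Qed.

Lemma Mc_recursion n l : (l < T)%N ->
  Mc n l.+1 *+ l.+1 = \sum_(i < l) Mc n i * t n (l - i)%N.
Proof.
move=> lT; have T0 : (0 < T)%N by exact: leq_trans lT.
(* centering replaces t n 0, which is the mean, by 0 *)
pose tp := \poly_(i < T) t n i.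
have hF i : (i < T)%N -> (F n)`_i.+1 *+ i.+1 = (F n * tp)`_i.
  move=> iT; rewrite (det_corner_log_deriv (ricD n) iT) coefM.
  apply: eq_bigr => j _; congr (_ * _); rewrite coef_poly.
  by rewrite (leq_ltn_trans (leq_subr _ _) iT).
rewrite (log_deriv_texp _ hF lT) coefM big_ord_recr/= subnn.
rewrite coefD coefC eqxx coef_poly T0 mean0// subrr mulr0 addr0.
apply: eq_bigr => i _; congr (_ * _); first by rewrite /Mc mean0.
rewrite coefD coefC coef_poly (leq_ltn_trans (leq_subr _ _) lT).
by have := ltn_ord i; rewrite -subn_gt0 lt0n => /negbTE ->; rewrite addr0.
Qed.

(** For l = 0 the trace of H11 would enter, but that is the mean, removed by
    centering. *)
Lemma t_asym l : (0 < l <= T)%N ->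
  asym (fun n => t n l) (fun=> if l == 1%N then limit_variance else 0).
Proof.
move=> /andP[l0 lT]; have [lk k_lk] := choice k_path.
pose beta r := blim (lk r).
pose O q := opH hp hr (hden blim deg) q.
pose G : nat -> nat -> nat -> R := opentries (fun=> newton beta) (fun _ q => O q).
have mf := @masym_f _ _ p (fun n r j => path_v (mus n.+1) (a n.+1) k r j)
  (fun n r j => a n.+1 (k r) j) (fun n r j => b n.+1 (k r) j) lk alim blim
  (fun n r => size_path_mop (mus_perfect n.+1) k_size r)
  (fun n r => monic_path_mop (mus_perfect n.+1) k r)
  (fun n r => path_rec (ab_rec n.+1) k_lk r)
  (fun n j => path_v0 (mus n.+1) (a n.+1) k_size j)
  (fun n r j => path_vS (mus_moments n.+1) (mus_perfect n.+1) (ab_rec n.+1) k_lk r j)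
  (fun j r hr => @cvg_near_diag R (fun n r => a n (k r) j) (alim j) (@a_lim j) r hr)
  (fun j r hr => @cvg_near_diag R (fun n r => b n (k r) j) (blim j) (@b_lim j) r hr)
  f deg size_f.
have [c hc] := flimop_opH beta alim blim f deg.
have mG : masym Hent G.
  move=> r s nr ns; have [L [n0 hs]] := ns.
  apply: (asym_ext (mf r s nr ns)); exists (n0 + (L + c))%N => n hn; split=> //.
  rewrite /opentries/= hc//.
  have /andP[h1 _] := hs n (leq_trans (leq_addr _ _) hn); lia.
have mW := monic_hden blim deg.
have sr : (size hr < size (hden blim deg))%N by rewrite ltn_modp monic_neq0.
have sp : (size hp <= deg.+1)%N by exact: (size_hpol alim blim size_f).
have bH n r s : (r + deg < s)%N -> Hent n r s = 0.
  move=> rs; apply: crd_ge; apply: leq_trans (size_polyMleq _ _) _.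
  rewrite (size_path_mop (mus_perfect n.+1) k_size); move: rs size_f.
  by move: (size f) => x; lia.
have bG n r s : (r + deg < s)%N -> G n r s = 0.
  move=> rs; apply: crd_ge; apply: leq_trans (size_polyD _ _) _; rewrite geq_max.
  apply/andP; split.
    apply: leq_trans (size_polyMleq _ _) _; rewrite size_newton; move: rs sp.
    by move: (size hp) => x; lia.
  apply: leq_trans (size_toeplitz_small _ mW sr) _; rewrite size_newton/=.
  by move: rs; lia.
pose E n : nat -> 'M[R]_(n.+1, K) := sval (cid (riccati_exists
  (ulsubmx (bmx (n.+1 + K) (G n))) (ursubmx (bmx (n.+1 + K) (G n)))
  (dlsubmx (bmx (n.+1 + K) (G n))) (drsubmx (bmx (n.+1 + K) (G n))))).
have ricE n T' : block_riccati T' (G n) (E n).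
  exact: (svalP (cid (riccati_exists
  (ulsubmx (bmx (n.+1 + K) (G n))) (ursubmx (bmx (n.+1 + K) (G n)))
  (dlsubmx (bmx (n.+1 + K) (G n))) (drsubmx (bmx (n.+1 + K) (G n)))))).
apply: (asym_ext (asym_riccati_trace mG bH bG (fun n => ricD n T) (fun n => ricE n T) lT)).
exists (2 * (T * deg) + deg)%N => n hn; split.
  by rewrite /t /trace_coef (gtn_eqF l0) add0r.
have l0T : (0 < l <= T)%N by rewrite l0.
exact: (trace_coef_model mW sr sp hn (ltnSn _) (ricE n T) l0T).
Qed.

Lemma Mc_limit (g : nat -> R) : g 0%N = 1 ->
  (forall l, g l.+1 = l%:R * limit_variance * g l.-1) ->
  forall l, (l <= T)%N -> asym (fun n => Mc n l) (fun=> g l / l`!%:R).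
Proof.
move=> g0 gS l lT; apply: (cumulant_limit _ Mc_recursion t_asym g0 gS lT) => n.
rewrite /Mc coefM big_ord1 texp0 mulr1.
have [_ <-] := @moments_S n 0 isT; rewrite divr1; under eq_Rintegral do rewrite expr0.
by rewrite Rintegral_cst// mul1r [X in fine X](@probability_setT _ _ _ (P n.+1)).
Qed.

End Truncation.

Lemma integrable_moments_Y n l :
  (P n.+1).-integrable setT (EFin \o (fun o => @Y n.+1 o ^+ l)).
Proof. by have [] := @moments_Y l n l (leqnn l). Qed.

Lemma moments_Y_limit (g : nat -> R) : g 0%N = 1 ->
  (forall l, g l.+1 = l%:R * limit_variance * g l.-1) ->
  forall l, vanishes (fun n => Rintegral (P n.+1) setT (fun o => @Y n.+1 o ^+ l) - g l).
Proof.
move=> g0 gS l.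
have [h _] := asymZ (l`!%:R) (@Mc_limit l g g0 gS l (leqnn l)).
apply: vanishes_ext h; exists 0%N => n _.
have [_ ->] := @moments_Y l n l (leqnn l).
have f0 : (l`!%:R : R) != 0 by rewrite pnatr_eq0 -lt0n fact_gt0.
by rewrite mulrC [_ * (g l / _)]mulrC divfK.
Qed.

(** It is a limit of second centered moments. *)
Lemma limit_variance_ge0 : 0 <= limit_variance.
Proof.
pose g := fix g l : R := if l is l'.+1 then
  (if l' is l''.+1 then l'%:R * limit_variance * g l'' else 0) else 1.
have gS l : g l.+1 = l%:R * limit_variance * g l.-1.
  by case: l => [|l]//=; rewrite !mul0r.
have h := moments_Y_limit (erefl : g 0%N = 1) gS 2.
have g2 : g 2%N = limit_variance by rewrite /= mulr1 mul1r.
rewrite leNgt; apply/negP => v0; have e0 : 0 < - limit_variance / 2 by lra.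
have [N hN] := h _ e0; have := hN N (leqnn N); rewrite g2.
have : 0 <= Rintegral (P N.+1) setT (fun o => @Y N.+1 o ^+ 2).
  by apply: Rintegral_ge0 => o _; rewrite sqr_ge0.
by move: (Rintegral _ _ _) => x x0; rewrite ler_norml => /andP[_]; lra.
Qed.

Lemma measurable_S n : measurable_fun setT (@S n).
Proof.
apply: measurable_sum => i; apply: (measurableT_comp (measurable_horner f)).
apply: (@measurableT_comp _ _ _ _ _ _ (fun t => tnth t i)) => //.
exact: measurable_tnth.
Qed.

Lemma meanE n : fine 'E_(P n)[S (n := n)] = mean n.
Proof. by rewrite unlock. Qed.

(** Convergence of moments to those of the Gaussian law, then
    [tested_bounded_continuous]. *)
Lemma linear_statistic_clt : cvg_in_distribution P
  (fun n o => S o - fine 'E_(P n)[S (n := n)]) (gaussian 0 limit_variance).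
Proof.
move=> h ch [B hB].
have [Q [g [QE Q1 Qmom g0 gS]]] := gaussian_moments limit_variance_ge0.
have P1 n : P n.+1 setT = 1%E by exact: probability_setT.
have mY n : measurable_fun setT (@Y n.+1).
  by apply: measurable_funB => //; exact: measurable_S.
have iQ l : Q.-integrable setT (EFin \o (fun x : measurableTypeR R => x ^+ l)).
  by have [] := Qmom l.
have Mg l : vanishes (fun n => Rintegral (P n.+1) setT (fun o => @Y n.+1 o ^+ l) -
   Rintegral Q setT (fun x : measurableTypeR R => x ^+ l)).
  by have [_ ->] := Qmom l; exact: moments_Y_limit.
have gr (a0 eps : R) : 0 < eps -> exists j, `|a0| ^+ j.*2 / j.*2`!%:R *
   Rintegral Q setT (fun x : measurableTypeR R => x ^+ j.*2) <= eps.
  move=> e0; have [j hj] := gaussian_moment_growth g0 gS a0 e0.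
  by exists j; have [_ ->] := Qmom j.*2.
have [mh iPh iQh /vanishesP vh] := @tested_bounded_continuous R (fun n => d n.+1)
  (fun n => Omega n.+1) (fun n => P n.+1) (fun n => @Y n.+1) Q P1 Q1 mY
  integrable_moments_Y iQ Mg gr h B ch hB.
rewrite -QE; have <- : (Rintegral Q setT (fun x : measurableTypeR R => h x))%:E =
   (\int[Q]_x (h x)%:E)%E.
  by rewrite /Rintegral fineK//; exact: integrable_fin_num.
rewrite -(cvg_shiftn 1) /=.
have E : (Rintegral (P n.+1) setT (fun o => h (@Y n.+1 o)))%:E @[n --> \oo] -->
    (Rintegral Q setT (fun x : measurableTypeR R => h x))%:E.
  by apply: cvg_EFin => //; exact: nearW.
apply: cvg_trans E; apply: near_eq_cvg; apply: nearW => n /=.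
rewrite addn1 meanE unlock /Rintegral fineK//.
exact: integrable_fin_num.
Qed.

End CentralLimit.

Theorem theorem1p3 (R : realType) (m : nat) (m_gt0 : (0 < m)%N)
  (mu : nat -> {measure set (measurableTypeR R) -> \bar R})
  (w : nat -> 'I_m -> measurableTypeR R -> R)
  (mus : nat -> 'I_m -> {measure set (measurableTypeR R) -> \bar R})
  (w_meas : forall n j, measurable_fun setT (w n j))
  (w_ge0 : forall n j x, 0 <= w n j x)
  (mus_density : forall n j (A : set (measurableTypeR R)), measurable A ->
     mus n j A = (\int[mu n]_(x in A) (w n j x)%:E)%E)
  (mus_moments : forall n, finite_moments (mus n))
  (mus_perfect : forall n, perfect (mus n))
  (a b : nat -> multi_index m -> 'I_m -> R)
  (ab_rec : forall n, nearest_neighbor_recurrence (mus n) (a n) (b n))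
  (k : nat -> multi_index m)
  (k_size : forall n, mi_size (k n) = n)
  (k_path : forall n, exists j : 'I_m, k n.+1 = mi_succ (k n) j)
  (nu : 'I_m -> R)
  (nu_01 : forall j, 0 <= nu j <= 1)
  (nu_size : \sum_(j < m) nu j = 1)
  (k_nu : forall j, (fun n : nat => (k n j)%:R / n%:R : R) @ \oo --> nu j)
  (alim blim : 'I_m -> R)
  (* [n + s] may be negative for finitely many [n] only; its absolute value
     makes it an index in these cases *)
  (a_lim : forall (j : 'I_m) (s : int),
     (fun n : nat => a n (k `|(n%:Z + s)%R|%N) j) @ \oo --> alim j)
  (b_lim : forall (j : 'I_m) (s : int),
     (fun n : nat => b n (k `|(n%:Z + s)%R|%N) j) @ \oo --> blim j)
  (gamma : R -> R[i])
  (gamma_contour : simple_closed_contour gamma)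
  (gamma_b : forall j, goes_around_ccw gamma (blim j)%:C)
  (gamma_0 : goes_around_ccw gamma 0)
  (d : nat -> measure_display)
  (Omega : forall n, measurableType (d n))
  (P : forall n, probability (Omega n) R)
  (X : forall n, {RV P n >-> n.-tuple (measurableTypeR R)})
  (X_mope : forall n, is_mope (mu n) (w n) (k n) (distribution (P n) (X n)))
  (f : {poly R}) :
  let fhat (l : int) : R[i] := symbol_coef alim blim gamma f l in
  let S (n : nat) (o : Omega n) : R := \sum_(i < n) f.[tnth (X n o) i] in
  exists sigma2 : R,
    [/\ 0 <= sigma2,
        complex_series_cvg
          (fun l : nat => l%:R * fhat l%:Z * fhat (- l%:Z)) sigma2%:C &
        cvg_in_distribution P
          (fun n o => S n o - fine 'E_(P n)[S n]) (gaussian 0 sigma2)].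
Proof.
move=> fhat S.
have size_f : (size f <= (size f).+1)%N by exact: leqnSn.
exists (limit_variance alim blim f (size f)); split.
- exact: (limit_variance_ge0 w_meas w_ge0 mus_density mus_moments mus_perfect ab_rec
    k_size k_path a_lim b_lim X_mope size_f).
- exact: (variance_series _ gamma_contour gamma_b gamma_0 size_f).
- exact: (linear_statistic_clt w_meas w_ge0 mus_density mus_moments mus_perfect ab_rec
    k_size k_path a_lim b_lim X_mope size_f).
Qed.
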